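(* Let $d\ge 3$, $\mathbf{y}\in\mathbf{R}^d$ and $r>0$. Then $\mathrm{M}_f(\mathbf{y},r)\subseteq\mathrm{BP}_{eq}(\mathbf{y},r)$, where $f(t)=t^{(d-2)/d}$, $t\in[0,1]$.
   Context: $B_r(\mathbf{y})$ is the open ball in $\mathbf{R}^d$ with centre $\mathbf{y}$ and radius $r$, $\bar B_r(\mathbf{y})$ its closure, $\mathrm{mes}_d$ Lebesgue measure. Harmonic capacity of a compact set $E\subset\mathbf{R}^d$: $\mathrm{cap}(E)=\inf\{\int_{\mathbf{R}^d}|\nabla u|^2\,\mathrm{d}\mathbf{x}:\ u\in C^\infty(\mathbf{R}^d),\ u\ge 1\text{ on }E,\ u(\mathbf{x})\to 0\text{ as }|\mathbf{x}|\to\infty\}$; it is extended to Borel sets in the standard way, $\mathrm{cap}(A)=\sup\{\mathrm{cap}(E): E\subseteq A\text{ compact}\}$. The base polyhedron $\mathrm{BP}(\bar B_r(\mathbf{y}))$ is the set of all non-negative additive set functions $\mu$ on the Borel subsets of $\bar B_r(\mathbf{y})$ such that $\mu(A)\le\mathrm{cap}(A)$ for all Borel $A\subseteq\bar B_r(\mathbf{y})$ and $\mu(\bar B_r(\mathbf{y}))=\mathrm{cap}(\bar B_r(\mathbf{y}))$. $\mathrm{BP}_{eq}(\mathbf{y},r)$ is the set of those $\mu\in\mathrm{BP}(\bar B_r(\mathbf{y}))$ that are Radon measures equivalent to (mutually absolutely continuous with) Lebesgue measure on $\bar B_r(\mathbf{y})$. $m_{d,r}(A)=\mathrm{mes}_d(A)/\mathrm{mes}_d(B_r(\mathbf{y}))$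 is normalized Lebesgue measure on $\bar B_r(\mathbf{y})$. $\mathcal{S}(\bar B_r(\mathbf{y}),m_{d,r})$ is the set of measure preserving functions, i.e. measurable $s:\bar B_r(\mathbf{y})\to[0,1]$ such that $m_{d,r}(s^{-1}(B))$ equals the Lebesgue measure of $B$ for every Borel $B\subseteq[0,1]$. $\mathrm{M}_f(\mathbf{y},r)$ is the set of absolutely continuous measures on $\bar B_r(\mathbf{y})$ whose densities with respect to $m_{d,r}$ run over $$\mathrm{cap}(\bar B_r(0))\cdot\overline{\mathrm{co}}\big(\{f'\circ s:\ s\in\mathcal{S}(\bar B_r(\mathbf{y}),m_{d,r})\}\big),$$ where $\mathrm{co}$ is the convex hull and the closure is taken in $L_1(\bar B_r(\mathbf{y}),m_{d,r})$. *)

(* Defs.v *)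
From HB Require Import structures.
From mathcomp Require Import all_boot all_order all_algebra.
From mathcomp Require Import all_classical all_reals all_analysis.

Set Implicit Arguments.
Unset Strict Implicit.
Unset Printing Implicit Defensive.

Import Order.TTheory GRing.Theory Num.Theory.
Import numFieldNormedType.Exports.

Local Open Scope classical_set_scope.
Local Open Scope ring_scope.

HB.instance Definition _ (R : realType) (d : nat) :=
  @isMeasurable.Build (sigma_display (@open 'rV[R]_d)) 'rV[R]_d
    <<s @open 'rV[R]_d >>
    (@sigma_algebra0 _ setT _)
    (@sigma_algebraC 'rV[R]_d _)
    (@sigma_algebra_bigcup _ setT _).

Section lebesgue_measure_rV.
Context {R : realType}.

Lemma open_measurable_rV d (U : set 'rV[R]_d) : open U -> measurable U.
Proof. exact: sub_sigma_algebra. Qed.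

Definition obox d (a b : 'rV[R]_d) : set 'rV[R]_d :=
  [set x | forall i, a 0 i < x 0 i < b 0 i].

Lemma open_obox d (a b : 'rV[R]_d) : open (obox a b).
Proof.
rewrite openE => x xab; rewrite /interior.
suff : \forall z \near (nbhs x), forall i, a 0 i < (z : 'rV[R]_d) 0 i < b 0 i by [].
apply: filter_forall => i.
have oI : open (`]a 0 i, b 0 i[%classic : set R) by exact: itv_open.
have xI : `]a 0 i, b 0 i[%classic (x 0 i) by rewrite /= in_itv; exact: xab.
have H : nbhs x ((fun z : 'rV[R]_d => z 0 i) @^-1` `]a 0 i, b 0 i[%classic).
  exact: coord_continuous (open_nbhs_nbhs (conj oI xI)).
by near=> z; have := near H z; rewrite /= in_itv /=; apply.
Unshelve. all: by end_near. Qed.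

Lemma open_rV_obox d (U : set 'rV[R]_d) : open U ->
  U = \bigcup_(q in [set q : 'rV[rat]_d * 'rV[rat]_d |
         obox (map_mx ratr q.1) (map_mx ratr q.2) `<=` U])
       obox (map_mx ratr q.1) (map_mx ratr q.2).
Proof.
move=> oU; apply/seteqP; split=> [x Ux|x [q /= qU]]; last exact: qU.
have /nbhs_ballP[e /= e0 eU] : nbhs x U by exact: open_nbhs_nbhs.
have lo i : {q : rat | x 0 i - e < ratr q < x 0 i}.
  have H : x 0 i - e < x 0 i by rewrite ltrBlDr ltrDl.
  by apply: cid; have [q qi] := rat_in_itvoo H; exists q; rewrite in_itv in qi.
have hi i : {q : rat | x 0 i < ratr q < x 0 i + e}.
  have H : x 0 i < x 0 i + e by rewrite ltrDl.
  by apply: cid; have [q qi] := rat_in_itvoo H; exists q; rewrite in_itv in qi.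
exists (\row_i sval (lo i), \row_i sval (hi i)) => /=; last first.
  move=> i; rewrite !mxE; case: (lo i) => p /= /andP[_ ->].
  by case: (hi i) => q /= /andP[->].
move=> y xy; apply: eU; split=> // i j; rewrite ord1.
have := xy j; rewrite !mxE; case: (lo j) => p /= /andP[p1 p2].
case: (hi j) => q /= /andP[q1 q2] /andP[y1 y2].
rewrite /ball /= ltr_distlC; apply/andP; split.
  exact: lt_trans y1.
exact: lt_trans y2 _.
Qed.

Definition rV_cons d (p : measurableTypeR R * 'rV[R]_d) : 'rV[R]_d.+1 :=
  row_mx (p.1 : R)%:M p.2.

Lemma rV_cons_obox d (a b : 'rV[R]_(1 + d)) :
  @rV_cons d @^-1` obox a b =
    `]a 0 0, b 0 0[ `*` obox (rsubmx a) (rsubmx b).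
Proof.
apply/seteqP; split=> -[t x] /=.
  move=> H; split => /=.
    by have := H 0; rewrite /rV_cons mxE; case: splitP => // j _;
      rewrite ord1 mxE eqxx mulr1n in_itv.
  move=> i; have := H (rshift 1 i).
  by rewrite /rV_cons row_mxEr !mxE.
case=> /=; rewrite in_itv /= => t1 x1 i.
case: (splitP (i : 'I_(1 + d))) => j ij.
  have -> : i = lshift d j by exact: val_inj.
  by rewrite /rV_cons row_mxEl ord1 mxE eqxx mulr1n lshift0.
have -> : i = rshift 1 j by exact: val_inj.
by have := x1 j; rewrite /rV_cons row_mxEr !mxE.
Qed.

Lemma measurable_rV_cons d : measurable_fun setT (@rV_cons d).
Proof.
apply: (@measurability _ _ _ _ setT (@rV_cons d) (@open 'rV[R]_d.+1)) => //.
move=> _ [U oU <-]; rewrite setTI (open_rV_obox oU) preimage_bigcup.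
rewrite bigcup_mkcond.
apply: countable_bigcupT_measurable; first exact: countableP.
move=> q; case: ifP => // _; rewrite rV_cons_obox.
apply: measurableX; first exact: measurable_itv.
by apply: open_measurable_rV; exact: open_obox.
Qed.

Definition measure_rV_cons d (m : set 'rV[R]_d -> \bar R) :
    set 'rV[R]_d.+1 -> \bar R :=
  pushforward (lebesgue_measure \x^ m)%E (@rV_cons d).

HB.instance Definition _ d (m : {measure set 'rV[R]_d -> \bar R}) :=
  Measure.copy (measure_rV_cons m)
    (measure_function_pushforward__canonical__measure_function_Measure
       (lebesgue_measure \x^ m)%E (@measurable_rV_cons d)).

(* Lebesgue measure on the Borel sets of R^d, as the d-fold product of the
   one-dimensional one; lebesgue_rV_obox checks the normalization. *)
Fixpoint lebesgue_rV d : {measure set 'rV[R]_d -> \bar R} :=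
  match d with
  | 0 => \d_(0 : 'rV[R]_0)
  | n.+1 => measure_rV_cons (lebesgue_rV n)
  end.

Lemma lebesgue_rV_obox d (a b : 'rV[R]_d) : (forall i, a 0 i <= b 0 i) ->
  lebesgue_rV d (obox a b) = (\prod_i (b 0 i - a 0 i))%:E.
Proof.
elim: d a b => [|d IH] a b ab /=.
  by rewrite big_ord0 diracE mem_set // => -[].
rewrite /measure_rV_cons /pushforward rV_cons_obox product_measure2E; last 2 first.
- exact: (measurable_itv `]a 0 0, b 0 0[).
- by apply: open_measurable_rV; exact: open_obox.
rewrite /= IH; last by move=> i; rewrite !mxE.
rewrite lebesgue_measure_itv /= lte_fin big_ord_recl.
have -> : \prod_i (rsubmx (b : 'rV_(1 + d)) 0 i - rsubmx (a : 'rV_(1 + d)) 0 i) =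
    \prod_(i < d) (b 0 (lift ord0 i) - a 0 (lift ord0 i)).
  by apply: eq_bigr => i _; rewrite !mxE rshift1.
have [_|ba] := ltP (a 0 0) (b 0 0); first by rewrite -EFinB -EFinM.
have -> : b 0 0 = a 0 0 by apply/eqP; rewrite eq_le ba ab.
by rewrite subrr mul0r mul0e.
Qed.

End lebesgue_measure_rV.

Section defs.
Context {R : realType} {d : nat}.
Implicit Types (x y : 'rV[R]_d) (r : R) (A E K : set 'rV[R]_d)
  (u : 'rV[R]_d -> R) (mu : set 'rV[R]_d -> \bar R).

(* The norm of the library on 'rV[R]_d is the sup norm. *)
Definition enorm x : R := Num.sqrt (\sum_i x 0 i ^+ 2).

Definition eball y r : set 'rV[R]_d := [set x | enorm (x - y) < r].

Definition ecball y r : set 'rV[R]_d := closure (eball y r).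

Definition partial_derivative (i : 'I_d) u : 'rV[R]_d -> R :=
  fun x => 'D_(delta_mx 0 i) u x.

Definition iter_partial (s : seq 'I_d) u : 'rV[R]_d -> R :=
  foldr partial_derivative u s.

(* C^oo: all iterated partial derivatives exist and are continuous. *)
Definition smooth u : Prop := forall s : seq 'I_d,
  continuous (iter_partial s u) /\
  forall i x, derivable (iter_partial s u) x (delta_mx 0 i).

Definition dirichlet u : \bar R :=
  (\int[lebesgue_rV d]_x (\sum_i partial_derivative i u x ^+ 2)%:E)%E.

Definition cap_admissible E : set ('rV[R]_d -> R) :=
  [set u | [/\ smooth u, (forall x, E x -> 1 <= u x) &
    forall e, 0 < e -> exists M, forall x, M < enorm x -> `|u x| < e]].

Definition compact_cap E : \bar R :=
  ereal_inf [set dirichlet u | u in cap_admissible E].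

Definition cap A : \bar R :=
  ereal_sup [set compact_cap E | E in [set E | compact E /\ E `<=` A]].

Lemma cap_compact E : compact E -> cap E = compact_cap E.
Proof.
move=> cE; apply/eqP; rewrite eq_le; apply/andP; split.
  apply: ge_ereal_sup => _ [F [cF FE] <-].
  apply: ereal_inf_le_tmp => _ [u [su u1 u0] <-]; exists u => //.
  by split=> // x /FE; exact: u1.
by apply: ereal_sup_ubound; exists E => //=; split.
Qed.

(* A set function on the Borel subsets of K is represented by a total map
   [set 'rV[R]_d -> \bar R] whose values elsewhere are irrelevant. *)
Definition borel_in K A : Prop := measurable A /\ A `<=` K.

Definition BP K : set (set 'rV[R]_d -> \bar R) :=
  [set mu | [/\ forall A, borel_in K A -> (0 <= mu A)%E,
    forall A B, borel_in K A -> borel_in K B -> A `&` B = set0 ->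
      mu (A `|` B) = (mu A + mu B)%E,
    forall A, borel_in K A -> (mu A <= cap A)%E &
    mu K = cap K]].

Definition radon_on K mu : Prop :=
  [/\ forall F : nat -> set 'rV[R]_d, (forall n, borel_in K (F n)) ->
        trivIset setT F -> mu (\bigcup_n F n) = (\sum_(0 <= n <oo) mu (F n))%E,
      forall E, compact E -> E `<=` K -> (mu E < +oo)%E &
      forall A, borel_in K A ->
        mu A = ereal_sup [set mu E | E in [set E | compact E /\ E `<=` A]]].

Definition BP_eq y r : set (set 'rV[R]_d -> \bar R) :=
  [set mu | [/\ BP (ecball y r) mu, radon_on (ecball y r) mu &
    forall A, borel_in (ecball y r) A ->
      (mu A = 0%E <-> lebesgue_rV d A = 0%E)]].

Lemma inv_volume_ge0 y r : 0 <= (fine (lebesgue_rV d (eball y r)))^-1.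
Proof. by rewrite invr_ge0 fine_ge0. Qed.

Definition normalized_lebesgue y r : set 'rV[R]_d -> \bar R :=
  mscale (NngNum (inv_volume_ge0 y r)) (lebesgue_rV d).

HB.instance Definition _ y r := Measure.on (normalized_lebesgue y r).

Definition measure_preserving y r : set ('rV[R]_d -> R) :=
  [set s : 'rV[R]_d -> R | [/\ measurable_fun (ecball y r) s,
    forall x, ecball y r x -> 0 <= s x <= 1 &
    forall B : set R, measurable B -> B `<=` `[0, 1] ->
      normalized_lebesgue y r (ecball y r `&` s @^-1` B) =
      lebesgue_measure B]].

Definition convex_hull (G : set ('rV[R]_d -> R)) : set ('rV[R]_d -> R) :=
  [set g : 'rV[R]_d -> R | exists n (c : 'I_n -> R) (h : 'I_n -> 'rV[R]_d -> R),
    [/\ forall i, 0 <= c i, \sum_i c i = 1, forall i, G (h i) &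
      g = fun x => \sum_i c i * h i x]].

Definition L1_closure (m : set 'rV[R]_d -> \bar R) K
    (G : set ('rV[R]_d -> R)) : set ('rV[R]_d -> R) :=
  [set g : 'rV[R]_d -> R | m.-integrable K (EFin \o g) /\
    forall e, 0 < e ->
      exists2 h, G h & (\int[m]_(x in K) `|g x - h x|%:E < e%:E)%E].

(* For f t = t `^ a with 0 < a < 1 the junk value of derive1 f 0 is harmless:
   a measure preserving s vanishes on a null set only. *)
Definition M_f (f : R -> R) y r : set (set 'rV[R]_d -> \bar R) :=
  [set mu | exists2 g : 'rV[R]_d -> R,
    L1_closure (normalized_lebesgue y r) (ecball y r)
      (convex_hull [set derive1 f \o s | s in measure_preserving y r]) g &
    forall A, borel_in (ecball y r) A ->
      mu A = (\int[normalized_lebesgue y r]_(x in A)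
                (cap (ecball 0%R r) * (g x)%:E))%E].

End defs.

(* Main.v *)
Require Import Defs.
From HB Require Import structures.
From mathcomp Require Import all_boot all_order all_algebra.
From mathcomp Require Import all_classical all_reals all_analysis.
From mathcomp Require Import measurable_realfun zify ring lra.

Set Implicit Arguments.
Unset Strict Implicit.
Unset Printing Implicit Defensive.

Import Order.TTheory GRing.Theory Num.Theory.
Import numFieldNormedType.Exports.

Local Open Scope classical_set_scope.
Local Open Scope ring_scope.

(** Write q = (d - 2) / d, w for the volume of the unit ball and m for the
    normalized Lebesgue measure on the closed ball K of radius r. For
    f(t) = t^q, layer cake turns m {s <= t} = t into
    [\int_A f' o s dm <= m(A)^q], with equality for A = K, while f' >= q on
    (0, 1]; these bounds survive convex combinations and L1 limits. Hence a
    measure in M_f is equivalent to Lebesgue measure and bounded by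
    cap(K) m(A)^q. It remains to show cap(K) m(E)^q <= cap(E) for compact E, as
    inner regularity passes from compact to Borel sets.

    This is the sharp capacity-volume inequality. Let u be a test function,
    V(t) = |{u > t}| and p = (d - 1) / d. Weighting with V(t)^(-p) the volume
    between {u > t} and its e-neighbourhood, bounded below by Brunn-Minkowski,
    and letting e tend to 0 gives
    [d w^(1/d) <= \int_{0 < u < 1} V(u)^(-p) |grad u|]. Young's inequality
    and [\int_{0 < u < 1} V(u)^(-2p) <= |E|^(-q) / q] then yield
    [d (d - 2) w^(2/d) |E|^q <= \int |grad u|^2]. For K the explicit test
    functions below show that equality is attained. *)

(** Volume scales like r^d and capacity like r^(d-2), so f(m(A)) is the fraction of cap(K) carried
    by a ball with the volume of A. Since the total mass of a measure in M_f is exactly cap(K), the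
    lower bound for compact sets must have the sharp constant: a loss in it could not be absorbed.
    The argument needs neither the coarea formula nor regular level sets. The perimeter of {u > t}
    is replaced by the volume of a thin shell, counted once level by level and once point by point.
    V may jump where u has plateaus, so only its monotonicity is used. Since u merely tends to 0 at
    infinity, its superlevel sets are bounded only for positive levels; hence the levels start at
    some s > 0, which tends to 0 at the end. The exponent p is the one for which the weight cancels
    the factor V^p from Brunn-Minkowski, and 2p = 1 + q > 1 makes the remainder in Young's
    inequality integrable. The equilibrium potential min(1, (r / |x - y|)^(d-2)) of a ball is not
    smooth across the sphere, so the capacity of K is approached along a sequence of smooth
    approximations to it. *)

(** * Slices and affine images of Lebesgue measure *)

Section lebesgue_rV_sections.
Context {R : realType}.

Lemma obox_bigcup d :
  \bigcup_n obox (const_mx (- n%:R)) (const_mx n%:R) = [set: 'rV[R]_d].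
Proof.
apply/seteqP; split => // x _.
exists (Num.truncn (\sum_i `|x 0 i|)).+1 => // i; rewrite !mxE -ltr_norml.
apply: le_lt_trans (truncnS_gt _).
by rewrite (bigD1 i) //= lerDl sumr_ge0.
Qed.

Lemma measurable_obox d (a b : 'rV[R]_d) : measurable (obox a b).
Proof. by apply: open_measurable_rV; exact: open_obox. Qed.

Lemma lebesgue_rV_sigma_finite d : sigma_finite setT (@lebesgue_rV R d).
Proof.
exists (fun n => obox (const_mx (- n%:R)) (const_mx n%:R)).
  by rewrite obox_bigcup.
move=> n; split; first exact: measurable_obox.
rewrite lebesgue_rV_obox ?ltry // => i.
by rewrite !mxE (le_trans _ (ler0n R n)) // oppr_le0.
Qed.

(* The library's Tonelli theorem needs a sigma-finite structure, which can only
   be attached to a constant, not to the Fixpoint of measures lebesgue_rV. *)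
Definition lebesgue_rV_sf d : set 'rV[R]_d -> \bar R := lebesgue_rV d.

HB.instance Definition _ d := Measure.copy (@lebesgue_rV_sf d) (lebesgue_rV d).

HB.instance Definition _ d :=
  @Measure_isSigmaFinite.Build _ _ _ (@lebesgue_rV_sf d) (@lebesgue_rV_sigma_finite d).

Lemma lebesgue_rVS d (A : set 'rV[R]_d.+1) : measurable A ->
  (lebesgue_rV d.+1 A =
   \int[lebesgue_measure]_t
     lebesgue_rV d (xsection (@rV_cons R d @^-1` A) t))%E.
Proof.
move=> mA.
have mB : measurable (@rV_cons R d @^-1` A).
  by rewrite -[X in measurable X]setTI; exact: measurable_rV_cons.
have := @indic_fubini_tonelli _ _ _ _ R
  (lebesgue_measure : {sigma_finite_measure set (measurableTypeR R) -> \bar R})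
  (@lebesgue_rV_sf d) _ mB.
by rewrite indic_fubini_tonelli_FE // indic_fubini_tonelli_GE // => /esym.
Qed.

Lemma measurable_rV_cons_section d (A : set 'rV[R]_d.+1) t : measurable A ->
  measurable (xsection (@rV_cons R d @^-1` A) t).
Proof.
move=> mA; apply: measurable_xsection.
by rewrite -[X in measurable X]setTI; exact: measurable_rV_cons.
Qed.

Lemma measurable_lebesgue_rV_section d (A : set 'rV[R]_d.+1) : measurable A ->
  measurable_fun [set: measurableTypeR R]
    (fun t => lebesgue_rV d (xsection (@rV_cons R d @^-1` A) t) : \bar R).
Proof.
move=> mA.
apply: (@measurable_fun_xsection _ _ _ _ R (@lebesgue_rV_sf d)).
by rewrite -[X in measurable X]setTI; exact: measurable_rV_cons.
Qed.

Lemma rV_cons_affine d (c : R) (b : 'rV[R]_d.+1) t x :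
  c *: rV_cons (t, x) + b =
  rV_cons (c * t + b 0 0, c *: x + rsubmx (b : 'rV_(1 + d))).
Proof.
apply/rowP => i; rewrite !mxE.
case: (splitP (i : 'I_(1 + d))) => j ij; rewrite !mxE.
  have -> : i = ord0 by apply: val_inj; rewrite /= ij ord1.
  by rewrite ord1 eqxx !mulr1n.
by congr (_ + b _ _); apply: val_inj.
Qed.

(** [c] times the preimage measure agrees with Lebesgue measure on half-open intervals, and these
    determine the measure. *)
Lemma lebesgue_measure_affine (c b : R) (A : set R) : 0 < c -> measurable A ->
  lebesgue_measure ((fun t => c * t + b) @^-1` A) =
  (c^-1%:E * lebesgue_measure A)%E.
Proof.
move=> c0 mA.
have mf : measurable_fun [set: measurableTypeR R]
    ((fun t => c * t + b) : _ -> measurableTypeR R).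
  by apply: measurable_funD => //; apply: measurable_funM.
have c0' : 0 <= c by exact: ltW.
pose mu' : {measure set (measurableTypeR R) -> \bar R} := mscale (NngNum c0')
  (measure_function_pushforward__canonical__measure_function_Measure
    (@lebesgue_measure R) mf).
have H : forall X, measurable X -> lebesgue_measure X = mu' X.
  apply: (@lebesgue_measure_unique R mu') => _ [[x y] /= _ <-].
  rewrite /mu' /= /mscale /= /pushforward.
  have -> : (fun t : R => c * t + b) @^-1` `]x, y]%classic =
      `](x - b) / c, (y - b) / c]%classic.
    apply/seteqP; split => t /=; rewrite !in_itv /=.
      by rewrite ltr_pdivrMr // ler_pdivlMr // ltrBlDr lerBrDr mulrC.
    by rewrite ltr_pdivrMr // ler_pdivlMr // ltrBlDr lerBrDr mulrC.
  rewrite !lebesgue_measure_itv /= !lte_fin ltr_pM2r ?invr_gt0 // ltrD2r.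
  case: ifP => _; last by rewrite mule0.
  rewrite -!EFinB -EFinM -mulrBl [c * _]mulrC divfK ?gt_eqF //; congr EFin; lra.
rewrite (H _ mA) /mu' /mscale /= muleA -EFinM mulVf ?gt_eqF // mul1e.
by [].
Qed.

Lemma ge0_integral_affine (c b : R) (f : R -> \bar R) : 0 < c ->
  measurable_fun setT f -> (forall t, 0 <= f t)%E ->
  (\int[lebesgue_measure]_(t in [set: R]) f (c * t + b)%R =
   c^-1%:E * \int[lebesgue_measure]_t f t)%E.
Proof.
move=> c0 mf f0.
have mg : measurable_fun [set: measurableTypeR R]
    ((fun t => c * t + b) : _ -> measurableTypeR R).
  by apply: measurable_funD => //; apply: measurable_funM.
have := @ge0_integral_pushforward _ _ _ _ R _ mg lebesgue_measure setT f
  measurableT mf (fun y _ => f0 y).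
rewrite preimage_setT /= => <-.
have ci0 : 0 <= c^-1 by rewrite invr_ge0 ltW.
rewrite -(@ge0_integral_mscale _ _ _ (@lebesgue_measure R) setT measurableT
  (NngNum ci0) f mf (fun x _ => f0 x)).
apply: eq_measure_integral => A mA _.
exact: lebesgue_measure_affine.
Qed.

Lemma continuous_measurable_rV d (T : topologicalType)
    (f : 'rV[R]_d -> T) (U : set T) :
  continuous f -> open U -> measurable (f @^-1` U).
Proof.
by move=> /continuousP cf oU; apply: open_measurable_rV; exact: cf.
Qed.

Lemma measurable_affine_rV d (c : R) (b : 'rV[R]_d) :
  measurable_fun setT (fun x : 'rV[R]_d => c *: x + b).
Proof.
apply: (@measurability _ _ _ _ setT _ (@open 'rV[R]_d)) => //.
move=> _ [U oU <-]; rewrite setTI; apply: continuous_measurable_rV => // x.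
by apply: continuousD; [exact: scaler_continuous | exact: cst_continuous].
Qed.

(** Induction on slices: an affine map acts on the first coordinate and on the remaining ones
    separately, so each step contributes one factor [c^-1] from the slices' base. *)
Lemma lebesgue_rV_affine d (c : R) (b : 'rV[R]_d) (A : set 'rV[R]_d) :
  0 < c -> measurable A ->
  lebesgue_rV d ((fun x => c *: x + b) @^-1` A) =
  ((c^-1 ^+ d)%:E * lebesgue_rV d A)%E.
Proof.
move=> c0; elim: d b A => [|d IH] b A mA.
  rewrite expr0 mul1e; have -> // : (fun x => c *: x + b) @^-1` A = A.
  by apply/seteqP; split => x /=; rewrite (_ : c *: x + b = x) //;
    apply/rowP => -[].
have mB : measurable ((fun x => c *: x + b) @^-1` A).
  by rewrite -[X in measurable X]setTI; exact: measurable_affine_rV.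
rewrite lebesgue_rVS // lebesgue_rVS //.
pose b' := rsubmx (b : 'rV_(1 + d)).
pose F t := lebesgue_rV d (xsection (@rV_cons R d @^-1` A) t).
have mF : measurable_fun setT F by exact: measurable_lebesgue_rV_section.
transitivity (\int[lebesgue_measure]_t ((c^-1 ^+ d)%:E * F (c * t + b 0 0)%R))%E.
  apply: eq_integral => t _; rewrite /F.
  rewrite -(IH b'); last exact: measurable_rV_cons_section.
  congr (lebesgue_rV d _).
  by apply/seteqP; split => x; rewrite /xsection /= !inE /= rV_cons_affine.
rewrite ge0_integralZl //; last first.
- by rewrite lee_fin exprn_ge0 // invr_ge0 ltW.
- by apply: measurableT_comp => //; apply: measurable_funD => //;
    apply: measurable_funM.
by rewrite ge0_integral_affine // muleA -EFinM exprSr.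
Qed.

End lebesgue_rV_sections.

(** * The Brunn-Minkowski inequality *)

Section brunn_minkowski.
Context {R : realType}.

(** Convexity of the power function, stated through its tangent at [w]. With [w = 1] it is
    Bernoulli's inequality; with [z = x + y] and [w = x] it extracts the first-order term of
    Brunn-Minkowski. *)
Lemma ler_expr_tangent (n : nat) (z w : R) : 0 <= z -> 0 <= w ->
  w ^+ n.+1 + n.+1%:R * w ^+ n * (z - w) <= z ^+ n.+1.
Proof.
move=> z0 w0; elim: n => [|n IH]; first by rewrite !expr1 expr0; lra.
rewrite [leRHS]exprS; apply: le_trans (ler_wpM2l z0 IH).
have : 0 <= n.+1%:R * w ^+ n * (z - w) ^+ 2.
  by rewrite mulr_ge0 ?sqr_ge0 // mulr_ge0 // exprn_ge0.
rewrite -(natr1 n.+1) !exprS => h.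
rewrite -subr_ge0; apply: le_trans h _; rewrite le_eqVlt; apply/orP; left.
by apply/eqP; ring.
Qed.

(** Jensen's inequality for the points x/a and y/b with weights a and b. The tangents are taken at
    the weighted mean [w], where the linear terms cancel. It recombines the two terms of the
    inductive step of Brunn-Minkowski. *)
Lemma ler_exprD_div (n : nat) (a b x y : R) : 0 < a -> 0 < b -> 0 <= x -> 0 <= y ->
  (x + y) ^+ n.+1 <= (a + b) ^+ n * (x ^+ n.+1 / a ^+ n + y ^+ n.+1 / b ^+ n).
Proof.
move=> a0 b0 x0 y0.
have ab0 : 0 < a + b by exact: addr_gt0.
pose w := (x + y) / (a + b).
have w0 : 0 <= w by rewrite divr_ge0 ?addr_ge0 // ltW.
have E (u c : R) : 0 < c -> u ^+ n.+1 / c ^+ n = c * (u / c) ^+ n.+1.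
  by move=> c0; rewrite expr_div_n exprS [in RHS]exprSr; field; rewrite expf_neq0 gt_eqF.
rewrite !E //.
have hx := ler_wpM2l (ltW a0) (ler_expr_tangent n (divr_ge0 x0 (ltW a0)) w0).
have hy := ler_wpM2l (ltW b0) (ler_expr_tangent n (divr_ge0 y0 (ltW b0)) w0).
have := ler_wpM2l (exprn_ge0 n (ltW ab0)) (lerD hx hy).
apply: le_trans.
have -> : a * (w ^+ n.+1 + n.+1%:R * w ^+ n * (x / a - w)) +
    b * (w ^+ n.+1 + n.+1%:R * w ^+ n * (y / b - w)) = (a + b) * w ^+ n.+1.
  have -> : a * (w ^+ n.+1 + n.+1%:R * w ^+ n * (x / a - w)) +
    b * (w ^+ n.+1 + n.+1%:R * w ^+ n * (y / b - w)) = (a + b) * w ^+ n.+1 +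
    n.+1%:R * w ^+ n * (a * (x / a) + b * (y / b) - (a + b) * w) by ring.
  have -> : a * (x / a) + b * (y / b) - (a + b) * w = 0.
    by rewrite /w; field; rewrite !gt_eqF.
  by rewrite mulr0 addr0.
by rewrite mulrA -exprSr -exprMn /w [(a + b) * _]mulrC divfK ?gt_eqF.
Qed.

Lemma lebesgue_measure_shift (b : R) (A : set R) : measurable A ->
  lebesgue_measure ((fun t => t + b) @^-1` A) = lebesgue_measure A.
Proof.
move=> mA; rewrite -[RHS]mul1e -[X in (X%:E * _)%E]invr1.
rewrite -(lebesgue_measure_affine b ltr01 mA).
by congr (lebesgue_measure _); apply/seteqP; split => t /=; rewrite mul1r.
Qed.

(* For a in A near sup A and b in B near inf B, the sets (A n ]-oo, a]) + b and
   a + (B n ]b, +oo[) are disjoint subsets of A + B. *)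
Lemma brunn_minkowski1 (A B C : set R) (k : R) :
  measurable A -> measurable B -> measurable C ->
  A !=set0 -> B !=set0 -> A `<=` `[-k, k] -> B `<=` `[-k, k] ->
  (forall a b, A a -> B b -> C (a + b)) ->
  (lebesgue_measure A + lebesgue_measure B <= lebesgue_measure C)%E.
Proof.
move=> mA mB mC A0 B0 Ak Bk ABC.
have hA : has_sup A.
  by split=> //; exists k => x /Ak /=; rewrite in_itv => /andP[].
have hB : has_inf B.
  by split=> //; exists (- k) => x /Bk /=; rewrite in_itv => /andP[].
have [oo|Cfin] := eqVneq (lebesgue_measure C) +oo%E; first by rewrite oo leey.
have {}Cfin : lebesgue_measure C \is a fin_num.
  by rewrite ge0_fin_numE // ltey.
apply/lee_addgt0Pr => e e0.
have e20 : 0 < e / 2 by rewrite divr_gt0.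
have [a Aa ea] := sup_adherent e20 hA.
have [b Bb eb] := inf_adherent e20 hB.
pose A' := A `&` `]-oo, a]; pose B' := B `&` `]b, +oo[.
have mA' : measurable A' by apply: measurableI => //; exact: measurable_itv.
have mB' : measurable B' by apply: measurableI => //; exact: measurable_itv.
have leA : (lebesgue_measure A <= lebesgue_measure A' + (e / 2)%:E)%E.
  apply: (@le_trans _ _ (lebesgue_measure (A' `|` `]a, sup A]))).
    apply: le_measure; rewrite ?inE //; first exact: measurableU.
    move=> x Ax; have [xa|ax] := leP x a; first by left; split.
    by right; rewrite /= in_itv /= ax /= ub_le_sup //; case: hA.
  apply: (le_trans (measureU2 _ _ _)) => //.
  apply: leeD2l; rewrite /= lebesgue_measure_itv /= lte_fin.
  case: ifPn => _; last by rewrite lee_fin ltW.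
  by rewrite -EFinB lee_fin; lra.
have leB : (lebesgue_measure B <= lebesgue_measure B' + (e / 2)%:E)%E.
  apply: (@le_trans _ _ (lebesgue_measure (B' `|` `[inf B, b]))).
    apply: le_measure; rewrite ?inE //; first exact: measurableU.
    move=> x Bx; have [xb|bx] := leP x b; last by left; split; rewrite //= in_itv /= bx.
    by right; rewrite /= in_itv /= xb andbT ge_inf //; case: hB.
  apply: (le_trans (measureU2 _ _ _)) => //.
  apply: leeD2l; rewrite /= lebesgue_measure_itv /= lte_fin.
  case: ifPn => _; last by rewrite lee_fin ltW.
  by rewrite -EFinB lee_fin; lra.
apply: (le_trans (leeD leA leB)).
rewrite addeACA -EFinD -splitr leeD2r //.
rewrite -(lebesgue_measure_shift (- b) mA') -(lebesgue_measure_shift (- a) mB').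
have mS (c : R) D : measurable D -> measurable ((fun t : R => t + c) @^-1` D).
  move=> mD; rewrite -[X in measurable X]setTI.
  have /(_ measurableT) : measurable_fun [set: R] (fun t : R => t + c).
    by apply: measurable_funD.
  exact.
rewrite -measureU; [|exact: mS|exact: mS|].
  apply: le_measure; rewrite ?inE //; first by apply: measurableU; exact: mS.
  move=> x [] /= [h _]; first by have := ABC _ _ h Bb; rewrite subrK.
  by have := ABC _ _ Aa h; rewrite addrC subrK.
apply/seteqP; split => // x [] [_ /=]; rewrite in_itv /= => h1 [_ /=].
by rewrite in_itv /= andbT => h2; lra.
Qed.

Lemma min_lebesgue_measure (K : R) (v : \bar R) : 0 < K -> (0 <= v)%E ->
  lebesgue_measure [set t : R | 0 < t < 1 /\ ((t * K)%:E <= v)%E] =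
  (K^-1%:E * mine v K%:E)%E.
Proof.
move=> K0 v0.
have ii : lebesgue_measure (`]0%R, 1%R[%classic : set R) = 1%E.
  by rewrite lebesgue_measure_itv /= lte_fin ltr01 oppr0 adde0.
have [Kv|vK] := leP K%:E v.
  rewrite [RHS](_ : _ = 1%E); last by rewrite -EFinM mulVf // gt_eqF.
  rewrite -ii; congr (lebesgue_measure _); apply/seteqP; split => t /=.
    by case; rewrite in_itv.
  rewrite in_itv /= => t01; split => //; apply: le_trans Kv.
  by rewrite lee_fin ler_piMl ?ltW //; case/andP: t01.
case: v v0 vK => [v| |] //; rewrite lee_fin lte_fin => v0 vK.
have vK1 : v / K < 1 by rewrite ltr_pdivrMr // mul1r.
have -> : [set t : R | 0 < t < 1 /\ ((t * K)%:E <= v%:E)%E] = `]0, v / K]%classic.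
  apply/seteqP; split => t /=; rewrite in_itv /= lee_fin ler_pdivlMr //.
    by case=> /andP[-> _ ->].
  move=> /andP[t0 tv]; split=> //; rewrite t0 /= (le_lt_trans _ vK1) //.
  by rewrite ler_pdivlMr.
rewrite lebesgue_measure_itv /= lte_fin oppr0 adde0.
case: ifPn => [_|]; first by rewrite -EFinM mulrC.
rewrite -leNgt => h; have : v / K = 0.
  by apply/eqP; rewrite eq_le h divr_ge0 // ltW.
by rewrite mulrC => h'; rewrite -EFinM h'.
Qed.

Lemma measurable_lee_set d (T : measurableType d) (f g : T -> \bar R) :
  measurable_fun setT f -> measurable_fun setT g ->
  measurable [set x | (f x <= g x)%E].
Proof.
by move=> mf mg; rewrite -[X in measurable X]setTI; exact: measurable_lee.
Qed.

(** The levels are measured relative to [K] and stop at [K], which is why [f] appears truncated. *)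
Lemma layer_cake01 d (T : measurableType d)
    (m : {sigma_finite_measure set T -> \bar R}) (f : T -> \bar R) (K : R) :
  0 < K -> measurable_fun setT f -> (forall x, 0 <= f x)%E ->
  (\int[lebesgue_measure]_(t in `]0%R, 1%R[)
      m [set x | ((t * K)%:E <= f x)%E] =
   K^-1%:E * \int[m]_x mine (f x) K%:E)%E.
Proof.
move=> K0 mf f0.
pose Q : set (T * measurableTypeR R) :=
  [set p | 0 < p.2 < 1 /\ ((p.2 * K)%:E <= f p.1)%E].
have mQ : measurable Q.
  have -> : Q = (snd @^-1` `]0%R, 1%R[%classic) `&`
      [set p | ((p.2 * K)%:E <= f p.1)%E].
    by apply/seteqP; split => p /=; rewrite in_itv.
  apply: measurableI.
    by rewrite -[X in measurable X]setTI; apply: measurable_snd => //; exact: measurable_itv.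
  apply: (@measurable_lee_set _ _ (fun p : T * measurableTypeR R =>
    (p.2 * K)%:E) (fun p => f p.1)); last exact: measurableT_comp.
  by apply/measurable_EFinP; apply: measurable_funM.
have := @indic_fubini_tonelli _ _ _ _ R m
  (lebesgue_measure : {sigma_finite_measure set (measurableTypeR R) -> \bar R}) _ mQ.
rewrite indic_fubini_tonelli_FE // indic_fubini_tonelli_GE // => H.
transitivity (\int[lebesgue_measure]_t (m \o ysection Q) t)%E.
  rewrite integral_mkcond; apply: eq_integral => t _ /=.
  rewrite patchE; case: ifPn => [|]; rewrite ?inE ?notin_setE /= in_itv /=.
    move=> t01; congr (m _); apply/seteqP; split => x; rewrite /ysection /= inE /Q /=.
      by split.
    by case.
  move=> t01; apply: esym; rewrite -[RHS](measure0 m) /=; congr (m _).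
  apply/seteqP; split => x //.
  by rewrite /ysection /= inE /Q /= => -[/t01].
rewrite -H -ge0_integralZl //; last first.
- by rewrite lee_fin invr_ge0 ltW.
- by move=> x _; rewrite le_min f0 lee_fin ltW.
- by apply: measurable_mine.
apply: eq_integral => x _ /=; rewrite -min_lebesgue_measure //.
congr (lebesgue_measure _).
by apply/seteqP; split => t; rewrite /xsection /= inE.
Qed.

(** Each function is cut at the same fraction [l] of its own reference height. As [M] and [N] are
    the suprema of [a] and [b], both level sets are nonempty for every l < 1, so the one-dimensional
    inequality applies at each level; integrating over [l] gives the claim. Without the
    normalization one level set could be empty while the other is not. *)
Lemma prekopa_leindler1 (a b c : R -> \bar R) (K M N k : R) :
  0 < K -> 0 < M -> 0 < N ->
  measurable_fun setT a -> measurable_fun setT b -> measurable_fun setT c ->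
  (forall t, 0 <= a t)%E -> (forall t, 0 <= b t)%E -> (forall t, 0 <= c t)%E ->
  (forall t, a t <= M%:E)%E -> (forall t, b t <= N%:E)%E ->
  (forall t, (0 < a t)%E -> - k <= t <= k) ->
  (forall t, (0 < b t)%E -> - k <= t <= k) ->
  (forall l, 0 < l < 1 -> exists t, ((l * M)%:E <= a t)%E) ->
  (forall l, 0 < l < 1 -> exists t, ((l * N)%:E <= b t)%E) ->
  (forall l s t, 0 < l < 1 -> ((l * M)%:E <= a s)%E -> ((l * N)%:E <= b t)%E ->
     ((l * K)%:E <= c (s + t)%R)%E) ->
  (K%:E * (M^-1%:E * (\int[lebesgue_measure]_t a t) +
           N^-1%:E * (\int[lebesgue_measure]_t b t)) <=
   \int[lebesgue_measure]_t c t)%E.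
Proof.
move=> K0 M0 N0 ma mb mc a0 b0 c0 aM bN ak bk aex bex abc.
have LC := @layer_cake01 _ (measurableTypeR R) lebesgue_measure.
have La := LC a M M0 ma a0; have Lb := LC b N N0 mb b0; have Lc := LC c K K0 mc c0.
have aE : (\int[lebesgue_measure]_t mine (a t) M%:E =
    \int[lebesgue_measure]_t a t)%E.
  by apply: eq_integral => t _; apply/min_idPl.
have bE : (\int[lebesgue_measure]_t mine (b t) N%:E =
    \int[lebesgue_measure]_t b t)%E.
  by apply: eq_integral => t _; apply/min_idPl.
rewrite aE in La; rewrite bE in Lb.
apply: (@le_trans _ _ (\int[lebesgue_measure]_t mine (c t) K%:E)%E); last first.
  apply: ge0_le_integral => //.
  - by move=> t _; rewrite le_min c0 lee_fin ltW.
  - exact: measurable_mine.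
  - by move=> t _; rewrite ge_min lexx.
rewrite -lee_pdivlMl //.
have -> : (K^-1%:E * \int[lebesgue_measure]_t mine (c t) K%:E =
  \int[lebesgue_measure]_(t in `]0%R, 1%R[) lebesgue_measure [set x | ((t * K)%:E <= c x)%E])%E.
  by rewrite Lc.
rewrite -La -Lb.
have mm (f : R -> \bar R) (L : R) : 0 < L -> measurable_fun setT f ->
    measurable_fun (`]0%R, 1%R[%classic : set R)
      (fun t : R => lebesgue_measure [set x | ((t * L)%:E <= f x)%E]).
  move=> L0 mf.
  apply: (measurable_funS measurableT) => //.
  pose Q : set (measurableTypeR R * measurableTypeR R) := [set p | ((p.2 * L)%:E <= f p.1)%E].
  have mQ : measurable Q.
    apply: (@measurable_lee_set _ _ (fun p : measurableTypeR R * measurableTypeR R =>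
      (p.2 * L)%:E) (fun p => f p.1)); last exact: measurableT_comp.
    by apply/measurable_EFinP; apply: measurable_funM.
  have := @measurable_fun_ysection _ _ _ _ R lebesgue_measure _ mQ.
  congr (measurable_fun _ _); apply/funext => t /=; congr (lebesgue_measure _).
  by apply/seteqP; split => x; rewrite /ysection /= inE.
rewrite -ge0_integralD //; [|exact: mm|exact: mm].
apply: ge0_le_integral => //.
- by move=> t _; rewrite adde_ge0.
- by apply: (emeasurable_funD (mm _ _ M0 ma) (mm _ _ N0 mb)).
- exact: mm.
move=> l /=; rewrite in_itv /= => l01.
have /andP[l0 l1] := l01.
apply: (@brunn_minkowski1 _ _ _ k); try exact: measurable_lee_set.
- by have [t] := aex _ l01; exists t.
- by have [t] := bex _ l01; exists t.
- move=> t /= h; rewrite in_itv /=; apply: ak; apply: lt_le_trans h.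
  by rewrite lte_fin mulr_gt0.
- move=> t /= h; rewrite in_itv /=; apply: bk; apply: lt_le_trans h.
  by rewrite lte_fin mulr_gt0.
by move=> s t /=; exact: abc.
Qed.

Lemma lebesgue_rV0_gt0 (S : set 'rV[R]_0) :
  (0 < lebesgue_rV 0 S)%E -> lebesgue_rV 0 S = 1%E /\ S 0.
Proof.
rewrite /= diracE; case: (boolP (0 \in S)) => [|_]; first by rewrite inE.
by rewrite ltxx.
Qed.

Lemma lebesgue_rV_gt0_dim0 d (S : set 'rV[R]_d) : d = 0%N ->
  (0 < lebesgue_rV d S)%E -> lebesgue_rV d S = 1%E.
Proof. by case: d S => // S _ /lebesgue_rV0_gt0[]. Qed.

Lemma expr_surj_gt0 (d : nat) (m : R) : 0 < m -> (d = 0%N -> m = 1) ->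
  exists2 al : R, 0 < al & al ^+ d = m.
Proof.
case: d => [|n] m0 mE; first by exists 1; rewrite ?expr0 ?mE.
exists (m `^ n.+1%:R^-1); first by rewrite powR_gt0.
by rewrite -powR_mulrn ?powR_ge0 // -powRrM mulVf // powRr1 // ltW.
Qed.

Lemma rV_consD d (s t : R) (x z : 'rV[R]_d) :
  rV_cons (s, x) + rV_cons (t, z) = rV_cons (s + t, x + z).
Proof.
apply/rowP => i; rewrite !mxE.
by case: (splitP (i : 'I_(1 + d))) => j ij; rewrite !mxE // ord1 eqxx !mulr1n.
Qed.

(** A set [C] containing all sums replaces the Minkowski sum, which need not be measurable, and
    lower bounds [x], [y] on the d-th roots of the volumes replace the roots. In the inductive step
    al^d and be^d are the largest slice volumes. The induction hypothesis applied to slices at the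
    same relative height [l] shows that the slice of [C] at s + t has volume at least l (al + be)^d,
    which is the hypothesis of the one-dimensional inequality. *)
Lemma brunn_minkowski_obox d (A B C : set 'rV[R]_d) (k x y : R) :
  measurable A -> measurable B -> measurable C ->
  A `<=` obox (const_mx (- k)) (const_mx k) ->
  B `<=` obox (const_mx (- k)) (const_mx k) ->
  (forall a b, A a -> B b -> C (a + b)) ->
  0 < x -> 0 < y ->
  ((x ^+ d)%:E <= lebesgue_rV d A)%E -> ((y ^+ d)%:E <= lebesgue_rV d B)%E ->
  (((x + y) ^+ d)%:E <= lebesgue_rV d C)%E.
Proof.
elim: d A B C x y => [|d IH] A B C x y mA mB mC Ak Bk ABC x0 y0 xA yB.
  have A0 : A 0 by apply: (lebesgue_rV0_gt0 _).2; apply: lt_le_trans xA; rewrite lte_fin.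
  have B0 : B 0 by apply: (lebesgue_rV0_gt0 _).2; apply: lt_le_trans yB; rewrite lte_fin.
  by have := ABC _ _ A0 B0; rewrite addr0 /= diracE => C0; rewrite mem_set.
pose sec (S : set 'rV[R]_d.+1) (t : R) := xsection (@rV_cons R d @^-1` S) t.
pose a t := lebesgue_rV d (sec A t); pose b t := lebesgue_rV d (sec B t).
pose c t := lebesgue_rV d (sec C t).
have msec S t : measurable S -> measurable (sec S t).
  by move=> mS; exact: measurable_rV_cons_section.
have secE S t z : sec S t z = S (rV_cons (t, z)).
  by rewrite /sec /xsection /= inE.
have boxE (t : R) (z : 'rV[R]_d) :
    obox (const_mx (- k)) (const_mx k) (rV_cons (t, z)) ->
    - k < t < k /\ obox (const_mx (- k)) (const_mx k) z.
  rewrite -[obox _ _ _]/((@rV_cons R d @^-1` obox (const_mx (- k)) (const_mx k)) (t, z)).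
  rewrite rV_cons_obox => -[] /=; rewrite !mxE in_itv /= => tk zk; split => // i.
  by have := zk i; rewrite !mxE.
have Sbox S (Sk : S `<=` obox (const_mx (- k)) (const_mx k)) t :
    sec S t `<=` obox (const_mx (- k)) (const_mx k).
  by move=> z; rewrite secE => /Sk /boxE[].
have Ssupp S (mS : measurable S) (Sk : S `<=` obox (const_mx (- k)) (const_mx k)) t :
    (0 < lebesgue_rV d (sec S t))%E -> - k < t < k.
  have [->|/set0P[z]] := eqVneq (sec S t) set0; first by rewrite measure0 ltxx.
  by rewrite secE => /Sk /boxE[].
(* The supremum of the slice volumes is positive because the total volume is, and finite because [S]
   is bounded. In dimension 0 a nonempty slice has measure 1, so the supremum is still of the form
   al^d. *)
have peak S (mS : measurable S) (Sk : S `<=` obox (const_mx (- k)) (const_mx k)) :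
    (0 < lebesgue_rV d.+1 S)%E -> exists2 al : R, 0 < al &
    (forall t, lebesgue_rV d (sec S t) <= (al ^+ d)%:E)%E /\
    forall l, 0 < l < 1 -> exists t, ((l * al ^+ d)%:E <= lebesgue_rV d (sec S t))%E.
  move=> S0.
  have [t0 St0] : exists t, (0 < lebesgue_rV d (sec S t))%E.
    apply: contrapT => /forallNP h; move: S0; rewrite lebesgue_rVS //.
    rewrite integral0_eq ?ltxx // => t _.
    by apply/eqP; rewrite eq_le measure_ge0 andbT leNgt; apply/negP; exact: h.
  have k0 : 0 <= k by have /andP[] := Ssupp _ mS Sk _ St0; lra.
  pose M := ereal_sup (range (fun t => lebesgue_rV d (sec S t))).
  have ubM t : (lebesgue_rV d (sec S t) <= M)%E by apply: ereal_sup_ubound; exists t.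
  have M0 : (0 < M)%E by exact: lt_le_trans St0 (ubM _).
  have Moo : (M < +oo)%E.
    apply: (@le_lt_trans _ _ ((\prod_(i < d) (k - - k))%:E)); last by rewrite ltry.
    apply: ge_ereal_sup => _ [t _ <-].
    apply: (@le_trans _ _ (lebesgue_rV d (obox (const_mx (- k)) (const_mx k)))).
      apply: le_measure; rewrite ?inE; [exact: msec|exact: measurable_obox|].
      exact: Sbox.
    rewrite lebesgue_rV_obox.
      by under eq_bigr do rewrite !mxE.
    by move=> i; rewrite !mxE; lra.
  have Mfin : M \is a fin_num by rewrite ge0_fin_numE // ltW.
  have fM0 : 0 < fine M by rewrite fine_gt0 // M0.
  suff [al al0 alM] : exists2 al : R, 0 < al & al ^+ d = fine M.
    exists al => //; split => [t|l /andP[l0 l1]]; first by rewrite alM fineK.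
    have : (l%:E * M < M)%E.
      by rewrite -(fineK Mfin) -EFinM lte_fin gtr_pMl.
    rewrite -{2}[M]/(ereal_sup _) => /ereal_sup_gt[_ [t _ <-] h].
    by exists t; rewrite alM EFinM fineK // ltW.
  apply: expr_surj_gt0 => // d0; apply/eqP; rewrite eq_le -!lee_fin fineK //.
  rewrite -{2}(lebesgue_rV_gt0_dim0 d0 St0) ubM andbT.
  apply: ge_ereal_sup => _ [t _ <-].
  have [->|h] := eqVneq (lebesgue_rV d (sec S t)) 0%E; first by rewrite lee01.
  by rewrite lebesgue_rV_gt0_dim0 // lt0e h /=.
have A0 : (0 < lebesgue_rV d.+1 A)%E by apply: lt_le_trans xA; rewrite lte_fin exprn_gt0.
have B0 : (0 < lebesgue_rV d.+1 B)%E by apply: lt_le_trans yB; rewrite lte_fin exprn_gt0.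
have [al al0 [aal alx]] := peak A mA Ak A0.
have [be be0 [bbe bex]] := peak B mB Bk B0.
have albe0 : 0 < al + be by rewrite addr_gt0.
have H s1 s2 := @prekopa_leindler1 a b c ((al + be) ^+ d) (al ^+ d) (be ^+ d) k
  (exprn_gt0 d albe0) (exprn_gt0 d al0) (exprn_gt0 d be0)
  (measurable_lebesgue_rV_section mA) (measurable_lebesgue_rV_section mB)
  (measurable_lebesgue_rV_section mC) (fun t => measure_ge0 _ _)
  (fun t => measure_ge0 _ _) (fun t => measure_ge0 _ _) aal bbe s1 s2 alx bex.
rewrite [leRHS]lebesgue_rVS //; apply: le_trans (H _ _ _); last 1 first.
- move=> l s t /andP[l0 l1] ha hb.
  have hsub u v : sec A s u -> sec B t v -> sec C (s + t) (u + v).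
    by rewrite !secE -rV_consD; exact: ABC.
  have /(_ _ _) H0 := IH (sec A s) (sec B t) (sec C (s + t)) _ _ (msec _ _ mA)
    (msec _ _ mB) (msec _ _ mC) (Sbox _ Ak _) (Sbox _ Bk _) hsub.
  (* For d = 0 no [g] satisfies g^d = l < 1, but slices of positive measure have measure 1 and the
     induction hypothesis is used with both radii equal to 1. *)
  have [d0|d0] := eqVneq d 0%N.
    have e1 (u : R) : u ^+ d = 1 by rewrite d0 expr0.
    have ap : (0 < lebesgue_rV d (sec A s))%E.
      by apply: lt_le_trans ha; rewrite lte_fin mulr_gt0 // e1.
    have bp : (0 < lebesgue_rV d (sec B t))%E.
      by apply: lt_le_trans hb; rewrite lte_fin mulr_gt0 // e1.
    have a1 : ((1 ^+ d)%:E <= lebesgue_rV d (sec A s))%E.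
      by rewrite (lebesgue_rV_gt0_dim0 d0 ap) expr1n.
    have b1 : ((1 ^+ d)%:E <= lebesgue_rV d (sec B t))%E.
      by rewrite (lebesgue_rV_gt0_dim0 d0 bp) expr1n.
    apply: le_trans (H0 1 1 ltr01 ltr01 a1 b1).
    by rewrite (e1 (al + be)) (e1 (1 + 1)) lee_fin mulr1 ltW.
  have [g g0 gE] : exists2 g : R, 0 < g & g ^+ d = l.
    by apply: expr_surj_gt0 => // /eqP; rewrite (negbTE d0).
  have := H0 (g * al) (g * be).
  by rewrite -mulrDr !exprMn gE; apply => //; exact: mulr_gt0.
- rewrite -!lebesgue_rVS //.
  apply: (@le_trans _ _ (((al + be) ^+ d)%:E * ((x ^+ d.+1 / al ^+ d)%:E +
    (y ^+ d.+1 / be ^+ d)%:E))%E).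
    by rewrite -EFinD -EFinM lee_fin ler_exprD_div // ltW.
  rewrite lee_pmul2l ?lte_fin ?exprn_gt0 //.
  rewrite ![(_ / _)%:E]EFinM ![((_ ^+ _)%:E * (_^-1)%:E)%E]muleC.
  by apply: leeD; rewrite lee_pmul2l // lte_fin invr_gt0 exprn_gt0.
- by move=> t /(Ssupp _ mA Ak) /andP[? ?]; rewrite !ltW.
- by move=> t /(Ssupp _ mB Bk) /andP[? ?]; rewrite !ltW.
Qed.

End brunn_minkowski.

Lemma continuous_bigsum {R : realType} (T : topologicalType) (I : Type)
    (s : seq I) (F : I -> T -> R) : (forall i, continuous (F i)) ->
  continuous (fun x => \sum_(i <- s) F i x).
Proof.
move=> cF; elim: s => [|i s IH] x.
  by under eq_fun do rewrite big_nil; exact: cvg_cst.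
under eq_fun do rewrite big_cons.
exact: (continuousD (cF i x) (IH x)).
Qed.

(** * Euclidean balls *)

Section euclidean_norm.
Context {R : realType} {d : nat}.
Implicit Types (x y z : 'rV[R]_d) (r c : R).

Lemma sum_sqr_ge0 x : 0 <= \sum_i x 0 i ^+ 2.
Proof. by apply: sumr_ge0 => i _; exact: sqr_ge0. Qed.

Lemma enorm_ge0 x : 0 <= enorm x.
Proof. exact: sqrtr_ge0. Qed.

Lemma sqr_enorm x : enorm x ^+ 2 = \sum_i x 0 i ^+ 2.
Proof. by rewrite sqr_sqrtr // sum_sqr_ge0. Qed.

Lemma enorm0 : enorm (0 : 'rV[R]_d) = 0.
Proof. by rewrite /enorm big1 ?sqrtr0 // => i _; rewrite mxE expr0n. Qed.

Lemma le_coord_enorm x i : `|x 0 i| <= enorm x.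
Proof.
rewrite -sqrtr_sqr ler_wsqrtr // (bigD1 i) //= lerDl.
by apply: sumr_ge0 => j _; exact: sqr_ge0.
Qed.

Lemma enormZ c x : enorm (c *: x) = `|c| * enorm x.
Proof.
rewrite /enorm; under eq_bigr do rewrite mxE exprMn.
by rewrite -mulr_sumr sqrtrM ?sqr_ge0 // sqrtr_sqr.
Qed.

Lemma sum_mul_le_enorm x z : \sum_i x 0 i * z 0 i <= enorm x * enorm z.
Proof.
have [x0|x0] := eqVneq (enorm x) 0.
  rewrite x0 mul0r big1 // => i _.
  have := le_coord_enorm x i; rewrite x0 normr_le0 => /eqP ->.
  by rewrite mul0r.
have [z0|z0] := eqVneq (enorm z) 0.
  rewrite z0 mulr0 big1 // => i _.
  have := le_coord_enorm z i; rewrite z0 normr_le0 => /eqP ->.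
  by rewrite mulr0.
have xp : 0 < enorm x by rewrite lt0r x0 enorm_ge0.
have zp : 0 < enorm z by rewrite lt0r z0 enorm_ge0.
(* With these weights the product of the norms is a sum over coordinates in which each term
   dominates x_i z_i by the arithmetic-geometric mean inequality. *)
have -> : enorm x * enorm z =
    enorm z / enorm x / 2 * enorm x ^+ 2 + enorm x / enorm z / 2 * enorm z ^+ 2.
  by field; rewrite x0 z0.
rewrite !sqr_enorm !mulr_sumr -big_split /=; apply: ler_sum => i _.
set u := x 0 i; set v := z 0 i.
have : 0 <= (enorm z * u - enorm x * v) ^+ 2 / (2 * (enorm x * enorm z)).
  by rewrite divr_ge0 ?sqr_ge0 // !mulr_ge0 // enorm_ge0.
rewrite -subr_ge0; congr (0 <= _); field; rewrite x0 z0 //.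
Qed.

Lemma continuous_enorm : continuous (@enorm R d).
Proof.
move=> x; apply: continuous_comp; last exact: sqrt_continuous.
apply: continuous_bigsum => i {}x.
apply: (@continuous_comp _ _ _ (fun x : 'rV[R]_d => x 0 i) (fun t => t ^+ 2)).
  exact: coord_continuous.
exact: exprn_continuous.
Qed.

Lemma continuous_enormB y : continuous (fun x => enorm (x - y)).
Proof.
move=> x; apply: (@continuous_comp _ _ _ (fun x => x - y) (@enorm R d)).
  by apply: continuousB => //; exact: cst_continuous.
exact: continuous_enorm.
Qed.

Lemma open_eball y r : open (eball y r).
Proof.
by apply: (continuousP (fun x => enorm (x - y))).1 (@open_lt R r);
  exact: continuous_enormB.
Qed.

Lemma closed_enorm_ball y r : closed [set x | enorm (x - y) <= r].
Proof.
apply: (@closed_comp _ _ (fun x => enorm (x - y)) [set t : R | t <= r]).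
  by move=> x _; exact: continuous_enormB.
exact: closed_le.
Qed.

Lemma ecball_sub y r : ecball y r `<=` [set x | enorm (x - y) <= r].
Proof.
rewrite [X in _ `<=` X](closure_id _).1; last exact: closed_enorm_ball.
by apply: closure_subset => x /ltW.
Qed.

Lemma enorm_ball_sub_obox y r k : 0 <= k -> (forall i, `|y 0 i| + r < k) ->
  [set x | enorm (x - y) <= r] `<=` obox (const_mx (- k)) (const_mx k).
Proof.
move=> k0 yk x /= xr i; rewrite !mxE -ltr_norml.
rewrite -[x 0 i](subrK (y 0 i)); apply: le_lt_trans (ler_normD _ _) _.
apply: le_lt_trans (yk i); rewrite addrC lerD2l; apply: le_trans xr.
by have := le_coord_enorm (x - y) i; rewrite !mxE.
Qed.

Lemma enorm_ball_bounded y r : exists k, 0 <= k /\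
  [set x | enorm (x - y) <= r] `<=` obox (const_mx (- k)) (const_mx k).
Proof.
exists (\sum_i `|y 0 i| + `|r| + 1); split.
  by rewrite !addr_ge0 // sumr_ge0.
apply: enorm_ball_sub_obox; first by rewrite !addr_ge0 // sumr_ge0.
move=> i; rewrite (bigD1 i) //=.
have : 0 <= \sum_(j < d | j != i) `|y 0 j| by rewrite sumr_ge0.
by have := ler_norm r; lra.
Qed.

Lemma lebesgue_rV_obox_lty (a b : 'rV[R]_d) : (lebesgue_rV d (obox a b) < +oo)%E.
Proof.
have [ab|/existsNP[i /negP]] := pselect (forall i, a 0 i <= b 0 i).
  by rewrite lebesgue_rV_obox // ltry.
rewrite -ltNge => ba; rewrite (_ : obox a b = set0) ?measure0 //.
by apply/seteqP; split => // x /(_ i) /andP[h1 h2]; lra.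
Qed.

Lemma lebesgue_rV_bounded (A : set 'rV[R]_d) k : measurable A ->
  A `<=` obox (const_mx (- k)) (const_mx k) -> (lebesgue_rV d A < +oo)%E.
Proof.
move=> mA Ak; apply: le_lt_trans (lebesgue_rV_obox_lty (const_mx (- k)) (const_mx k)).
by apply: le_measure; rewrite ?inE //; exact: measurable_obox.
Qed.

Lemma measurable_eball y r : measurable (eball y r).
Proof. by apply: open_measurable_rV; exact: open_eball. Qed.

Lemma closed_measurable_rV (A : set 'rV[R]_d) : closed A -> measurable A.
Proof.
by move=> cA; rewrite -[A]setCK; apply: measurableC; apply: open_measurable_rV;
  rewrite openC.
Qed.

Lemma measurable_enorm_ball y r : measurable [set x | enorm (x - y) <= r].
Proof. by apply: closed_measurable_rV; exact: closed_enorm_ball. Qed.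

Definition unit_ball_volume : R := fine (lebesgue_rV d (eball 0 1)).

Lemma lebesgue_eball_lty y r : (lebesgue_rV d (eball y r) < +oo)%E.
Proof.
have [k [_ kE]] := enorm_ball_bounded y r.
apply: (lebesgue_rV_bounded (k := k)); first exact: measurable_eball.
by move=> x /ltW /kE.
Qed.

Lemma lebesgue_enorm_ball_lty y r :
  (lebesgue_rV d [set x | enorm (x - y) <= r]%R < +oo)%E.
Proof.
have [k [_ kE]] := enorm_ball_bounded y r.
exact: lebesgue_rV_bounded (measurable_enorm_ball y r) kE.
Qed.

Lemma unit_ball_volume_gt0 : 0 < unit_ball_volume.
Proof.
rewrite fine_gt0 // lebesgue_eball_lty andbT.
(* A cube of half side 1/(d+1) lies in the unit ball, because d / (d+1)^2 < 1. *)
pose a : R := d.+1%:R^-1.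
have a0 : 0 < a by rewrite invr_gt0.
apply: (@lt_le_trans _ _ (lebesgue_rV d (obox (const_mx (- a)) (const_mx a)))).
  rewrite lebesgue_rV_obox; last by move=> i; rewrite !mxE; lra.
  rewrite lte_fin; apply: prodr_gt0 => i _; rewrite !mxE; lra.
apply: le_measure; rewrite ?inE; [exact: measurable_obox|exact: measurable_eball|].
move=> x xa; rewrite /eball /= subr0.
rewrite -(sqrtr1 R) /enorm ltr_sqrt //.
apply: (@le_lt_trans _ _ (\sum_(i < d) a ^+ 2)).
  apply: ler_sum => i _; have := xa i; rewrite !mxE -ltr_norml => h.
  by rewrite -(real_normK (num_real _)) lerXn2r ?nnegrE // ltW.
rewrite sumr_const card_ord -mulr_natl /a.
have dd : d%:R < d.+1%:R :> R by rewrite ltr_nat.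
have d1 : 1 <= d.+1%:R :> R by rewrite ler1n.
rewrite exprVn ltr_pdivrMr ?exprn_gt0 // mul1r expr2.
by apply: lt_le_trans dd _; rewrite ler_peMr.
Qed.

(** The predicate [P] lets one proof cover open and closed balls. *)
Lemma lebesgue_ball_scale (P : R -> bool) y r : 0 < r ->
  measurable [set x : 'rV[R]_d | P (enorm x)] ->
  lebesgue_rV d [set x | P (enorm (x - y) / r)] =
  ((r ^+ d)%:E * lebesgue_rV d [set x | P (enorm x)])%E.
Proof.
move=> r0 mP; have ri0 : 0 < r^-1 by rewrite invr_gt0.
rewrite -[r in LHS]invrK -[r in RHS]invrK -(lebesgue_rV_affine (- (r^-1 *: y)) ri0 mP).
congr (lebesgue_rV d _); apply/seteqP; split => x /=;
by rewrite invrK -scalerBr enormZ gtr0_norm // mulrC.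
Qed.

Lemma lebesgue_eball y r : 0 < r ->
  lebesgue_rV d (eball y r) = (unit_ball_volume * r ^+ d)%:E.
Proof.
move=> r0.
have -> : eball y r = [set x | enorm (x - y) / r < 1].
  by apply/seteqP; split => x /=; rewrite /eball /= ltr_pdivrMr // mul1r.
have e1 : [set x : 'rV[R]_d | enorm x < 1] = eball 0 1.
  by apply/seteqP; split => x; rewrite /eball /= subr0.
rewrite (@lebesgue_ball_scale (fun t => t < 1)) //; last first.
  by rewrite e1; exact: measurable_eball.
rewrite e1 mulrC EFinM /unit_ball_volume fineK //.
by rewrite ge0_fin_numE // lebesgue_eball_lty.
Qed.

(** The sphere is null by scaling alone: slightly shrunken closed balls lie in the open ball, and
    their volumes tend to that of the closed ball. *)
Lemma lebesgue_enorm_ball y r : (0 < d)%N -> 0 < r ->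
  lebesgue_rV d [set x | enorm (x - y) <= r] = (unit_ball_volume * r ^+ d)%:E.
Proof.
move=> d0.
have e1 : [set x : 'rV[R]_d | enorm x <= 1] = [set x | enorm (x - 0) <= 1].
  by apply/seteqP; split => x; rewrite /= subr0.
have m1 : measurable [set x : 'rV[R]_d | enorm x <= 1].
  by rewrite e1; exact: measurable_enorm_ball.
pose m := fine (lebesgue_rV d [set x : 'rV[R]_d | enorm x <= 1]).
have mE : lebesgue_rV d [set x : 'rV[R]_d | enorm x <= 1] = m%:E.
  by rewrite /m fineK // ge0_fin_numE // e1 lebesgue_enorm_ball_lty.
have sc z s : 0 < s -> lebesgue_rV d [set x | enorm (x - z) <= s] = (m * s ^+ d)%:E.
  move=> s0; rewrite mulrC EFinM -mE.
  rewrite -(@lebesgue_ball_scale (fun t => t <= 1) z) //; congr (lebesgue_rV d _).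
  by apply/seteqP; split => x /=; rewrite ler_pdivrMr // mul1r.
move=> r0; rewrite sc //; congr ((_ * _)%:E).
have um : unit_ball_volume <= m.
  have := lebesgue_eball 0 ltr01; rewrite expr1n mulr1 -lee_fin => <-.
  rewrite -mE e1.
  apply: le_measure; rewrite ?inE; [exact: measurable_eball|exact: measurable_enorm_ball|].
  by move=> x /ltW.
apply/eqP; rewrite eq_le um andbT leNgt; apply/negP => mu.
have u0 := unit_ball_volume_gt0; have m0 : 0 < m by exact: lt_trans mu.
(* If the closed unit ball had volume m greater than the open one, the closed ball of radius s < 1
   with s^d = q would have the midpoint of the two volumes as its volume, and yet lie in the open
   unit ball. *)
pose q := (unit_ball_volume + m) / (2 * m).
have [s s0 sq] : exists2 s : R, 0 < s & s ^+ d = q.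
  apply: expr_surj_gt0; first by rewrite divr_gt0 // ?addr_gt0 // mulr_gt0.
  by move=> dd; rewrite dd in d0.
have s1 : s < 1.
  have : s ^+ d < 1 by rewrite sq /q ltr_pdivrMr ?mulr_gt0 // mul1r; lra.
  by rewrite !ltNge; apply: contra => /(exprn_ege1 d).
have : (lebesgue_rV d [set x | (enorm (x - 0) <= s)%R] <= lebesgue_rV d (eball 0 1))%E.
  apply: le_measure; rewrite ?inE; [exact: measurable_enorm_ball|exact: measurable_eball|].
  by move=> x /= xs; exact: le_lt_trans s1.
rewrite sc // lebesgue_eball // expr1n mulr1 lee_fin sq /q.
have -> : m * ((unit_ball_volume + m) / (2 * m)) = (unit_ball_volume + m) / 2.
  by field; rewrite gt_eqF.
by lra.
Qed.

End euclidean_norm.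

(** * Layer-cake formulas and integrals of powers *)

Section power_integrals.
Context {R : realType}.
Implicit Types (a b v t : R).
Let leb : {measure set (measurableTypeR R) -> \bar R} := @lebesgue_measure R.

Lemma powRD_gt0 (x : R) a b : 0 < x -> x `^ (a + b) = x `^ a * x `^ b.
Proof. by move=> x0; rewrite powRD // (gt_eqF x0) implybT. Qed.

Lemma powRN_le (x : R) t a : 0 <= a -> 0 < x -> x <= t -> t `^ (- a) <= x `^ (- a).
Proof.
move=> a0 x0 xt; have t0 : 0 < t by exact: lt_le_trans xt.
rewrite !powRN lef_pV2 ?posrE ?powR_gt0 //.
by apply: ge0_ler_powR; rewrite ?nnegrE // ltW.
Qed.

Lemma powRN_cvgy a : 0 < a -> ((x : R) `^ (- a) @[x --> +oo]) --> (0 : R).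
Proof.
move=> a0; apply/cvgrPdist_le => e e0; near=> x.
have x1 : 0 < e `^ (- a^-1) by rewrite powR_gt0.
have x2 : e `^ (- a^-1) <= x by near: x; exact: nbhs_pinfty_ge.
rewrite sub0r normrN ger0_norm ?powR_ge0 //.
apply: le_trans (powRN_le (ltW a0) x1 x2) _.
by rewrite -powRrM mulrNN mulVf ?gt_eqF // powRr1 // ltW.
Unshelve. all: by end_near. Qed.

Lemma continuous_powRl a (x : R) : 0 < x -> {for x, continuous (fun t => t `^ a)}.
Proof.
move=> x0; apply: differentiable_continuous; apply/derivable1_diffP.
by apply: derivable_powR; rewrite in_itv /= x0.
Qed.

Lemma ge0_integral_itvcy (f F : R -> R) a (l : R) : 0 < a ->
  (forall x, a <= x -> 0 <= f x) ->
  (forall x : R, 0 < x -> {for x, continuous f}) ->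
  (forall x : R, 0 < x -> is_derive x (1 : R) F (f x)) ->
  F x @[x --> +oo] --> l ->
  (\int[leb]_(x in `[a, +oo[) (f x)%:E = (l - F a)%:E)%E.
Proof.
move=> a0 f0 cf dF Fl; rewrite EFinB; apply: ge0_continuous_FTC2y => //.
- apply: continuous_in_subspaceT => x; rewrite inE /= in_itv /= andbT => ax.
  by apply: cf; exact: lt_le_trans ax.
- by move=> x ax; have x0 := lt_trans a0 ax; have [] := dF _ x0.
- apply: cvg_at_right_filter; apply: differentiable_continuous.
  by apply/derivable1_diffP; have [] := dF _ a0.
- move=> x; rewrite in_itv /= andbT => ax; have x0 := lt_trans a0 ax.
  by rewrite derive1E; have [_ ->] := dF _ x0.
Qed.

Lemma integral_powRN b a : 0 < b -> 1 < a ->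
  (\int[leb]_(x in `[b, +oo[) (x `^ (- a))%:E =
   (b `^ (1 - a) / (a - 1))%:E)%E.
Proof.
move=> b0 a1; have a10 : 0 < a - 1 by lra.
(* The limit at infinity minus the value at [b] of the primitive x^(1-a) / (1-a). *)
have -> : b `^ (1 - a) / (a - 1) = (1 - a)^-1 * 0 - (1 - a)^-1 * b `^ (1 - a).
  by field; lra.
apply: (@ge0_integral_itvcy (fun x => x `^ (- a))
  (fun x => (1 - a)^-1 * x `^ (1 - a)) b ((1 - a)^-1 * 0) b0).
- by move=> x _; exact: powR_ge0.
- by move=> x x0; exact: continuous_powRl.
- move=> x x0.
  have := is_deriveZ (1 - a)^-1 (is_derive1_powR (1 - a) x0).
  rewrite /GRing.scale /= mulrA mulVf; last by lra.
  by rewrite mul1r addrAC subrr sub0r.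
- apply: cvgMr => //=; rewrite -[1 - a]opprB; exact: powRN_cvgy.
Qed.

Lemma integral_powRN_sub v a : 0 < v -> 1 < a ->
  (\int[leb]_(x in `[v, +oo[) (a * x `^ (- a - 1) * (x - v))%:E =
   (v `^ (1 - a) / (a - 1))%:E)%E.
Proof.
move=> v0 a1; have a10 : 0 < a - 1 by lra.
have -> : v `^ (1 - a) / (a - 1) = ((a / (1 - a)) * 0 + v * 0) -
    ((a / (1 - a)) * v `^ (1 - a) + v * v `^ (- a)).
  have -> : v * v `^ (- a) = v `^ (1 - a).
    by rewrite powRD_gt0 // powRr1 // ltW.
  by field; lra.
apply: (@ge0_integral_itvcy (fun x => a * x `^ (- a - 1) * (x - v))
  (fun x => (a / (1 - a)) * x `^ (1 - a) + v * x `^ (- a)) v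
  ((a / (1 - a)) * 0 + v * 0) v0).
- move=> x vx; rewrite mulr_ge0 ?subr_ge0 // mulr_ge0 ?powR_ge0 //; lra.
- move=> x x0; apply: continuousM.
    by apply: continuousM; [exact: cst_continuous|exact: continuous_powRl].
  by apply: continuousB => //; exact: cst_continuous.
- move=> x x0.
  apply: (@is_derive_eq _ _ _ _ _ _ _ _ (is_deriveD
    (is_deriveZ (a / (1 - a)) (is_derive1_powR (1 - a) x0))
    (is_deriveZ v (is_derive1_powR (- a) x0)))); rewrite /GRing.scale /=.
  have -> : 1 - a - 1 = - a - 1 + 1 by ring.
  rewrite [x `^ (- a - 1 + 1)]powRD_gt0 // powRr1; last exact: ltW.
  by field; lra.
- apply: cvgD; apply: cvgMr => //=; last by apply: powRN_cvgy; lra.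
  by rewrite -[1 - a]opprB; exact: powRN_cvgy.
Qed.

(** The double counting used throughout: the weight depends on the level only, so slices at a fixed
    level contribute their measure and slices at a fixed point the integral of the weight. *)
Lemma tonelli_weight d (T : measurableType d)
    (m : {sigma_finite_measure set T -> \bar R}) (w : measurableTypeR R -> \bar R)
    (Q : set (T * measurableTypeR R)) :
  measurable_fun setT w -> (forall t, 0 <= w t)%E -> measurable Q ->
  (\int[m]_x \int[leb]_(t in xsection Q x) w t =
   \int[leb]_t (w t * m (ysection Q t)))%E.
Proof.
move=> mw w0 mQ.
pose f (p : T * measurableTypeR R) := (w p.2 * (\1_Q p)%:E)%E.
have f0 p : (0 <= f p)%E by rewrite mule_ge0 // lee_fin.
have mf : measurable_fun setT f.
  apply: emeasurable_funM; first exact: measurableT_comp.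
  by apply/measurable_EFinP; exact: measurable_indic.
have := @fubini_tonelli _ _ _ _ R m
  (lebesgue_measure : {sigma_finite_measure set (measurableTypeR R) -> \bar R}) f mf f0.
move=> H; transitivity (\int[m]_x \int[leb]_t f (x, t))%E.
  apply: eq_integral => x _; rewrite integral_mkcond; apply: eq_integral => t _.
  rewrite /f patchE /= indicE.
  have -> : (t \in xsection Q x) = ((x, t) \in Q).
    by rewrite /xsection; apply/idP/idP; rewrite !inE /= ?inE.
  by case: ((x, t) \in Q); rewrite ?mule1 ?mule0.
rewrite H; apply: eq_integral => t _.
rewrite /f /= ge0_integralZl //.
  congr (_ * _)%E; rewrite -[RHS]mul1e -integral_cst //; last exact: measurable_ysection.
  rewrite [RHS]integral_mkcond; apply: eq_integral => x _.
  rewrite patchE indicE.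
  have -> : (x \in ysection Q t) = ((x, t) \in Q).
    by rewrite /ysection; apply/idP/idP; rewrite !inE /= ?inE.
  by case: ((x, t) \in Q).
by apply/measurable_EFinP; apply: measurableT_comp => //; exact: measurable_indic.
Qed.

Lemma measurable_integral_xsection d (T : measurableType d)
    (w : measurableTypeR R -> \bar R) (Q : set (T * measurableTypeR R)) :
  measurable_fun setT w -> (forall t, 0 <= w t)%E -> measurable Q ->
  measurable_fun setT (fun x => \int[leb]_(t in xsection Q x) w t)%E.
Proof.
move=> mw w0 mQ.
pose f (p : T * measurableTypeR R) := (w p.2 * (\1_Q p)%:E)%E.
have f0 p : (0 <= f p)%E by rewrite mule_ge0 // lee_fin.
have mf : measurable_fun setT f.
  apply: emeasurable_funM; first exact: measurableT_comp.
  by apply/measurable_EFinP; exact: measurable_indic.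
have := @measurable_fun_fubini_tonelli_F _ _ _ _ R
  (lebesgue_measure : {sigma_finite_measure set (measurableTypeR R) -> \bar R}) f mf f0.
congr measurable_fun; apply/funext => x; rewrite /fubini_F [RHS]integral_mkcond.
apply: eq_integral => t _.
rewrite /f patchE /= indicE.
have -> : (t \in xsection Q x) = ((x, t) \in Q).
  by rewrite /xsection; apply/idP/idP; rewrite !inE /= ?inE.
by case: ((x, t) \in Q); rewrite ?mule1 ?mule0.
Qed.

Lemma measurable_ler_set d (T : measurableType d) (f g : T -> R) :
  measurable_fun setT f -> measurable_fun setT g ->
  measurable [set x | f x <= g x].
Proof.
by move=> mf mg; rewrite -[X in measurable X]setTI; exact: measurable_fun_le.
Qed.

(** The distribution of [phi] is dominated by Lebesgue measure on [v, +oo[ in the sense of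
    distribution functions, and t^(-a) is decreasing. Writing phi^(-a) as the integral of a t^(-a-1)
    over t >= phi reduces the claim to that comparison. It serves both for the volume of superlevel
    sets and for the gradient outside a ball. *)
Lemma integral_powRN_le d (T : measurableType d)
    (m : {sigma_finite_measure set T -> \bar R}) (S : set T) (phi : T -> R) v a :
  measurable S -> measurable_fun setT phi -> 0 < v -> 1 < a ->
  (forall x, S x -> v <= phi x) ->
  (forall t, v <= t -> (m (S `&` [set x | phi x <= t]%R) <= (t - v)%:E)%E) ->
  (\int[m]_(x in S) (phi x `^ (- a))%:E <= (v `^ (1 - a) / (a - 1))%:E)%E.
Proof.
move=> mS mphi v0 a1 vphi mphiv; have a0 : 0 < a by lra.
pose w t := (a * t `^ (- a - 1))%:E.
have mw : measurable_fun [set: measurableTypeR R] (w : measurableTypeR R -> \bar R).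
  by apply/measurable_EFinP; apply: measurable_funM => //; exact: measurable_powR.
have w0 t : (0 <= w t)%E by rewrite lee_fin mulr_ge0 ?powR_ge0 // ltW.
pose Q : set (T * measurableTypeR R) := [set p | S p.1 /\ phi p.1 <= p.2].
have mQ : measurable Q.
  have -> : Q = (fst @^-1` S) `&` [set p | phi p.1 <= p.2] by [].
  apply: measurableI.
    by rewrite -[X in measurable X]setTI; exact: measurable_fst.
  apply: (@measurable_ler_set _ _ (fun p : T * measurableTypeR R => phi p.1)
    (fun p => p.2)); last exact: measurable_snd.
  exact: measurableT_comp.
have yQ t : ysection Q t = S `&` [set x | phi x <= t].
  by apply/seteqP; split => x; rewrite /ysection /= inE.
have -> : (\int[m]_(x in S) (phi x `^ (- a))%:E =
    \int[m]_x \int[leb]_(t in xsection Q x) w t)%E.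
  rewrite integral_mkcond; apply: eq_integral => x _; rewrite patchE.
  case: ifPn => [|]; rewrite ?inE ?notin_setE => Sx; last first.
    rewrite (_ : xsection Q x = set0) ?integral_set0 //.
    by apply/seteqP; split => t //; rewrite /xsection /= inE => -[/Sx].
  have p0 : 0 < phi x by exact: lt_le_trans (vphi x Sx).
  rewrite (_ : xsection Q x = `[phi x, +oo[%classic); last first.
    apply/seteqP; split => t; rewrite /xsection /= inE in_itv /= andbT.
      by case.
    by [].
  have e1 : - a - 1 = - (a + 1) by ring.
  rewrite /w; under eq_integral do rewrite EFinM e1.
  rewrite ge0_integralZl //; last first.
  - by rewrite lee_fin ltW.
  - by move=> t _; rewrite lee_fin powR_ge0.
  - apply/measurable_EFinP; apply: measurable_funTS.
    exact: measurable_powR.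
  rewrite integral_powRN //; last by lra.
  rewrite -EFinM; congr EFin; rewrite (_ : 1 - (a + 1) = - a); last by ring.
  by field; lra.
rewrite tonelli_weight // -integral_powRN_sub //.
rewrite [leRHS]integral_mkcond; apply: ge0_le_integral => //.
- by move=> t _; rewrite mule_ge0.
- apply: emeasurable_funM => //.
  exact: (@measurable_fun_ysection _ _ _ _ R m).
- apply/(measurable_restrictT _ _).1 => //.
  apply/measurable_EFinP; apply: measurable_funTS.
  apply: measurable_funM; last by apply: measurable_funB.
  by apply: measurable_funM => //; exact: measurable_powR.
move=> t _; rewrite patchE; case: ifPn => [|]; rewrite ?inE ?notin_setE /= in_itv /= andbT => vt.
  by rewrite yQ EFinM lee_wpmul2l // mphiv.
rewrite yQ (_ : S `&` _ = set0) ?measure0 ?mule0 //.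
apply/seteqP; split => x // [Sx /= xt]; apply: vt.
exact: le_trans (vphi x Sx) xt.
Qed.

Lemma layer_cake_ge d (T : measurableType d)
    (m : {sigma_finite_measure set T -> \bar R}) (A : set T) (h : T -> R) :
  measurable A -> measurable_fun setT h -> (forall x, 0 <= h x) ->
  (\int[m]_(x in A) (h x)%:E =
   \int[leb]_(t in `[0%R, +oo[) m (A `&` [set x | t <= h x]%R))%E.
Proof.
move=> mA mh h0.
pose Q : set (T * measurableTypeR R) := [set p | A p.1 /\ (0 <= p.2 /\ p.2 <= h p.1)].
have mQ : measurable Q.
  have -> : Q = (fst @^-1` A) `&` ([set p | 0 <= p.2] `&` [set p | p.2 <= h p.1]) by [].
  apply: measurableI.
    by rewrite -[X in measurable X]setTI; exact: measurable_fst.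
  apply: measurableI.
    apply: (@measurable_ler_set _ _ (fun=> 0) (fun p : T * measurableTypeR R => p.2)) => //.
    exact: measurable_snd.
  apply: (@measurable_ler_set _ _ (fun p : T * measurableTypeR R => p.2)
    (fun p => h p.1)); first exact: measurable_snd.
  exact: measurableT_comp.
have := @tonelli_weight _ _ m (fun=> 1%E) Q (measurable_cst _) (fun=> lee01) mQ.
under [X in X = _ -> _]eq_integral => x _.
  rewrite (_ : (\int[leb]_(t in xsection Q x) 1)%E = ((EFin \o h) \_ A) x); last first.
    rewrite integral_cst ?mul1e; last exact: measurable_xsection.
    rewrite patchE; case: ifPn => [|]; rewrite ?inE ?notin_setE => Ax; last first.
      rewrite (_ : xsection Q x = set0) ?measure0 //.
      by apply/seteqP; split => t //; rewrite /xsection /= inE => -[/Ax].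
    rewrite (_ : xsection Q x = `[0, h x]%classic); last first.
      apply/seteqP; split => t; rewrite /xsection /= inE in_itv /=.
        by case=> _ [-> ->].
      by case/andP.
    rewrite [leb _]lebesgue_measure_itv /= lte_fin oppr0 adde0; case: ifPn => //.
    by rewrite -leNgt => hx; congr EFin; apply/eqP; rewrite eq_le hx h0.
  over.
rewrite -integral_mkcond => ->; rewrite [RHS]integral_mkcond.
apply: eq_integral => t _; rewrite mul1e patchE.
case: ifPn => [|]; rewrite ?inE ?notin_setE /= in_itv /= andbT => t0.
  congr (m _); apply/seteqP; split => x; rewrite /ysection /= inE.
    by case=> ? [].
  by case.
rewrite (_ : ysection Q t = set0) ?measure0 //.
by apply/seteqP; split => x //; rewrite /ysection /= inE => -[_ [/t0]].
Qed.

(** At the crossover t = a^(-1/b) the integrand is min(a, x^(-b)), the largest possible mass of a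
    level set of s^(-1/b) inside a set of measure [a]. *)
Lemma integral_cst_powRN a b t : 0 <= a -> 0 < t -> 1 < b ->
  (\int[leb]_(x in `[0%R, +oo[) (if x < t then a else x `^ (- b))%:E =
   (a * t + t `^ (1 - b) / (b - 1))%:E)%E.
Proof.
move=> a0 t0 b1.
have -> : `[0, +oo[%classic = `[0, t[ `|` `[t, +oo[ :> set R.
  apply/seteqP; split => x /=; rewrite !in_itv /= !andbT.
    by move=> x0; rewrite x0; case: (ltP x t) => xt; [left|right].
  by case=> [/andP[]//|/(lt_le_trans t0)/ltW].
rewrite ge0_integral_setU //=; last 3 first.
- apply/measurable_EFinP; apply: measurable_funTS.
  apply: (@measurable_fun_ifT _ _ _ _ (cst a) (fun x => x `^ (- b))) => //.
  exact: measurable_fun_ltr.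
- by move=> x _; rewrite lee_fin; case: ifP => // _; exact: powR_ge0.
- apply/disj_setPS => x [] /=; rewrite !in_itv /= andbT => /andP[_ xt] tx; lra.
rewrite EFinD; congr (_ + _)%E.
  rewrite (eq_integral (fun=> a%:E)); last first.
    by move=> x; rewrite inE /= in_itv /= => /andP[_ ->].
  rewrite integral_cst // [leb _]lebesgue_measure_itv /= lte_fin t0 oppr0 adde0.
  by rewrite EFinM.
rewrite -integral_powRN //; apply: eq_integral => x.
by rewrite inE /= in_itv /= andbT ltNge => ->.
Qed.

End power_integrals.

(** * First-order increments of continuously differentiable functions *)

Section increments.
Context {R : realType} {d : nat}.
Implicit Types (u f : 'rV[R]_d -> R) (x w z : 'rV[R]_d).

Lemma is_derive_line f x z (t : R) : derivable f (x + t *: z) z ->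
  is_derive t (1 : R) (fun t : R => f (x + t *: z)) ('D_z f (x + t *: z)).
Proof.
have E : (fun h : R => h^-1 *: (((fun t : R => f (x + t *: z)) \o shift t) (h *: (1 : R)) -
      f (x + t *: z))) =
    (fun h : R => h^-1 *: ((f \o shift (x + t *: z)) (h *: z) - f (x + t *: z))).
  apply/funext => h; congr (_ *: (_ - _)); rewrite /= [h *: 1]mulr1 scalerDl.
  by congr f; rewrite addrCA.
by move=> df; apply: DeriveDef; rewrite /derivable /derive E.
Qed.

Lemma line_MVT f x z (t : R) : (forall x, derivable f x z) ->
  exists2 c : R, `|c| <= `|t| & f (x + t *: z) - f x = 'D_z f (x + c *: z) * t.
Proof.
move=> df; pose g (s : R) := f (x + s *: z).
have dg (s : R) : is_derive s (1 : R) g ('D_z f (x + s *: z)).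
  exact: is_derive_line.
have cg (a b : R) : {within `[a, b], continuous g}.
  apply: derivable_within_continuous => s _; exact: ex_derive.
have [t0|t0] := leP 0 t.
  have [c] := MVT_segment t0 (fun s _ => dg s) (@cg 0 t).
  rewrite in_itv /= => /andP[c0 ct].
  rewrite subr0 /g scale0r addr0 => E; exists c => //.
  by rewrite !ger0_norm.
have [c] := MVT_segment (ltW t0) (fun s _ => dg s) (@cg t 0).
rewrite in_itv /= => /andP[tc c0].
rewrite sub0r /g scale0r addr0 => E; exists c.
  by rewrite !ler0_norm ?lerN2 // ltW.
by rewrite -opprB E mulrN opprK.
Qed.

Lemma increment_partial_sum u x z :
  (forall i x, derivable u x (delta_mx 0 i)) ->
  exists xi : 'I_d -> 'rV[R]_d, (forall i j, `|xi i 0 j - x 0 j| <= enorm z) /\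
    u (x + z) - u x = \sum_i partial_derivative i u (xi i) * z 0 i.
Proof.
move=> du.
pose tr (k : nat) : 'rV[R]_d := \row_j (if (j < k)%N then z 0 j else 0).
have tr0 : tr 0%N = 0 by apply/rowP => j; rewrite !mxE.
have trd : tr d = z by apply/rowP => j; rewrite !mxE ltn_ord.
have trS (i : 'I_d) : tr i.+1 = tr i + z 0 i *: delta_mx 0 i.
  apply/rowP => j; rewrite !mxE eqxx /= ltnS leq_eqVlt.
  have [->|ij] := eqVneq j i; first by rewrite !eqxx ltnn /= mulr1 add0r.
  by rewrite (negbTE (ij : (j != i :> nat))) /= mulr0 addr0.
have H (i : 'I_d) : {c : R | `|c| <= `|z 0 i| &
    u (x + tr i.+1) - u (x + tr i) =
    partial_derivative i u (x + tr i + c *: delta_mx 0 i) * z 0 i}.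
  apply: cid2; have [c cz E] := line_MVT (x + tr i) (z 0 i) (du i).
  by exists c => //; rewrite trS addrA.
exists (fun i : 'I_d => x + tr i + s2val (H i) *: delta_mx 0 i); split.
  move=> i j; case: (H i) => c /= cz _; rewrite !mxE eqxx /=.
  rewrite -[x 0 j + _ + _]addrA [x 0 j + _]addrC addrK.
  have [->|ij] := eqVneq j i.
    by rewrite ltnn mulr1 add0r (le_trans cz) // le_coord_enorm.
  rewrite mulr0 addr0; case: ifP => _; first exact: le_coord_enorm.
  by rewrite normr0 enorm_ge0.
transitivity (\sum_(i < d) (u (x + tr i.+1) - u (x + tr i))).
  rewrite -(big_mkord xpredT (fun i => u (x + tr i.+1) - u (x + tr i))).
  by rewrite telescope_sumr // tr0 trd addr0.
by apply: eq_bigr => i _; case: (H i).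
Qed.

(** The nearby point [w] may leave [K], as happens for the intermediate points of an increment
    starting in [K]. *)
Lemma compact_uniform_continuous f (K : set 'rV[R]_d) : continuous f -> compact K ->
  forall e : R, 0 < e -> exists2 r : R, 0 < r &
    forall x w, K x -> (forall j, `|w 0 j - x 0 j| < r) -> `|f w - f x| < e.
Proof.
move=> cf /compact_near_coveringP nK e e0.
pose P (r : R) x := forall w, ball x r w -> `|f w - f x| < e.
have : \forall r \near (0 : R)^'+, K `<=` P r.
  apply: (nK _ _ P) => x Kx.
  have e2 : 0 < e / 2 by rewrite divr_gt0.
  have /cvgrPdist_lt/(_ _ e2) : f w @[w --> x] --> f x by exact: cf.
  move=> /nbhs_ballP[r /= r0 fr].
  have r2 : 0 < r / 2 by rewrite divr_gt0.
  exists (ball x (r / 2), [set s : R | s < r / 2]) => /=.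
    split; first exact: nbhsx_ballx.
    exact: nbhs_right_lt.
  move=> [x' s] /= [xx' sr] w x'w.
  have h1 : `|f x - f x'| < e / 2.
    by apply: fr; apply: le_ball xx'; rewrite ler_pdivrMr // mulr2n mulrDr mulr1; lra.
  have h2 : `|f x - f w| < e / 2.
    apply: fr; apply: (ball_split xx'); apply: le_ball x'w; exact: ltW.
  rewrite -(subrKA (f x)) (splitr e); apply: le_lt_trans (ler_normD _ _) _.
  by rewrite ltrD // distrC.
move=> h; have [r [r0 rK]] : exists r : R, 0 < r /\ K `<=` P r.
  near (0 : R)^'+ => r; exists r; split => //; near: r; exact: h.
exists r => // x w Kx wx; apply: rK => //; split => // i j.
by rewrite ord1 /ball /= distrC.
Unshelve. all: by end_near. Qed.

Definition grad_norm u x : R := enorm (\row_i partial_derivative i u x).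

Lemma sqr_grad_norm u x : grad_norm u x ^+ 2 = \sum_i partial_derivative i u x ^+ 2.
Proof. by rewrite sqr_enorm; apply: eq_bigr => i _; rewrite mxE. Qed.

Lemma continuous_grad_norm u : (forall i, continuous (partial_derivative i u)) ->
  continuous (grad_norm u).
Proof.
move=> cp x; rewrite /grad_norm /enorm.
apply: (@continuous_comp _ _ _ (fun x => \sum_i (\row_i partial_derivative i u x) 0 i ^+ 2)
  (@Num.sqrt R)); last exact: sqrt_continuous.
apply: continuous_bigsum => i {}x; under eq_fun do rewrite mxE.
apply: (@continuous_comp _ _ _ (partial_derivative i u) (fun t => t ^+ 2)).
  exact: cp.
exact: exprn_continuous.
Qed.

(** Replacing the partial derivatives at the intermediate points by those at [x] costs at most e/d
    each; Cauchy-Schwarz handles the main term. The uniformity in [x] lets one shell width serve for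
    all points and levels. *)
Lemma compact_increment_bound u (K : set 'rV[R]_d) :
  (forall i x, derivable u x (delta_mx 0 i)) ->
  (forall i, continuous (partial_derivative i u)) -> compact K ->
  forall e : R, 0 < e -> exists2 r : R, 0 < r &
    forall x z, K x -> enorm z < r ->
      u (x + z) - u x <= enorm z * (grad_norm u x + e).
Proof.
move=> du cp cK e e0.
have [d0|d0] := posnP d.
  exists 1 => // x z _ _; rewrite (_ : x + z = x).
    by rewrite subrr mulr_ge0 ?enorm_ge0 // addr_ge0 ?enorm_ge0 // ltW.
  by apply/rowP => i; have := ltn_ord i; rewrite [X in (_ < X)%N]d0.
have dp : 0 < d%:R :> R by rewrite ltr0n.
pose e' := e / d%:R; have e'0 : 0 < e' by rewrite divr_gt0.
have H (i : 'I_d) : {r : R | 0 < r &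
    forall x w, K x -> (forall j, `|w 0 j - x 0 j| < r) ->
    `|partial_derivative i u w - partial_derivative i u x| < e'}.
  by apply: cid2; exact: compact_uniform_continuous.
pose r := \big[Num.min/1]_(i < d) s2val (H i).
have r0 : 0 < r by apply: lt_bigmin => // i _; case: (H i).
exists r => // x z Kx zr.
have [xi [xix ->]] := increment_partial_sum x z du.
have -> : \sum_i partial_derivative i u (xi i) * z 0 i =
   \sum_i (\row_i partial_derivative i u x) 0 i * z 0 i +
   \sum_i (partial_derivative i u (xi i) - partial_derivative i u x) * z 0 i.
  by rewrite -big_split /=; apply: eq_bigr => i _; rewrite mxE -mulrDl addrC subrK.
rewrite mulrDr lerD //; first by rewrite mulrC sum_mul_le_enorm.
apply: (@le_trans _ _ (\sum_(i < d) enorm z * e')); last first.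
  by rewrite sumr_const card_ord -mulr_natr -mulrA /e' divfK // gt_eqF.
apply: ler_sum => i _; apply: le_trans (ler_norm _) _.
rewrite normrM mulrC; apply: ler_pM => //; first exact: le_coord_enorm.
have rH : r <= s2val (H i) by exact: bigmin_le_cond.
case: (H i) rH => ri /= ri0 hri rri; apply/ltW/hri => // j.
exact: le_lt_trans (xix i j) (lt_le_trans zr rri).
Qed.

Lemma compact_norm_le (k : R) : compact [set x : 'rV[R]_d | forall i, `|x 0 i| <= k].
Proof.
have -> : [set x : 'rV[R]_d | forall i, `|x 0 i| <= k] =
    \bigcap_i [set x : 'rV[R]_d | `|x 0 i| <= k].
  by apply/seteqP; split => x h i *; exact: h.
apply: bounded_closed_compact.
  exists `|k|; split; first exact: num_real.
  move=> t kt x /= xk; rewrite [leLHS](mx_normrE x : `|x| = _).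
  apply: bigmax_le => [|[i j] _ /=]; first by rewrite (le_trans _ (ltW kt)).
  by rewrite ord1 (le_trans (xk j I)) // (le_trans (ler_norm k)) // ltW.
apply: closed_bigI => i _.
apply: (@closed_comp _ _ (fun x : 'rV[R]_d => `|x 0 i|) [set t : R | t <= k]).
  move=> x _; apply: (@continuous_comp _ _ _ (fun x : 'rV[R]_d => x 0 i) (fun t : R => `|t|)).
    exact: coord_continuous.
  exact: norm_continuous.
exact: closed_le.
Qed.

End increments.

Lemma open_rV_rat {R : realType} {d : nat} (U : set 'rV[R]_d) :
  open U -> U !=set0 -> exists q : 'rV[rat]_d, U (map_mx ratr q).
Proof.
move=> oU [x]; rewrite (open_rV_obox oU) => -[q /= qU xq].
exists (\row_i ((q.1 0 i + q.2 0 i) / 2)); exists q => // i.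
have := xq i; rewrite !mxE => /andP[h1 h2].
by rewrite fmorph_div rmorphD rmorph_nat; apply/andP; split; lra.
Qed.

(** * Superlevel sets and the isoperimetric inequality *)

Section level_sets.
Context {R : realType} {d : nat}.
Variables (u : 'rV[R]_d -> R) (s a k : R).
Hypotheses (d_gt0 : (0 < d)%N) (cu : continuous u).
Hypotheses (s_gt0 : 0 < s) (s_lt1 : s < 1) (a_gt0 : 0 < a) (k_ge1 : 1 <= k).
Hypothesis u_box : [set x | s / 2 <= u x] `<=` obox (const_mx (- k)) (const_mx k).
Hypothesis a_le : (a%:E <= lebesgue_rV d [set x | 1 <= u x]%R)%E.

Hypothesis du : forall i x, derivable u x (delta_mx 0 i).
Hypothesis cp : forall i, continuous (partial_derivative i u).
Let leb : {measure set (measurableTypeR R) -> \bar R} := @lebesgue_measure R.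

(* Truncating the level at s / 2 makes all these sets bounded. *)
Definition vol_gt (t : R) : R :=
  fine (lebesgue_rV d [set x | Num.max t (s / 2) < u x]).
Definition vol_ge (t : R) : R :=
  fine (lebesgue_rV d [set x | Num.max t (s / 2) <= u x]).

Let p : R := (d%:R - 1) / d%:R.
Let kappa : R := @unit_ball_volume R d `^ d%:R^-1.

Lemma half_lt1 : s / 2 < 1.
Proof. have h0 := s_gt0; have h1 := s_lt1; lra. Qed.

Lemma half_le : s / 2 <= s.
Proof. have h0 := s_gt0; lra. Qed.

Lemma measurable_gt_set (t : R) : measurable [set x | t < u x].
Proof.
apply: (@continuous_measurable_rV _ _ _ u [set v | t < v]) => //; exact: open_gt.
Qed.

Lemma measurable_ge_set (t : R) : measurable [set x | t <= u x].
Proof.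
rewrite -[X in measurable X]setCK; apply: measurableC.
rewrite (_ : ~` _ = u @^-1` [set v | v < t]).
  apply: (@continuous_measurable_rV _ _ _ u [set v | v < t]) => //; exact: open_lt.
by apply/seteqP; split => x /=; rewrite ltNge => /negP.
Qed.

Lemma vol_geE t :
  lebesgue_rV d [set x | Num.max t (s / 2) <= u x] = (vol_ge t)%:E.
Proof.
rewrite /vol_ge fineK // ge0_fin_numE //.
apply: (lebesgue_rV_bounded (k := k)); first exact: measurable_ge_set.
by move=> x /=; rewrite ge_max => /andP[_ /u_box].
Qed.

Lemma vol_gtE t :
  lebesgue_rV d [set x | Num.max t (s / 2) < u x] = (vol_gt t)%:E.
Proof.
rewrite /vol_gt fineK // ge0_fin_numE //.
apply: (lebesgue_rV_bounded (k := k)); first exact: measurable_gt_set.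
by move=> x /=; rewrite gt_max => /andP[_ /ltW /u_box].
Qed.

Lemma vol_gt_le t t' : t <= t' -> vol_gt t' <= vol_gt t.
Proof.
move=> tt'; rewrite -lee_fin -!vol_gtE; apply: le_measure; rewrite ?inE;
  try exact: measurable_gt_set.
move=> x /=; rewrite !gt_max => /andP[h ->]; rewrite andbT.
exact: le_lt_trans h.
Qed.

Lemma vol_ge_le t t' : t <= t' -> vol_ge t' <= vol_ge t.
Proof.
move=> tt'; rewrite -lee_fin -!vol_geE; apply: le_measure; rewrite ?inE;
  try exact: measurable_ge_set.
move=> x /=; rewrite !ge_max => /andP[h ->]; rewrite andbT.
exact: le_trans h.
Qed.

Lemma vol_ge_le_gt t t' : t < t' -> s / 2 < t' -> vol_ge t' <= vol_gt t.
Proof.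
move=> tt' st'; rewrite -lee_fin -vol_gtE -vol_geE; apply: le_measure; rewrite ?inE;
  [exact: measurable_ge_set|exact: measurable_gt_set|].
move=> x /=; rewrite ge_max gt_max => /andP[h _].
by rewrite !(lt_le_trans _ h).
Qed.

Lemma le_vol_gt t : t < 1 -> a <= vol_gt t.
Proof.
move=> t1; rewrite -lee_fin -vol_gtE; apply: (le_trans a_le).
apply: le_measure; rewrite ?inE; [exact: measurable_ge_set|exact: measurable_gt_set|].
move=> x /= h; rewrite gt_max; apply/andP; split; apply: lt_le_trans h => //.
exact: half_lt1.
Qed.

Lemma le_vol_ge t : t <= 1 -> a <= vol_ge t.
Proof.
move=> t1; rewrite -lee_fin -vol_geE; apply: (le_trans a_le).
apply: le_measure; rewrite ?inE; try exact: measurable_ge_set.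
by move=> x /= h; rewrite ge_max; apply/andP; split; apply: le_trans h => //; exact: ltW half_lt1.
Qed.

Lemma vol_gt_ge0 t : 0 <= vol_gt t.
Proof. exact: fine_ge0. Qed.

Lemma p_ge0 : 0 <= p.
Proof. by rewrite divr_ge0 // subr_ge0 ler1n. Qed.

Lemma p_le1 : p <= 1.
Proof. by rewrite ler_pdivrMr ?ltr0n // mul1r gerBl. Qed.

Definition enlarged (e t : R) : set 'rV[R]_d :=
  [set x | exists2 z, enorm z < e & t < u (x + z)].

Lemma measurable_enlarged e t : measurable (enlarged e t).
Proof.
have -> : enlarged e t = \bigcup_(z in [set z : 'rV[R]_d | enorm z < e])
    ((fun x => x + z) @^-1` [set x | t < u x]).
  by apply/seteqP; split => x [z ? ?]; exists z.
apply: open_measurable_rV; apply: bigcup_open => z _.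
apply: open_comp; first by move=> x _; apply: continuousD => //; exact: cst_continuous.
by apply: (@open_comp _ _ u [set v | t < v]); [move=> x _; exact: cu | exact: open_gt].
Qed.

Lemma vol_enlarged e t : 0 < e <= 1 -> s <= t < 1 ->
  ((d%:R * kappa * e * vol_gt t `^ p)%:E <=
   lebesgue_rV d (enlarged e t `\` [set x | t < u x]%R))%E.
Proof.
move=> /andP[e0 e1] /andP[st t1].
have tm : Num.max t (s / 2) = t.
  by apply/max_idPl; apply: le_trans st; exact: half_le.
have Vt := vol_gtE t; rewrite tm in Vt.
have dp : 0 < d%:R :> R by rewrite ltr0n.
have v0 : 0 < vol_gt t by apply: lt_le_trans (le_vol_gt t1).
have w0 := @unit_ball_volume_gt0 R d.
pose x := vol_gt t `^ d%:R^-1; pose y := kappa * e.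
have x0 : 0 < x by rewrite powR_gt0.
have y0 : 0 < y by rewrite mulr_gt0 // powR_gt0.
have rootK (v : R) : 0 < v -> (v `^ d%:R^-1) ^+ d = v.
  by move=> ?; rewrite -powR_mulrn ?powR_ge0 // -powRrM mulVf ?gt_eqF // powRr1 // ltW.
have xE : x ^+ d = vol_gt t by exact: rootK.
have yE : y ^+ d = unit_ball_volume (R := R) (d := d) * e ^+ d.
  by rewrite exprMn rootK.
have BM : (((x + y) ^+ d)%:E <= lebesgue_rV d (enlarged e t))%E.
  apply: (@brunn_minkowski_obox _ _ [set z | t < u z] (eball 0 e) _ k) => //.
  - exact: measurable_gt_set.
  - exact: measurable_eball.
  - exact: measurable_enlarged.
  - by move=> z /= h; apply: u_box => /=; move: h; rewrite -{1}tm gt_max => /andP[_ /ltW].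
  - move=> z; rewrite /eball /= subr0 => ze i; rewrite !mxE -ltr_norml.
    by apply: le_lt_trans (le_coord_enorm z i) _; have h1 := k_ge1; lra.
  - move=> x' b /= ux; rewrite /eball /= subr0 => be; exists (- b); last by rewrite addrK.
    by rewrite -scaleN1r enormZ normrN1 mul1r.
  - by rewrite xE Vt.
  - by rewrite yE lebesgue_eball.
rewrite measureD ?ge0_fin_numE //; last 3 first.
- exact: measurable_enlarged.
- exact: measurable_gt_set.
- apply: (lebesgue_rV_bounded (k := k + 1)); first exact: measurable_enlarged.
  move=> z [b be tb] i; rewrite !mxE -ltr_norml.
  have /u_box/(_ i) : [set x | s / 2 <= u x] (z + b).
    by move: tb; rewrite -{1}tm /= gt_max => /andP[_ /ltW].
  rewrite !mxE -ltr_norml => h.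
  have -> : z 0 i = (z 0 i + b 0 i) - b 0 i by rewrite addrK.
  apply: le_lt_trans (ler_normB _ _) _; apply: ltrD => //.
  by apply: le_lt_trans (le_coord_enorm b i) _; lra.
rewrite (_ : _ `&` _ = [set x | t < u x]); last first.
  apply/seteqP; split => z /=; first by case.
  move=> h; split => //; exists 0; first by rewrite enorm0.
  by rewrite addr0.
rewrite [X in (_ - X)%E](_ : _ = (vol_gt t)%:E) //.
apply: (@le_trans _ _ (((x + y) ^+ d)%:E - (vol_gt t)%:E)%E); last first.
  by apply: leeB.
rewrite -EFinB lee_fin lerBrDl.
(* The tangent at x = V^(1/d) leaves V + d x^(d-1) y, where x^(d-1) = V^p and y = kappa e. *)
have := ler_expr_tangent d.-1 (ltW (addr_gt0 x0 y0)) (ltW x0).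
rewrite prednK // [x + y - x]addrAC subrr add0r; apply: le_trans.
rewrite xE lerD2l /y.
have -> : x ^+ d.-1 = vol_gt t `^ p.
  rewrite -powR_mulrn ?powR_ge0 // -powRrM /p; congr (_ `^ _).
  by rewrite mulrC; congr (_ / _); rewrite -subn1 natrB.
by rewrite le_eqVlt; apply/orP; left; apply/eqP; ring.
Qed.

Lemma measurable_vol_gt : measurable_fun [set: R] vol_gt.
Proof. by apply: nonincreasing_measurable => // x y; exact: vol_gt_le. Qed.

Lemma measurable_vol_ge : measurable_fun [set: R] vol_ge.
Proof. by apply: nonincreasing_measurable => // x y; exact: vol_ge_le. Qed.

Lemma continuous_measurable_fun_rV (f : 'rV[R]_d -> R) :
  continuous f -> measurable_fun setT f.
Proof.
move=> cf; apply: (measurability _ (RGenOpens.measurableE R)).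
by move=> _ [_ [v [t ->] <-]]; rewrite setTI; exact: continuous_measurable_rV.
Qed.

Lemma compact_bounded_above (f : 'rV[R]_d -> R) (K : set 'rV[R]_d) :
  continuous f -> compact K -> exists2 L : R, 0 <= L & forall x, K x -> f x <= L.
Proof.
move=> cf cK; have [->|K0] := eqVneq K set0; first by exists 0.
have K0' : K !=set0 by exact/set0P.
have [c _ cmax] := EVT_max_rV K0' cK (continuous_subspaceT cf).
exists (Num.max 0 (f c)); first by rewrite le_max lexx.
by move=> x Kx; rewrite le_max cmax ?orbT // inE.
Qed.

(** For fixed x and t the displacements that reach a value above [t] form an open set, so a rational
    one can be chosen; this turns the uncountable union into a countable one. *)
Let measurable_incidence (e : R) : measurable
  [set q : 'rV[R]_d * measurableTypeR R |
    s <= q.2 < 1 /\ (enlarged e q.2 q.1 /\ u q.1 <= q.2)].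
Proof.
have mu := continuous_measurable_fun_rV cu.
have -> : [set q : 'rV[R]_d * measurableTypeR R |
    s <= q.2 < 1 /\ (enlarged e q.2 q.1 /\ u q.1 <= q.2)] =
  (snd @^-1` `[s, 1[%classic) `&` ((\bigcup_(z in [set z : 'rV[rat]_d |
      enorm (map_mx ratr z : 'rV[R]_d) < e])
    ~` [set q | u (q.1 + map_mx ratr z) <= q.2]) `&` [set q | u q.1 <= q.2]).
  apply/seteqP; split => [[x t] /= [st [[z ze tz] ut]]|[x t] /= [st [[z ze tz] ut]]].
    split; first by rewrite in_itv.
    split => //.
    have [q [qe qt]] : exists q : 'rV[rat]_d,
        ([set z | enorm z < e] `&` [set z | t < u (x + z)]) (map_mx ratr q).
      apply: open_rV_rat; last by exists z.
      apply: openI.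
        have -> : [set z : 'rV[R]_d | enorm z < e] = eball 0 e.
          by apply/seteqP; split => y; rewrite /eball /= subr0.
        exact: open_eball.
      apply: (@open_comp _ _ (fun z => x + z) [set v | t < u v]).
        by move=> y _; apply: continuousD => //; exact: cst_continuous.
      by apply: (@open_comp _ _ u [set v | t < v]); [move=> y _; exact: cu | exact: open_gt].
    by exists q => //=; apply/negP; rewrite -ltNge.
  move: st; rewrite in_itv /= => st; split => //; split => //.
  exists (map_mx ratr z) => //.
  by rewrite ltNge; apply/negP.
apply: measurableI.
  by rewrite -[X in measurable X]setTI; apply: measurable_snd.
apply: measurableI; last first.
  apply: (@measurable_ler_set _ _ _ (fun q : 'rV[R]_d * measurableTypeR R => u q.1)
    (fun q => q.2)); last exact: measurable_snd.
  exact: measurableT_comp.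
rewrite bigcup_mkcond; apply: countable_bigcupT_measurable; first exact: countableP.
move=> z; case: ifP => // _; apply: measurableC.
apply: (@measurable_ler_set _ _ _
  (fun q : 'rV[R]_d * measurableTypeR R => u (q.1 + map_mx ratr z))
  (fun q => q.2)); last exact: measurable_snd.
apply: (@measurableT_comp _ _ _ _ _ _ u) => //.
apply: (@measurableT_comp _ _ _ _ _ _ (fun x : 'rV[R]_d => x + map_mx ratr z)) => //.
have := @measurable_affine_rV R d 1 (map_mx ratr z).
by congr measurable_fun; apply/funext => x; rewrite scale1r.
Qed.

(** The pairs (x, t) with x in the e-shell around {u > t} are counted in two ways. For fixed t,
    Brunn-Minkowski bounds the shell from below. For fixed x, the admissible t lie in an interval
    starting at u(x) of length at most e (|grad u(x)| + et). On that interval t - de < u(x), so V(t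
    - de) is at least [vol_ge (u x)] and the weight is at most its value in the right-hand
    integrand; without the shift by [de] this comparison would go the wrong way. The width [e] then
    cancels. *)
Lemma weighted_isoperimetric (de et : R) : 0 < de <= s / 2 -> 0 < et ->
  ((d%:R * kappa)%:E *
     \int[leb]_(t in `[s, 1%R[) (vol_gt (t - de) `^ (- p) * vol_gt t `^ p)%:E <=
   \int[lebesgue_rV d]_(x in [set x | s / 2 <= u x < 1]%R)
     (vol_ge (u x) `^ (- p) * (grad_norm u x + et))%:E)%E.
Proof.
move=> /andP[de0 des] et0.
have [h0 h1 h2 hk] : [/\ 0 < s, s < 1, 0 < a & 1 <= k] by [].
pose K := [set x : 'rV[R]_d | forall i, `|x 0 i| <= k + 1].
have cK : compact K by exact: compact_norm_le.
have [r r0 Hr] := compact_increment_bound du cp cK et0.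
have cG := continuous_grad_norm cp.
have [L L0 GL] := compact_bounded_above cG cK.
have Le0 : 0 < L + et by rewrite ltr_wpDl.
(* The three bounds make the increment estimate valid, keep the shells inside the enlarged box [K],
   and let [u] rise by at most [de] across a shell. *)
pose e := Num.min (Num.min r 1) (de / (L + et)).
have e0 : 0 < e by rewrite !lt_min r0 ltr01 divr_gt0.
have er : e <= r by rewrite !ge_min lexx.
have e1 : e <= 1 by rewrite !ge_min lexx orbT.
have ede : e * (L + et) <= de by rewrite -ler_pdivlMr // ge_min lexx orbT.
pose Q := [set q : 'rV[R]_d * measurableTypeR R |
    s <= q.2 < 1 /\ (enlarged e q.2 q.1 /\ u q.1 <= q.2)].
have mQ : measurable Q by exact: measurable_incidence.
pose w (t : measurableTypeR R) := ((vol_gt (t - de)) `^ (- p))%:E.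
have mw : measurable_fun setT w.
  apply/measurable_EFinP; apply: (@measurableT_comp _ _ _ _ _ _ (fun v : R => v `^ (- p))).
    exact: measurable_powR.
  apply: (measurableT_comp measurable_vol_gt); exact: measurable_funB.
have w0 t : (0 <= w t)%E by rewrite lee_fin powR_ge0.
have T := tonelli_weight (@lebesgue_rV_sf R d) mw w0 mQ.
have mu := continuous_measurable_fun_rV cu.
pose S := [set x | s / 2 <= u x < 1].
have mS : measurable S.
  rewrite (_ : S = [set x | s / 2 <= u x] `&` ~` [set x | 1 <= u x]).
    apply: measurableI; last apply: measurableC; exact: measurable_ge_set.
  apply/seteqP; split => x; rewrite /S /=; first by case/andP => -> ?; split => //; apply/negP; rewrite -ltNge.
  by case=> -> /negP; rewrite -ltNge => ->.
pose F x := (vol_ge (u x) `^ (- p) * (grad_norm u x + et))%:E.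
have F0 x : (0 <= F x)%E.
  by rewrite lee_fin mulr_ge0 ?powR_ge0 // addr_ge0 ?enorm_ge0 // ltW.
have mF : measurable_fun setT F.
  apply/measurable_EFinP; apply: measurable_funM.
    apply: (@measurableT_comp _ _ _ _ _ _ (fun v : R => v `^ (- p))).
      exact: measurable_powR.
    exact: (measurableT_comp measurable_vol_ge).
  by apply: measurable_funD => //; exact: continuous_measurable_fun_rV.
have slice x t : xsection Q x t ->
    [/\ S x, u x <= t <= u x + e * (grad_norm u x + et) &
        vol_ge (u x) <= vol_gt (t - de)].
  rewrite /xsection /= inE => -[/= /andP[st t1] [[z ze tz] ut]].
  have Kx : K x.
    move=> i; have /u_box/(_ i) : [set x | s / 2 <= u x] (x + z) by rewrite /=; lra.
    rewrite !mxE -ltr_norml => h.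
    have -> : x 0 i = (x 0 i + z 0 i) - z 0 i by rewrite addrK.
    apply: le_trans (ler_normB _ _) _; apply: lerD; first exact: ltW.
    by apply: le_trans (le_coord_enorm z i) _; lra.
  have Hx := Hr x z Kx (lt_le_trans ze er).
  have Gx := GL x Kx.
  have g0 : 0 <= grad_norm u x by exact: enorm_ge0.
  have H1 : enorm z * (grad_norm u x + et) <= e * (grad_norm u x + et).
    by apply: ler_wpM2r; [lra|exact: ltW].
  have H2 : e * (grad_norm u x + et) <= de.
    by apply: le_trans ede; apply: ler_wpM2l; lra.
  split; [by rewrite /S /=; lra|by lra|].
  by apply: vol_ge_le_gt; lra.
rewrite -(@lee_pmul2l _ e%:E) ?lte_fin //.
apply: (@le_trans _ _ (\int[leb]_t (w t * lebesgue_rV d (ysection Q t)))%E).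
  rewrite muleA -EFinM -ge0_integralZl //; last 3 first.
  - apply/measurable_EFinP; apply: measurable_funM.
      apply: (@measurableT_comp _ _ _ _ _ _ (fun v : R => v `^ (- p))).
        exact: measurable_powR.
      apply: measurable_funTS; apply: (measurableT_comp measurable_vol_gt).
      exact: measurable_funB.
    apply: (@measurableT_comp _ _ _ _ _ _ (fun v : R => v `^ p)).
      exact: measurable_powR.
    apply: measurable_funTS; exact: measurable_vol_gt.
  - by move=> t _; rewrite lee_fin mulr_ge0 // powR_ge0.
  - by rewrite lee_fin !mulr_ge0 ?powR_ge0 // ltW.
  rewrite [leLHS]integral_mkcond; apply: ge0_le_integral => //.
  - move=> t _; apply: erestrict_ge0 => {}t _.
    by rewrite -EFinM lee_fin !mulr_ge0 ?powR_ge0 // ltW.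
  - apply/(measurable_restrictT _ _).1 => //; apply: measurable_funTS.
    under eq_fun do rewrite -EFinM.
    apply/measurable_EFinP; apply: measurable_funM => //; apply: measurable_funM.
      apply: (@measurableT_comp _ _ _ _ _ _ (fun v : R => v `^ (- p))).
        exact: measurable_powR.
      by apply: (measurableT_comp measurable_vol_gt); exact: measurable_funB.
    apply: (@measurableT_comp _ _ _ _ _ _ (fun v : R => v `^ p)).
      exact: measurable_powR.
    exact: measurable_vol_gt.
  - apply: emeasurable_funM => //.
    exact: (@measurable_fun_ysection _ _ _ _ R (@lebesgue_rV_sf R d)).
  move=> t _; rewrite patchE; case: ifPn => [|_]; last by rewrite mule_ge0.
  rewrite inE /= in_itv /= => st.
  have -> : ysection Q t = enlarged e t `\` [set x | t < u x].
    apply/seteqP; split => x; rewrite /ysection /= inE /Q /=.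
      by case=> _ [h ut]; split => //; apply/negP; rewrite -leNgt.
    by case=> h /negP; rewrite -leNgt.
  rewrite -EFinM (_ : e * (d%:R * kappa) * (vol_gt (t - de) `^ (- p) * vol_gt t `^ p) =
    vol_gt (t - de) `^ (- p) * (d%:R * kappa * e * vol_gt t `^ p)); last by ring.
  rewrite EFinM; apply: lee_wpmul2l; [exact: w0|apply: vol_enlarged => //].
  by rewrite e0.
rewrite -[leLHS]T -ge0_integralZl //; last 3 first.
- exact: measurable_funTS.
- by move=> x _; exact: F0.
- by rewrite lee_fin ltW.
rewrite [leRHS]integral_mkcond; apply: ge0_le_integral => //.
- by move=> x _; apply: integral_ge0.
- exact: measurable_integral_xsection.
- apply/(measurable_restrictT _ _).1 => //; apply: measurable_funTS.
  by apply: emeasurable_funM.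
move=> x _; have [->|/set0P[t0 xt0]] := eqVneq (xsection Q x) set0.
  rewrite integral_set0; apply: erestrict_ge0 => {}x _.
  by apply: mule_ge0; [rewrite lee_fin ltW|exact: F0].
have [Sx ut0 _] := slice _ _ xt0.
rewrite patchE mem_set //.
apply: (@le_trans _ _ (\int[leb]_(t in xsection Q x) (vol_ge (u x) `^ (- p))%:E)%E).
  apply: ge0_le_integral => //.
  - exact: measurable_xsection.
  - exact: measurable_funTS.
  move=> t /slice[_ _ vv]; rewrite lee_fin; apply: powRN_le vv.
    exact: p_ge0.
  by apply: lt_le_trans h2 _; apply: le_vol_ge; case/andP: Sx => _ /ltW.
rewrite integral_cst; last exact: measurable_xsection.
rewrite /F EFinM muleCA lee_wpmul2l ?lee_fin ?powR_ge0 //.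
apply: (@le_trans _ _ (leb (`[u x, u x + e * (grad_norm u x + et)]%classic : set R))).
  apply: le_measure; rewrite ?inE; [exact: measurable_xsection|exact: measurable_itv|].
  by move=> t /slice[_ h _]; rewrite /= in_itv.
rewrite [leb _]lebesgue_measure_itv /= lte_fin; case: ifP => _.
  by rewrite -EFinB -EFinM lee_fin addrAC subrr add0r.
by rewrite -EFinM lee_fin mulr_ge0 ?ltW // ltr_wpDl // enorm_ge0.
Qed.

End level_sets.

(** * The capacity-volume inequality *)

Section isocapacitary.
Context {R : realType}.
Let leb : {measure set (measurableTypeR R) -> \bar R} := @lebesgue_measure R.

(** The price of the shift. The ratio V(t) / V(t - de) is at most 1 and p <= 1, so its p-th power is
    at least the ratio itself, which differs from 1 by at most (V(t - de) - V(t)) / a. The integral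
    of V(t - de) - V(t) telescopes to an interval of length [de], where V <= V(s - de). No
    continuity of V is involved. *)
Lemma integral_shift_ratio (V : R -> R) (s de a p : R) :
  (forall t t', t <= t' -> V t' <= V t) -> (forall t, t < 1 -> a <= V t) ->
  0 < a -> 0 <= p -> p <= 1 -> s < 1 -> 0 < de ->
  ((1 - s - de * V (s - de) / a)%:E <=
   \int[leb]_(t in `[s, 1%R[) (V (t - de) `^ (- p) * V t `^ p)%:E)%E.
Proof.
move=> Vle aV a0 p0 p1 s1 de0.
have mV : measurable_fun [set: measurableTypeR R] V.
  by apply: nonincreasing_measurable => // x y; exact: Vle.
have mVs : measurable_fun [set: measurableTypeR R] (fun t => V (t - de)).
  by apply: (measurableT_comp mV); exact: measurable_funB.
have mP (q : R) (f : measurableTypeR R -> R) : measurable_fun setT f ->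
    measurable_fun setT (fun t => f t `^ q).
  by move=> mf; apply: (measurableT_comp (measurable_powR q)).
have V0 t : t < 1 -> 0 < V t by move=> /aV; exact: lt_le_trans.
pose I (A : set R) := (\int[leb]_(t in A) (V t)%:E)%E.
pose J := (\int[leb]_(t in `[s, 1%R[) (V (t - de) `^ (- p) * V t `^ p)%:E)%E.
have ms1 : measurable (`[s, 1[%classic : set R) by exact: measurable_itv.
have len (x y : R) : x <= y -> leb (`[x, y[%classic : set R) = (y - x)%:E.
  move=> xy; rewrite [leb _]lebesgue_measure_itv /= lte_fin.
  case: ltP => // yx; have -> : y = x by apply/eqP; rewrite eq_le xy yx.
  by rewrite subrr.
pose I1 := I `[s, 1[%classic.
have I0 (x y : R) : y <= 1 -> (0 <= I `[x, y[%classic)%E.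
  move=> y1; apply: integral_ge0 => t; rewrite /= in_itv /= => /andP[_ ty].
  by rewrite lee_fin ltW // V0 // (lt_le_trans ty).
have Ifin : I1 \is a fin_num.
  rewrite /I1 ge0_fin_numE ?I0 //.
  apply: (@le_lt_trans _ _ (\int[leb]_(t in `[s, 1%R[) (V s)%:E)%E).
    apply: ge0_le_integral => //.
    - by move=> t; rewrite /= in_itv /= => /andP[_ t1]; rewrite lee_fin ltW // V0.
    - by apply: measurable_funTS; exact/measurable_EFinP.
    - by move=> t; rewrite /= in_itv /= => /andP[st _]; rewrite lee_fin Vle.
  by rewrite integral_cst // len ?ltW // -EFinM ltry.
have shift : (\int[leb]_(t in `[s, 1%R[) (V (t - de))%:E <=
    (de * V (s - de))%:E + I1)%E.
  pose H := (EFin \o V) \_ (`[s - de, 1 - de[%classic : set R).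
  have mH : measurable_fun [set: R] H.
    by apply/(measurable_restrictT _ _).1 => //; apply: measurable_funTS; exact/measurable_EFinP.
  have H0 t : (0 <= H t)%E.
    apply: erestrict_ge0 => {}t; rewrite /= in_itv /= => /andP[_ h].
    by rewrite lee_fin ltW // V0 //; lra.
  have -> : (\int[leb]_(t in `[s, 1%R[) (V (t - de))%:E =
      \int[leb]_(t in [set: R]) H (1 * t + - de)%R)%E.
    rewrite integral_mkcond; apply: eq_integral => t _.
    rewrite mul1r /H !patchE.
    have -> : (t - de \in `[s - de, 1 - de[%classic) = (t \in `[s, 1[%classic).
      by apply/idP/idP; rewrite !inE /= !in_itv /= lerD2r ltrD2r.
    by [].
  rewrite ge0_integral_affine // invr1 mul1e /H -integral_mkcond.
  apply: (@le_trans _ _ (I `[s - de, 1[%classic)).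
    apply: ge0_subset_integral => //.
    - by apply: measurable_funTS; exact/measurable_EFinP.
    - by move=> t; rewrite /= in_itv /= => /andP[_ h]; rewrite lee_fin ltW // V0.
    - by move=> t; rewrite /= !in_itv /= => /andP[-> h]; lra.
  have -> : `[s - de, 1[%classic = `[s - de, s[ `|` `[s, 1[ :> set R.
    apply/seteqP; split => t /=; rewrite !in_itv /=.
      by move=> /andP[h1 h2]; case: (ltP t s) => h; [left|right]; rewrite ?h1 ?h2.
    by case=> /andP[h1 h2]; lra.
  rewrite /I1 /I ge0_integral_setU //=; last 3 first.
  - by apply: measurable_funTS; exact/measurable_EFinP.
  - move=> t [] /=; rewrite in_itv /= => /andP[_ h]; rewrite lee_fin ltW // V0 //; lra.
  - by apply/disj_setPS => t [] /=; rewrite !in_itv /= => /andP[_ h] /andP[h' _]; lra.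
  apply: leeD2r.
  apply: (@le_trans _ _ (\int[leb]_(t in `[(s - de)%R, s[) (V (s - de))%:E)%E).
    apply: ge0_le_integral => //.
    - by move=> t; rewrite /= in_itv /= => /andP[_ h]; rewrite lee_fin ltW // V0 //; lra.
    - by apply: measurable_funTS; exact/measurable_EFinP.
    - by move=> t; rewrite /= in_itv /= => /andP[h _]; rewrite lee_fin Vle.
  rewrite integral_cst // len; last by lra.
  by rewrite -EFinM lee_fin mulrC opprB addrCA subrr addr0.
have Jge : ((1 - s)%:E + a^-1%:E * I1 <=
    J + a^-1%:E * \int[leb]_(t in `[s, 1%R[) (V (t - de))%:E)%E.
  have -> : (1 - s)%:E = (\int[leb]_(t in `[s, 1%R[) 1%:E)%E.
    by rewrite integral_cst // mul1e len // ltW.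
  rewrite /I1 /I -!ge0_integralZl //; last 6 first.
  all: try by rewrite lee_fin invr_ge0 ltW.
  all: try by apply: measurable_funTS; exact/measurable_EFinP.
  all: try by move=> t; rewrite /= in_itv /= => /andP[_ h]; rewrite lee_fin ltW // V0 //; lra.
  have ai : 0 <= a^-1 by rewrite invr_ge0 ltW.
  rewrite -!ge0_integralD //; last 6 first.
  all: try by move=> t; rewrite /= in_itv /= => /andP[_ h]; rewrite -?EFinM lee_fin
    ?mulr_ge0 ?powR_ge0 // ltW // V0 //; lra.
  all: try by apply: measurable_funTS; apply/measurable_EFinP; apply: measurable_funM => //; exact: mP.
  apply: ge0_le_integral => //.
  - move=> t; rewrite /= in_itv /= => /andP[_ h]; rewrite -EFinM -EFinD lee_fin.
    by rewrite addr_ge0 // mulr_ge0 // ltW // V0.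
  - apply: measurable_funTS; under eq_fun do rewrite -EFinM -EFinD.
    by apply/measurable_EFinP; apply: measurable_funD => //; exact: measurable_funM.
  - apply: measurable_funTS; under eq_fun do rewrite -EFinM -EFinD.
    apply/measurable_EFinP; apply: measurable_funD; last exact: measurable_funM.
    by apply: measurable_funM; exact: mP.
  move=> t; rewrite /= in_itv /= => /andP[_ t1]; rewrite -!EFinM -!EFinD lee_fin.
  have t2 : t - de < 1 by lra.
  have v1 := V0 _ t1; have v2 := V0 _ t2; have a2 := aV _ t2.
  have v12 : V t <= V (t - de) by apply: Vle; lra.
  have -> : V (t - de) `^ (- p) * V t `^ p = (V t / V (t - de)) `^ p.
    rewrite powRM ?invr_ge0 ?ltW // mulrC; congr (_ * _).
    by rewrite -powR_inv1 ?ltW // -powRrM mulN1r.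
  have q0 : 0 < V t / V (t - de) by rewrite divr_gt0.
  have q1 : V t / V (t - de) <= 1 by rewrite ler_pdivrMr // mul1r.
  have hq : V t / V (t - de) <= (V t / V (t - de)) `^ p.
    by apply: ger1_powR => //; rewrite q0.
  have h1 : 1 - V t / V (t - de) <= (V (t - de) - V t) / a.
    have -> : 1 - V t / V (t - de) = (V (t - de) - V t) / V (t - de).
      by field; rewrite gt_eqF.
    by rewrite ler_wpM2l ?subr_ge0 // lef_pV2 // posrE.
  have -> : a^-1 * V t = V t / a by rewrite mulrC.
  have -> : a^-1 * V (t - de) = V (t - de) / a by rewrite mulrC.
  by move: h1; rewrite mulrBl; lra.
have aIfin : (a^-1%:E * I1)%E \is a fin_num by rewrite fin_numM.
rewrite -/J EFinB leeBlDr //.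
rewrite -(@leeD2rE _ (a^-1%:E * I1)%E) //.
apply: (le_trans Jge); rewrite -[leRHS]addeA.
apply: (@leeD2l R J).
apply: (le_trans (lee_wpmul2l _ shift)); first by rewrite lee_fin invr_ge0 ltW.
rewrite ge0_muleDr ?I0 //;  last by rewrite lee_fin mulr_ge0 ?ltW // V0 //; lra.
by rewrite -EFinM mulrC.
Qed.

Lemma le_of_perturbed (x y c A B : R) : 0 < c -> 0 <= A -> 0 <= B ->
  (forall de et, 0 < de <= c -> 0 < et -> x - de * A <= y + et * B) -> x <= y.
Proof.
move=> c0 A0 B0 h; apply/ler_addgt0Pr => e e0.
have A1 : 0 < A + 1 by lra.
have B1 : 0 < B + 1 by lra.
pose de := Num.min c (e / 2 / (A + 1)); pose et := e / 2 / (B + 1).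
have et0 : 0 < et by rewrite !divr_gt0.
have de0 : 0 < de <= c by rewrite lt_min c0 !divr_gt0 //= ge_min lexx.
have := h _ _ de0 et0.
have hA : de * A <= e / 2.
  apply: (@le_trans _ _ (e / 2 / (A + 1) * A)).
    by rewrite ler_wpM2r // ge_min lexx orbT.
  by rewrite mulrAC ler_pdivrMr // ler_wpM2l; lra.
have hB : et * B <= e / 2.
  by rewrite /et mulrAC ler_pdivrMr // ler_wpM2l; lra.
lra.
Qed.

(** The composition of the volume function with [u] itself has a distribution dominated by Lebesgue
    measure, jumps of the volume only helping. Joined with {u >= 1}, the set in question is
    exhausted by superlevel sets of [u] of volume at most [t]. *)
Lemma vol_ge_distribution {d : nat} (u : 'rV[R]_d -> R) (s k t : R) :
  continuous u -> [set x | s / 2 <= u x] `<=` obox (const_mx (- k)) (const_mx k) ->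
  s / 2 < 1 -> vol_ge u s 1 <= t ->
  (lebesgue_rV d ([set x | s / 2 <= u x < 1]%R `&` [set x | vol_ge u s (u x) <= t]%R) <=
   (t - vol_ge u s 1)%:E)%E.
Proof.
move=> cu ub s1 vt.
have mge := measurable_ge_set cu.
have mS : measurable ([set x | s / 2 <= u x < 1] `&` [set x | vol_ge u s (u x) <= t]).
  apply: measurableI.
    rewrite (_ : mkset _ = [set x | s / 2 <= u x] `&` ~` [set x | 1 <= u x]).
      by apply: measurableI; [exact: mge|apply: measurableC; exact: mge].
    apply/seteqP; split => x /=; first by case/andP => -> ?; split => //; apply/negP; rewrite -ltNge.
    by case=> -> /negP; rewrite -ltNge => ->.
  apply: (@measurable_ler_set _ _ _ (fun x => vol_ge u s (u x)) (fun=> t)) => //.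
  by apply: (measurableT_comp (measurable_vol_ge cu ub)); exact: continuous_measurable_fun_rV.
set T := _ `&` _ in mS *.
have [->|/set0P[x0 [/andP[sx0 x01] x0t]]] := eqVneq T set0.
  by rewrite measure0 lee_fin subr_ge0.
have E1 : lebesgue_rV d [set x | 1 <= u x] = (vol_ge u s 1)%:E.
  have := vol_geE cu ub 1.
  by rewrite (_ : Num.max 1 (s / 2) = 1) //; apply/max_idPl/ltW.
have EU v : s / 2 <= v -> lebesgue_rV d [set x | v <= u x] = (vol_ge u s v)%:E.
  by move=> sv; have := vol_geE cu ub v; rewrite (_ : Num.max v (s / 2) = v) //; apply/max_idPl.
suff H : (lebesgue_rV d (T `|` [set x | (1 <= u x)%R]) <= t%:E)%E.
  rewrite EFinB leeBrDr // -E1.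
  have m1 : measurable [set x | 1 <= u x] by exact: mge.
  rewrite -(@measureU _ _ _ (lebesgue_rV d) T) //.
  by apply/seteqP; split => // x [[/andP[_ h] _] /= h']; move: h; rewrite ltNge h'.
have Tx0 : T x0 by split => //; apply/andP.
pose J := [set u x | x in T].
have hJ : has_inf J.
  split; first by exists (u x0); exists x0.
  by exists (s / 2) => _ [x [/andP[h _] _] <-].
have Tinf x : T x -> inf J <= u x.
  by move=> Tx; apply: ge_inf; [case: hJ|exists x].
(* If the lowest value of [u] on [T] is attained, one superlevel set covers everything. Otherwise
   the sets [F n] increase to a cover, and each lies in {u >= u(x)} for some x in [T]. *)
have [[x1 [[/andP[sx1 _] x1t]] x1E]|NJ] := pselect (J (inf J)).
  apply: (@le_trans _ _ (lebesgue_rV d [set x | u x1 <= u x])).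
    apply: le_measure; rewrite ?inE; [by apply: measurableU => //; exact: mge|exact: mge|].
    move=> x [/Tinf|] /=; first by rewrite x1E.
    apply: le_trans; rewrite x1E.
    by apply: (le_trans (Tinf x0 Tx0)); exact: ltW.
  by rewrite EU.
pose F (n : nat) := [set x | inf J + n.+1%:R^-1 <= u x].
have mF n : measurable (F n) by exact: mge.
have TF : T `|` [set x | 1 <= u x] `<=` \bigcup_n F n.
  move=> x Hx; have ix : inf J < u x.
    have : inf J <= u x.
      case: Hx => [/Tinf //|/=]; apply: le_trans.
      by apply: (le_trans (Tinf x0 Tx0)); exact: ltW.
    rewrite le_eqVlt => /orP[/eqP E|//]; case: Hx => [Tx|/= u1].
      by case: NJ; exists x.
    have : inf J < 1.
      by apply: le_lt_trans x01; exact: Tinf.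
    by rewrite E ltNge u1.
  have p0 : 0 < u x - inf J by rewrite subr_gt0.
  exists (Num.truncn (u x - inf J)^-1) => //=; rewrite /F /= -lerBrDl.
  by rewrite -[leRHS]invrK lef_pV2 ?posrE ?invr_gt0 // ltW // truncnS_gt.
have Ft n : (lebesgue_rV d (F n) <= t%:E)%E.
  have n0 : 0 < n.+1%:R^-1 :> R by rewrite invr_gt0.
  have [_ [x [/andP[sx _] xt] <-] xn] := inf_adherent n0 hJ.
  apply: (@le_trans _ _ (lebesgue_rV d [set z | u x <= u z])).
    apply: le_measure; rewrite ?inE; [exact: mF|exact: mge|].
    by move=> z /=; apply: le_trans; exact: ltW.
  by rewrite EU.
have ndF : nondecreasing_seq F.
  move=> m n mn; apply/subsetPset => x; rewrite /F /=; apply: le_trans.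
  by rewrite lerD2l lef_pV2 ?posrE // ler_nat.
have cF := @nondecreasing_cvg_mu _ _ _ (lebesgue_rV d) F mF (bigcupT_measurable _ mF) ndF.
apply: (@le_trans _ _ (lebesgue_rV d (\bigcup_n F n))).
  apply: le_measure; rewrite ?inE //; first by apply: measurableU => //; exact: mge.
  exact: bigcupT_measurable.
rewrite -(cvg_lim _ cF) //; apply: lime_le; first by apply/cvg_ex; exists (lebesgue_rV d (\bigcup_n F n)).
by apply: nearW => n; exact: Ft.
Qed.

(** Young's inequality with a free parameter [lam], to be optimized once s tends to 0. The errors in
    [de] and [et] are linear because the weight is at most a^(-p) and the set of levels between s/2
    and 1 has finite volume. *)
Lemma dirichlet_ge_level {d : nat} (u : 'rV[R]_d -> R) (s a k lam : R) :
  (3 <= d)%N -> continuous u ->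
  (forall i x, derivable u x (delta_mx 0 i)) ->
  (forall i, continuous (partial_derivative i u)) ->
  0 < s -> s < 1 -> 0 < a -> 1 <= k -> 0 <= lam ->
  [set x | s / 2 <= u x] `<=` obox (const_mx (- k)) (const_mx k) ->
  (a%:E <= lebesgue_rV d [set x | 1 <= u x]%R)%E ->
  ((lam * (d%:R * @unit_ball_volume R d `^ d%:R^-1) * (1 - s) -
    lam ^+ 2 / 2 * (a `^ (- ((d%:R - 2) / d%:R)) / ((d%:R - 2) / d%:R)))%:E <=
   2^-1%:E * dirichlet u)%E.
Proof.
move=> d3 cu du cp s0 s1 a0 k1 lam0 ub ale.
have d0 : (0 < d)%N by exact: leq_trans d3.
have dR : 3 <= d%:R :> R by rewrite ler_nat.
set kap := unit_ball_volume `^ _; pose p : R := (d%:R - 1) / d%:R.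
set q := (d%:R - 2) / d%:R.
have q0 : 0 < q by rewrite divr_gt0; lra.
have pq : - p + - p = - (1 + q) by rewrite /p /q; field; rewrite gt_eqF //; lra.
have p0 : 0 <= p by exact: p_ge0.
have p1 : p <= 1 by exact: p_le1.
have s21 : s / 2 < 1 by exact: half_lt1.
have D0 : (0 <= dirichlet u)%E.
  by apply: integral_ge0 => x _; rewrite lee_fin sumr_ge0 // => i _; exact: sqr_ge0.
have [Doo|Dfin] := eqVneq (dirichlet u) +oo%E.
  by rewrite Doo gt0_muley ?leey // lte_fin invr_gt0.
have {}Dfin : dirichlet u \is a fin_num by rewrite ge0_fin_numE // ltey.
pose G := grad_norm u; pose W x := vol_ge u s (u x).
pose S := [set x | s / 2 <= u x < 1].
have cG : continuous G by exact: continuous_grad_norm.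
have mG : measurable_fun setT G by exact: continuous_measurable_fun_rV.
have mW : measurable_fun setT W.
  by apply: (measurableT_comp (measurable_vol_ge cu ub)); exact: continuous_measurable_fun_rV.
have mWp (b : R) : measurable_fun setT (fun x => W x `^ b).
  exact: (measurableT_comp (measurable_powR b)).
have mge := measurable_ge_set cu.
have mS : measurable S.
  rewrite (_ : S = [set x | s / 2 <= u x] `&` ~` [set x | 1 <= u x]).
    by apply: measurableI; [exact: mge|apply: measurableC; exact: mge].
  apply/seteqP; split => x; rewrite /S /=; first by case/andP => -> ?; split => //; apply/negP; rewrite -ltNge.
  by case=> -> /negP; rewrite -ltNge => ->.
have Wa x : S x -> a <= W x.
  by move=> /andP[_ /ltW]; exact: (le_vol_ge cu s0 s1 ub ale).
pose MS := fine (lebesgue_rV d S).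
have MSE : lebesgue_rV d S = MS%:E.
  rewrite /MS fineK // ge0_fin_numE //; apply: (lebesgue_rV_bounded (k := k)) => //.
  by move=> x /andP[/ub].
have MS0 : 0 <= MS by exact: fine_ge0.
have v1a : a <= vol_ge u s 1 by exact: (le_vol_ge cu s0 s1 ub ale (lexx 1)).
have v10 : 0 < vol_ge u s 1 by exact: lt_le_trans v1a.
pose B := a `^ (- q) / q.
have intW : (\int[lebesgue_rV d]_(x in S) (W x `^ (- (1 + q)))%:E <= B%:E)%E.
  have q1 : 1 < 1 + q by rewrite ltrDl.
  have H := @integral_powRN_le R _ _ (@lebesgue_rV_sf R d) S W (vol_ge u s 1) (1 + q) mS mW v10 q1.
  apply: (le_trans (H _ _)).
  - by move=> x /andP[_ /ltW h]; exact: (vol_ge_le cu ub h).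
  - by move=> t vt; exact: (vol_ge_distribution cu ub).
  rewrite lee_fin /B (_ : 1 - (1 + q) = - q); last by ring.
  rewrite (_ : 1 + q - 1 = q); last by ring.
  by rewrite ler_wpM2r ?invr_ge0 ?(ltW q0) // powRN_le // ltW.
rewrite -(fineK Dfin) -EFinM lee_fin lerBlDr.
apply: (@le_of_perturbed _ _ (s / 2)
  (lam * (d%:R * kap) * (vol_gt u s 0 / a)) (lam * a `^ (- p) * MS)).
- by rewrite divr_gt0.
- by rewrite !mulr_ge0 ?powR_ge0 ?vol_gt_ge0 // invr_ge0 ltW.
- by rewrite !mulr_ge0 // powR_ge0.
move=> de et dedes et0; have /andP[de0 des] := dedes.
have Vle t t' (tt' : t <= t') := vol_gt_le cu ub tt'.
have Va t (t1 : t < 1) := le_vol_gt cu s0 s1 ub ale t1.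
have ratio := integral_shift_ratio Vle Va a0 p0 p1 s1 de0.
have iso := weighted_isoperimetric d0 cu s0 s1 a0 k1 ub ale du cp dedes et0.
have dk0 : 0 <= d%:R * kap by rewrite mulr_ge0 // powR_ge0.
have H1 : ((lam * (d%:R * kap) * (1 - s - de * vol_gt u s (s - de) / a))%:E <=
    lam%:E * \int[lebesgue_rV d]_(x in S) (W x `^ (- p) * (G x + et))%:E)%E.
  rewrite -mulrA EFinM; apply: lee_wpmul2l => //; apply: le_trans iso.
  by rewrite EFinM; apply: lee_wpmul2l.
have G0 x : 0 <= G x by exact: enorm_ge0.
have mGS : measurable_fun S (fun x => (G x ^+ 2)%:E).
  by apply: measurable_funTS; apply/measurable_EFinP; exact: measurable_funX.
have H2 : (lam%:E * \int[lebesgue_rV d]_(x in S) (W x `^ (- p) * (G x + et))%:E <=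
    2^-1%:E * dirichlet u + (lam ^+ 2 / 2)%:E * B%:E + (lam * a `^ (- p) * et * MS)%:E)%E.
  rewrite -ge0_integralZl //; last 2 first.
  - by apply: measurable_funTS; apply/measurable_EFinP; apply: measurable_funM => //;
      exact: measurable_funD.
  - by move=> x _; rewrite lee_fin mulr_ge0 ?powR_ge0 // addr_ge0 // ltW.
  apply: (@le_trans _ _ (\int[lebesgue_rV d]_(x in S)
     (2^-1%:E * (G x ^+ 2)%:E + (lam ^+ 2 / 2)%:E * (W x `^ (- (1 + q)))%:E +
      (lam * a `^ (- p) * et)%:E))%E).
    apply: ge0_le_integral => //.
    - by move=> x _; rewrite -EFinM lee_fin !mulr_ge0 ?powR_ge0 ?addr_ge0 // ltW.
    - by under eq_fun do rewrite -EFinM; apply: measurable_funTS; apply/measurable_EFinP;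
      apply: measurable_funM => //; apply: measurable_funM => //; exact: measurable_funD.
    - under eq_fun do rewrite -!EFinM -!EFinD.
      apply: measurable_funTS; apply/measurable_EFinP; apply: measurable_funD => //.
      by apply: measurable_funD; apply: measurable_funM => //; exact: measurable_funX.
    move=> x Sx; rewrite -!EFinM -!EFinD lee_fin.
    have w0 : 0 < W x by exact: lt_le_trans (Wa _ Sx).
    rewrite -pq powRD_gt0 //.
    have : W x `^ (- p) <= a `^ (- p) by apply: powRN_le => //; exact: Wa.
    set v := W x `^ (- p); set b := a `^ (- p) => vb.
    have : lam * et * v <= lam * et * b by rewrite ler_wpM2l // mulr_ge0 // ltW.
    (* Young's inequality for G and lam v is this square. *)
    have := sqr_ge0 (G x - lam * v); nra.
  rewrite ge0_integralD //; last 3 first.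
  - by move=> x _; rewrite -!EFinM -EFinD lee_fin addr_ge0 // !mulr_ge0 ?sqr_ge0 ?powR_ge0.
  - under eq_fun do rewrite -!EFinM -!EFinD.
    apply: measurable_funTS; apply/measurable_EFinP.
    by apply: measurable_funD; apply: measurable_funM => //; exact: measurable_funX.
  - by move=> x _; rewrite lee_fin !mulr_ge0 ?powR_ge0 // ltW.
  rewrite ge0_integralD //; last 4 first.
  - by move=> x _; rewrite -!EFinM lee_fin !mulr_ge0 ?sqr_ge0.
  - by under eq_fun do rewrite -!EFinM; apply: measurable_funTS; apply/measurable_EFinP;
      apply: measurable_funM => //; exact: measurable_funX.
  - by move=> x _; rewrite -!EFinM lee_fin !mulr_ge0 ?sqr_ge0 ?powR_ge0.
  - by under eq_fun do rewrite -!EFinM; apply: measurable_funTS; apply/measurable_EFinP;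
      apply: measurable_funM.
  have mWS : measurable_fun S (fun x => (W x `^ (- (1 + q)))%:E).
    by apply: measurable_funTS; exact/measurable_EFinP.
  have l20 : (0 <= (lam ^+ 2 / 2)%:E)%E by rewrite lee_fin mulr_ge0 ?sqr_ge0.
  have h20 : (0 <= 2^-1%:E :> \bar R)%E by rewrite lee_fin.
  rewrite (ge0_integralZl _ mS mGS _ h20); last by move=> x _; rewrite lee_fin sqr_ge0.
  rewrite (ge0_integralZl _ mS mWS _ l20); last by move=> x _; rewrite lee_fin powR_ge0.
  rewrite integral_cst // MSE -(EFinM (lam * a `^ (- p) * et) MS).
  apply: leeD => //; apply: leeD.
    apply: lee_wpmul2l => //.
    have -> : dirichlet u = (\int[lebesgue_rV d]_x (G x ^+ 2)%:E)%E.
      by apply: eq_integral => x _; rewrite sqr_grad_norm.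
    apply: ge0_subset_integral => //.
    by apply/measurable_EFinP; exact: measurable_funX.
    by move=> x _; rewrite lee_fin sqr_ge0.
  exact: lee_wpmul2l l20 _ _ intW.
have := le_trans H1 H2; rewrite -{1}(fineK Dfin) -!EFinM -!EFinD lee_fin => H3.
(* The coefficient of the error must not depend on [de]. *)
have Vs : vol_gt u s (s - de) <= vol_gt u s 0 by apply: Vle; lra.
have H4 : lam * (d%:R * kap) * (de * vol_gt u s (s - de) / a) <=
    lam * (d%:R * kap) * (de * vol_gt u s 0 / a).
  have X0 : 0 <= lam * (d%:R * kap) by rewrite mulr_ge0.
  apply: ler_wpM2l X0 _ _ _; apply: ler_wpM2r; first by rewrite invr_ge0 ltW.
  by apply: ler_wpM2l => //; exact: ltW.
move: H3 H4; rewrite /B; set X := lam * (d%:R * kap).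
rewrite mulrBr => H3 H4.
have -> : de * (X * (vol_gt u s 0 / a)) = X * (de * vol_gt u s 0 / a) by ring.
have -> : et * (lam * a `^ (- p) * MS) = lam * a `^ (- p) * et * MS by ring.
lra.
Qed.

Lemma dirichlet_ge {d : nat} (u : 'rV[R]_d -> R) (E : set 'rV[R]_d) (a : R) :
  (3 <= d)%N -> cap_admissible E u -> measurable E -> 0 < a ->
  (a%:E <= lebesgue_rV d E)%E ->
  ((d%:R * (d%:R - 2) * (@unit_ball_volume R d `^ d%:R^-1) ^+ 2 *
    a `^ ((d%:R - 2) / d%:R))%:E <= dirichlet u)%E.
Proof.
move=> d3 [su Eu udecay] mE a0 aE.
have dR : 3 <= d%:R :> R by rewrite ler_nat.
have cu : continuous u by have [] := su [::].
have du i x : derivable u x (delta_mx 0 i) by have [_] := su [::]; exact.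
have cp i : continuous (partial_derivative i u) by have [] := su [:: i].
have ale : (a%:E <= lebesgue_rV d [set x | 1 <= u x]%R)%E.
  apply: (le_trans aE); apply: le_measure; rewrite ?inE //.
  exact: measurable_ge_set.
set kap := unit_ball_volume `^ _; set q := (d%:R - 2) / d%:R.
have q0 : 0 < q by rewrite divr_gt0; lra.
(* The maximizer of lam d kap - lam^2 a^(-q) / (2 q), since d q = d - 2. *)
pose lam := kap * (d%:R - 2) * a `^ q.
have kap0 : 0 <= kap by exact: powR_ge0.
have lam0 : 0 <= lam by rewrite !mulr_ge0 ?powR_ge0 //; lra.
have [Doo|Dfin] := eqVneq (dirichlet u) +oo%E; first by rewrite Doo leey.
have {}Dfin : dirichlet u \is a fin_num.
  rewrite ge0_fin_numE ?ltey //.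
  by apply: integral_ge0 => x _; rewrite lee_fin sumr_ge0 // => i _; exact: sqr_ge0.
have H : lam * (d%:R * kap) <=
    2^-1 * fine (dirichlet u) + lam ^+ 2 / 2 * (a `^ (- q) / q).
  apply: (@le_of_perturbed _ _ (2^-1) (lam * (d%:R * kap)) 0) => //.
    by apply: mulr_ge0 => //; apply: mulr_ge0.
  move=> s et /andP[s0 s12] et0; rewrite mulr0 addr0.
  have s1 : s < 1 by lra.
  have s20 : 0 < s / 2 by rewrite divr_gt0.
  have [M Mu] := udecay _ s20.
  have [k [k0 kM]] := @enorm_ball_bounded R d 0 M.
  have ub : [set x | s / 2 <= u x] `<=` obox (const_mx (- (k + 1))) (const_mx (k + 1)).
    move=> x /= sx; have xM : [set x | enorm (x - 0) <= M] x.
      rewrite /= subr0 leNgt; apply/negP => /Mu; rewrite ltNge.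
      by rewrite (le_trans sx) // ler_norm.
    by move=> i; have := kM x xM i; rewrite !mxE => /andP[h1 h2]; apply/andP; split; lra.
  have k1 : 1 <= k + 1 by lra.
  have := dirichlet_ge_level d3 cu du cp s0 s1 a0 k1 lam0 ub ale.
  rewrite -/kap -/q -(fineK Dfin) -EFinM lee_fin; lra.
rewrite -(fineK Dfin) lee_fin.
have aa : a `^ q * a `^ (- q) = 1 by rewrite -powRD_gt0 // subrr powRr0.
have e1 : lam ^+ 2 / 2 * (a `^ (- q) / q) = d%:R / 2 * (d%:R - 2) * kap ^+ 2 * a `^ q.
  transitivity (kap ^+ 2 * (d%:R - 2) ^+ 2 / 2 * a `^ q * (a `^ q * a `^ (- q)) / q).
    by rewrite /lam; field; rewrite gt_eqF.
  rewrite aa /q; field; apply/andP; split; rewrite gt_eqF //; lra.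
move: H; rewrite e1 /lam; set c := a `^ q; lra.
Qed.

End isocapacitary.

(** * Capacity of balls *)

Section elementary_functions.
Context {R : realType} {d : nat}.
Implicit Types (f g : 'rV[R]_d -> R) (x v : 'rV[R]_d).

Lemma is_derive_of_line f x v (l : R) :
  is_derive (0 : R) (1 : R) (fun t : R => f (x + t *: v)) l -> is_derive x v f l.
Proof.
have E : (fun h : R => h^-1 *: (((fun t : R => f (x + t *: v)) \o shift 0) (h *: (1 : R)) -
      f (x + 0 *: v))) =
    (fun h : R => h^-1 *: ((f \o shift x) (h *: v) - f x)).
  apply/funext => h; rewrite /= [h *: 1]mulr1 addr0 scale0r addr0.
  by rewrite [x + _]addrC.
by move=> [dg gE]; apply: DeriveDef; [move: dg|move: gE]; rewrite /derivable /derive E.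
Qed.

(** Restricting to a line gives the chain rule from a directional derivative of [f] alone, without
    its differentiability in several variables. *)
Lemma is_derive_comp1 (phi : R -> R) f x v (df dphi : R) :
  is_derive x v f df -> is_derive (f x) (1 : R) phi dphi ->
  is_derive x v (fun z => phi (f z)) (dphi * df).
Proof.
move=> [ff fE] dp; apply: is_derive_of_line.
have dl := @is_derive_line R d f x v 0.
rewrite scale0r addr0 in dl; have {}dl := dl ff; rewrite fE in dl.
apply: (@is_derive1_comp R phi (fun t : R => f (x + t *: v)) 0 _ _ _ dl).
by rewrite scale0r addr0.
Qed.

Lemma is_derive_coord (i : 'I_d) x v : is_derive x v (fun z => z 0 i) (v 0 i).
Proof.
apply: is_derive_of_line.
have -> : (fun t : R => (x + t *: v) 0 i) = (fun t : R => v 0 i *: t + x 0 i).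
  by apply/funext => t; rewrite !mxE addrC [t * _]mulrC.
have := is_deriveD (is_deriveZ (v 0 i) (is_derive_id (0 : R) (1 : R)))
  (is_derive_cst (x 0 i) (0 : R) (1 : R)).
by rewrite addr0 [v 0 i *: 1]mulr1.
Qed.

Lemma is_derive_expn f x v (n : nat) (df : R) : is_derive x v f df ->
  is_derive x v (fun z => f z ^+ n.+1) (n.+1%:R * f x ^+ n * df).
Proof.
move=> dff; elim: n => [|n IH].
  by rewrite mulr1 mul1r; under eq_fun do rewrite expr1.
have -> : (fun z => f z ^+ n.+2) = (f * (fun z => f z ^+ n.+1)) :> ('rV[R]_d -> R).
  by apply/funext => z; rewrite exprS.
apply: (is_derive_eq (is_deriveM dff IH)); rewrite /GRing.scale /=.
by rewrite -(natr1 n.+1) !exprS; ring.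
Qed.

Lemma is_derive_bigsum (I : Type) (s : seq I) (F : I -> 'rV[R]_d -> R) (dF : I -> R) x v :
  (forall i, is_derive x v (F i) (dF i)) ->
  is_derive x v (fun z => \sum_(i <- s) F i z) (\sum_(i <- s) dF i).
Proof.
move=> h; elim: s => [|i s IH].
  rewrite big_nil; under eq_fun do rewrite big_nil; exact: is_derive_cst.
rewrite big_cons; under eq_fun do rewrite big_cons.
exact: is_deriveD.
Qed.

(* A class of smooth functions closed under partial derivatives that contains
   the test functions used for balls. *)
Inductive elementary : ('rV[R]_d -> R) -> Prop :=
| elementary_cst (c : R) : elementary (fun=> c)
| elementary_coord (i : 'I_d) : elementary (fun x => x 0 i)
| elementary_add f g : elementary f -> elementary g -> elementary (fun x => f x + g x)
| elementary_mul f g : elementary f -> elementary g -> elementary (fun x => f x * g x)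
| elementary_pow f (a : R) : elementary f -> (forall x, 0 < f x) ->
    elementary (fun x => f x `^ a).

Lemma elementary_continuous f : elementary f -> continuous f.
Proof.
elim=> {f} [c|i|f g _ cf _ cg|f g _ cf _ cg|f a _ cf f0] x.
- exact: cst_continuous.
- exact: coord_continuous.
- exact: continuousD (cf x) (cg x).
- exact: continuousM (cf x) (cg x).
apply: (@continuous_comp _ _ _ f (fun t : R => t `^ a)); first exact: cf.
exact: continuous_powRl.
Qed.

Lemma elementary_partial f (i : 'I_d) : elementary f -> exists2 g, elementary g &
  forall x, is_derive x (delta_mx 0 i) f (g x).
Proof.
elim=> {f} [c|j|f g ef [f' ef' df] eg [g' eg' dg]|f g ef [f' ef' df] eg [g' eg' dg]|
  f a ef [f' ef' df] f0].
- by exists (fun=> 0); [exact: elementary_cst|move=> x; exact: is_derive_cst].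
- exists (fun=> (delta_mx 0 i : 'rV[R]_d) 0 j); first exact: elementary_cst.
  by move=> x; exact: is_derive_coord.
- exists (fun x => f' x + g' x); first exact: elementary_add.
  by move=> x; exact: is_deriveD.
- exists (fun x => f x * g' x + g x * f' x).
    by apply: elementary_add; exact: elementary_mul.
  by move=> x; exact: is_deriveM.
exists (fun x => (a * f x `^ (a - 1)) * f' x).
  apply: elementary_mul => //; apply: elementary_mul; first exact: elementary_cst.
  exact: elementary_pow.
by move=> x; exact: (is_derive_comp1 (df x) (is_derive1_powR a (f0 x))).
Qed.

Lemma elementary_smooth f : elementary f -> smooth f.
Proof.
move=> ef s; have es : elementary (iter_partial s f).
  elim: s => [//|i s IH] /=.
  have [g eg dg] := elementary_partial i IH.
  rewrite (_ : partial_derivative i _ = g) //.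
  by apply/funext => x; have [_] := dg x.
split; first exact: elementary_continuous.
by move=> i x; have [g _ dg] := elementary_partial i es; have [] := dg x.
Qed.

Lemma elementary_expn f (n : nat) : elementary f -> elementary (fun x => f x ^+ n).
Proof.
move=> ef; elim: n => [|n IH]; first by under eq_fun do rewrite expr0; exact: elementary_cst.
by under eq_fun do rewrite exprS; exact: elementary_mul.
Qed.

Lemma elementary_bigsum (I : Type) (s : seq I) (F : I -> 'rV[R]_d -> R) :
  (forall i, elementary (F i)) -> elementary (fun x => \sum_(i <- s) F i x).
Proof.
move=> h; elim: s => [|i s IH].
  by under eq_fun do rewrite big_nil; exact: elementary_cst.
by under eq_fun do rewrite big_cons; exact: elementary_add.
Qed.

End elementary_functions.

Section ball_test_function.
Context {R : realType} {d : nat}.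
Variables (y : 'rV[R]_d) (r : R) (k : nat).
Hypotheses (d3 : (3 <= d)%N) (r0 : 0 < r).

Let b : R := (d%:R - 2) / (2 * k.+1%:R).
Let rho (x : 'rV[R]_d) : R := enorm (x - y) / r.
Let q (x : 'rV[R]_d) : R := \sum_i ((x 0 i - y 0 i) / r) ^+ 2.

(* A smooth version of min(1, (|x - y| / r)^(2 - d)), obtained by replacing
   max(1, t) by (1 + t^(2k+2))^(1/(2k+2)); the factor 2 `^ b makes it >= 1 on
   the ball. *)
Definition ball_test_function (x : 'rV[R]_d) : R :=
  2 `^ b * (1 + q x ^+ k.+1) `^ (- b).

Let dR : 3 <= d%:R :> R.
Proof. by rewrite ler_nat. Qed.

Let b0 : 0 < b.
Proof. by have h := dR; rewrite divr_gt0 ?mulr_gt0 //; lra. Qed.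

Let q_rho x : q x = rho x ^+ 2.
Proof.
rewrite /rho expr_div_n sqr_enorm mulr_suml; apply: eq_bigr => i _.
by rewrite !mxE expr_div_n.
Qed.

Let q_ge0 x : 0 <= q x.
Proof. by rewrite q_rho sqr_ge0. Qed.

Let rho_ge0 x : 0 <= rho x.
Proof. by rewrite divr_ge0 ?enorm_ge0 // ltW. Qed.

Let base_gt0 x : 0 < 1 + q x ^+ k.+1.
Proof. by rewrite ltr_pwDl // exprn_ge0. Qed.

Lemma smooth_ball_test_function : smooth ball_test_function.
Proof.
apply: elementary_smooth; apply: elementary_mul; first exact: elementary_cst.
apply: elementary_pow => //; apply: elementary_add; first exact: elementary_cst.
apply: elementary_expn; apply: elementary_bigsum => i; apply: elementary_expn.
apply: elementary_mul; last exact: elementary_cst.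
by apply: elementary_add; [exact: elementary_coord|exact: elementary_cst].
Qed.

Lemma partial_ball_test_function i x :
  partial_derivative i ball_test_function x =
  - (2 `^ b * (d%:R - 2) / r * (1 + q x ^+ k.+1) `^ (- b - 1) * q x ^+ k) *
    ((x 0 i - y 0 i) / r).
Proof.
have dq : is_derive x (delta_mx 0 i) q (2 * ((x 0 i - y 0 i) / r) / r).
  have H j : is_derive x (delta_mx 0 i)
      (fun z : 'rV[R]_d => ((z 0 j - y 0 j) / r) ^+ 2)
      ((j == i)%:R * (2 * ((x 0 j - y 0 j) / r) / r)).
    have Hj : is_derive x (delta_mx 0 i) (fun z : 'rV[R]_d => (z 0 j - y 0 j) / r)
        ((j == i)%:R / r).
      have -> : (fun z : 'rV[R]_d => (z 0 j - y 0 j) / r) =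
          (fun z : 'rV[R]_d => r^-1 *: (z 0 j - y 0 j)).
        by apply/funext => z; rewrite mulrC.
      have := is_deriveZ r^-1 (is_deriveB (is_derive_coord j x (delta_mx 0 i))
        (is_derive_cst (y 0 j) x (delta_mx 0 i))).
      by rewrite mxE eqxx /= subr0 [_ *: _]mulrC.
    apply: (is_derive_eq (is_derive_expn 1 Hj)); rewrite expr1.
    by case: (j == i); rewrite /= ?mul0r ?mulr0 ?mul1r //; ring.
  apply: (is_derive_eq (is_derive_bigsum (index_enum _) H)).
  rewrite (bigD1 i) //= eqxx mul1r big1 ?addr0 // => j ji.
  by rewrite (negbTE ji) mul0r.
have dbase : is_derive x (delta_mx 0 i) (fun z => 1 + q z ^+ k.+1)
    (k.+1%:R * q x ^+ k * (2 * ((x 0 i - y 0 i) / r) / r)).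
  have := is_deriveD (is_derive_cst (1 : R) x (delta_mx 0 i)) (is_derive_expn k dq).
  by rewrite add0r.
have dpow := is_derive_comp1 dbase (is_derive1_powR (- b) (base_gt0 x)).
have [_] := is_deriveZ (2 `^ b) dpow.
rewrite /partial_derivative => ->; rewrite /GRing.scale /=.
have -> : - b = - ((d%:R - 2) / (2 * k.+1%:R)) by [].
set c := (1 + q x ^+ k.+1) `^ (_ - 1).
by field; rewrite gt_eqF //= pnatr_eq0.
Qed.

Lemma sum_sqr_partial_ball_test_function x :
  \sum_i partial_derivative i ball_test_function x ^+ 2 =
  (2 `^ (2 * b) * (d%:R - 2) ^+ 2 / r ^+ 2) *
  ((1 + q x ^+ k.+1) `^ (- (2 * b) - 2) * q x ^+ (2 * k + 1)).
Proof.
under eq_bigr do rewrite partial_ball_test_function exprMn.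
rewrite -mulr_sumr -/(q x) sqrrN.
have e1 : 2 `^ (2 * b) = 2 `^ b * 2 `^ b :> R.
  by rewrite -powRD_gt0 // mulr2n mulrDl mul1r.
have e2 : (1 + q x ^+ k.+1) `^ (- (2 * b) - 2) =
    (1 + q x ^+ k.+1) `^ (- b - 1) * (1 + q x ^+ k.+1) `^ (- b - 1).
  by rewrite -powRD_gt0 //; congr (_ `^ _); ring.
rewrite e1 e2 exprD expr1 exprM.
set B := _ `^ (- b - 1); set p := 2 `^ b.
have -> : (q x ^+ 2) ^+ k = q x ^+ k * q x ^+ k by rewrite -exprM mulnC exprM expr2.
by field; rewrite gt_eqF.
Qed.

Lemma ball_test_function_ge1 x : enorm (x - y) <= r -> 1 <= ball_test_function x.
Proof.
move=> xr; have q1 : q x <= 1.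
  by rewrite q_rho expr_le1 ?rho_ge0 // ler_pdivrMr // mul1r.
rewrite /ball_test_function.
have h : 2 `^ (- b) <= (1 + q x ^+ k.+1) `^ (- b).
  apply: powRN_le => //; first exact: ltW b0.
  by have := exprn_ile1 k.+1 (q_ge0 x) q1; lra.
apply: le_trans (ler_wpM2l (powR_ge0 2 b) h).
by rewrite -powRD_gt0 // subrr powRr0.
Qed.

Lemma enorm_triangle (x z : 'rV[R]_d) : enorm (x + z) <= enorm x + enorm z.
Proof.
rewrite -(@ler_pXn2r _ 2) // ?nnegrE ?addr_ge0 ?enorm_ge0 //.
rewrite sqrrD !sqr_enorm.
have -> : \sum_i (x + z) 0 i ^+ 2 =
    \sum_i x 0 i ^+ 2 + (\sum_i x 0 i * z 0 i) *+ 2 + \sum_i z 0 i ^+ 2.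
  by rewrite -sumrMnl -!big_split /=; apply: eq_bigr => i _; rewrite mxE sqrrD.
by rewrite lerD2r lerD2l lerMn2r /= sum_mul_le_enorm.
Qed.

(** The true decay is rho^(2-d); as d >= 3, the weaker exponent -1 is available and gives an
    explicit threshold for the decay of the test function. *)
Let base_pow x : 1 <= rho x -> (1 + q x ^+ k.+1) `^ (- b) <= (rho x)^-1.
Proof.
move=> r1; have rp : 0 < rho x by exact: lt_le_trans r1.
apply: (@le_trans _ _ ((rho x ^+ (2 * k.+1)) `^ (- b))).
  apply: powRN_le; [exact: ltW b0|exact: exprn_gt0|].
  by rewrite q_rho -exprM lerDr.
rewrite -powR_mulrn ?(ltW rp) // -powRrM.
have -> : (2 * k.+1)%:R * - b = - (d%:R - 2) :> R.
  rewrite /b natrM; have : k.+1%:R != 0 :> R by rewrite pnatr_eq0.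
  by move: k.+1%:R => K K0; field.
rewrite -powR_inv1 ?(ltW rp) //; apply: ler_powR => //.
by have := dR; lra.
Qed.

Lemma ball_test_function_admissible : cap_admissible (ecball y r) ball_test_function.
Proof.
split; first exact: smooth_ball_test_function.
  by move=> x /ecball_sub; exact: ball_test_function_ge1.
move=> e e0; pose T := Num.max 1 (2 `^ b / e).
have T1 : 1 <= T by rewrite le_max lexx.
have T2 : 2 `^ b / e <= T by rewrite le_max lexx orbT.
exists (r * T + enorm y) => x xM.
have rT : T < rho x.
  rewrite ltr_pdivlMr // mulrC.
  have := enorm_triangle (x - y) y; rewrite subrK; lra.
have r1 : 1 <= rho x by exact: ltW (le_lt_trans T1 rT).
rewrite ger0_norm ?mulr_ge0 ?powR_ge0 //.
apply: le_lt_trans (ler_wpM2l (powR_ge0 2 b) (base_pow r1)) _.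
rewrite ltr_pdivrMr; last by exact: lt_le_trans r1.
by rewrite mulrC -ltr_pdivrMr //; exact: le_lt_trans rT.
Qed.

(** Dropping the summand 1 in the base leaves, whatever [k] is, the exponent of the squared gradient
    of rho^(2-d); only the factor 2^(2b) exceeds the limit. *)
Lemma ball_test_function_gradient_out x : 1 <= rho x ->
  \sum_i partial_derivative i ball_test_function x ^+ 2 <=
  (2 `^ (2 * b) * (d%:R - 2) ^+ 2 / r ^+ 2) * rho x `^ (- (2 * (d%:R - 1))).
Proof.
move=> r1; have rp : 0 < rho x by exact: lt_le_trans r1.
rewrite sum_sqr_partial_ball_test_function ler_wpM2l //.
  by rewrite divr_ge0 ?sqr_ge0 // mulr_ge0 ?powR_ge0 ?sqr_ge0.
apply: (@le_trans _ _ ((rho x ^+ (2 * k.+1)) `^ (- (2 * b) - 2) * q x ^+ (2 * k + 1))).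
  apply: ler_wpM2r; first exact: exprn_ge0.
  rewrite -opprD; apply: powRN_le; [by have := b0; lra|exact: exprn_gt0|].
  by rewrite q_rho -exprM lerDr.
rewrite q_rho -exprM -!powR_mulrn ?(ltW rp) // -powRrM -powRD_gt0 //.
rewrite le_eqVlt; apply/orP; left; apply/eqP; congr (_ `^ _).
have K0 : k.+1%:R != 0 :> R by rewrite pnatr_eq0.
rewrite /b !(natrM, natrD) (_ : k%:R = k.+1%:R - 1); last by rewrite -natr1 addrK.
by move: k.+1%:R K0 => K K0; field.
Qed.

(** A power of rho growing with [k], so the contribution of the open ball tends to 0. *)
Lemma ball_test_function_gradient_in x :
  \sum_i partial_derivative i ball_test_function x ^+ 2 <=
  (2 `^ (2 * b) * (d%:R - 2) ^+ 2 / r ^+ 2) * rho x ^+ (4 * k + 2).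
Proof.
rewrite sum_sqr_partial_ball_test_function ler_wpM2l //.
  by rewrite divr_ge0 ?sqr_ge0 // mulr_ge0 ?powR_ge0 ?sqr_ge0.
have -> : rho x ^+ (4 * k + 2) = q x ^+ (2 * k + 1).
  by rewrite q_rho -exprM; congr (_ ^+ _); rewrite mulnDr mulnA.
rewrite ler_piMl ?exprn_ge0 // -opprD.
apply: (@le_trans _ _ (1 `^ (- (2 * b + 2)))); last by rewrite powR1.
apply: powRN_le => //; first by have := b0; lra.
by rewrite lerDl exprn_ge0.
Qed.

End ball_test_function.

Section capacity_of_balls.
Context {R : realType} {d : nat}.
Implicit Types (y : 'rV[R]_d) (r : R).

Lemma measurable_rho y r : measurable_fun setT (fun x : 'rV[R]_d => enorm (x - y) / r).
Proof.
apply: measurable_funM => //; apply: continuous_measurable_fun_rV.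
exact: continuous_enormB.
Qed.

Lemma measurable_outside y r : measurable [set x : 'rV[R]_d | r <= enorm (x - y)].
Proof.
rewrite (_ : mkset _ = ~` eball y r); first by apply: measurableC; exact: measurable_eball.
by apply/seteqP; split => x; rewrite /eball /= leNgt => /negP.
Qed.

(** In place of polar coordinates the volume [phi] of the ball through x is taken as variable. Its
    distribution outside the ball is that of Lebesgue measure on [v, +oo[, and the integrand is (phi
    / v)^(-a) with a = 2 (d - 1) / d. *)
Lemma integral_outside_ball y r : (3 <= d)%N -> 0 < r ->
  (\int[lebesgue_rV d]_(x in [set x : 'rV[R]_d | r <= enorm (x - y)]%R)
      ((enorm (x - y) / r) `^ (- (2 * (d%:R - 1))))%:E <=
   (@unit_ball_volume R d * r ^+ d * d%:R / (d%:R - 2))%:E)%E.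
Proof.
move=> d3 r0; have dR : 3 <= d%:R :> R by rewrite ler_nat.
have d0 : (0 < d)%N by exact: leq_trans d3.
have w0 := @unit_ball_volume_gt0 R d; set w := unit_ball_volume.
pose phi (x : 'rV[R]_d) := w * enorm (x - y) ^+ d.
pose v := w * r ^+ d; have v0 : 0 < v by rewrite mulr_gt0 // exprn_gt0.
pose a : R := 2 * (d%:R - 1) / d%:R.
have a1 : 1 < a by rewrite /a ltr_pdivlMr; lra.
have mphi : measurable_fun setT phi.
  apply: measurable_funM => //; apply: measurable_funX; apply: continuous_measurable_fun_rV.
  exact: continuous_enormB.
set S := [set x | _].
have mS : measurable S by exact: measurable_outside.
have phiv x : S x -> v <= phi x.
  by move=> Sx; rewrite ler_pM2l // lerXn2r ?nnegrE ?enorm_ge0 // ltW.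
have distr t : v <= t -> (lebesgue_rV_sf (S `&` [set x | (phi x <= t)%R]) <= (t - v)%:E)%E.
  move=> vt; have t0 : 0 < t by exact: lt_le_trans vt.
  have [u u0 ud] : exists2 u : R, 0 < u & u ^+ d = t / w.
    apply: expr_surj_gt0; first exact: divr_gt0.
    by move=> dd; rewrite dd in d0.
  have -> : S `&` [set x | phi x <= t] = [set x | enorm (x - y) <= u] `\` eball y r.
    have E x : (phi x <= t) = (enorm (x - y) <= u).
      rewrite /phi mulrC -ler_pdivlMr // -ud ler_pXn2r ?nnegrE ?enorm_ge0 ?(ltW u0) //.
    apply/seteqP; split => x /=; rewrite E /S /eball /=.
      by case=> h ->; split => //; apply/negP; rewrite -leNgt.
    by case=> -> /negP; rewrite -leNgt.
  rewrite /lebesgue_rV_sf measureD; last 3 first.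
  - exact: measurable_enorm_ball.
  - exact: measurable_eball.
  - exact: lebesgue_enorm_ball_lty.
  have ru : r <= u.
    rewrite -(@ler_pXn2r _ d) ?nnegrE ?(ltW r0) ?(ltW u0) // ud.
    by rewrite ler_pdivlMr // mulrC.
  rewrite (_ : _ `&` _ = eball y r); last first.
    apply/seteqP; split => x; first by case.
    by move=> h; split => //=; apply: le_trans ru; exact: ltW.
  rewrite /= lebesgue_enorm_ball // lebesgue_eball // -EFinB lee_fin ud.
  by rewrite mulrC divfK // gt_eqF.
have H := @integral_powRN_le R _ _ (@lebesgue_rV_sf R d) S phi v a mS mphi v0 a1 phiv distr.
rewrite (eq_integral (fun x => (v `^ a)%:E * (phi x `^ (- a))%:E)%E); last first.
  move=> x; rewrite inE => Sx; rewrite -EFinM; congr EFin.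
  have e0 : 0 < enorm (x - y) by exact: lt_le_trans Sx.
  have -> : enorm (x - y) / r = (phi x / v) `^ d%:R^-1.
    have -> : phi x / v = (enorm (x - y) / r) ^+ d.
      by rewrite /phi /v expr_div_n; field; rewrite !gt_eqF // exprn_gt0.
    rewrite -powR_mulrn ?divr_ge0 ?(ltW e0) ?(ltW r0) // -powRrM mulfV; last lra.
    by rewrite powRr1 // divr_ge0 ?(ltW e0) ?(ltW r0).
  rewrite -powRrM.
  have -> : d%:R^-1 * - (2 * (d%:R - 1)) = - a by rewrite /a; field; lra.
  have p0 : 0 < phi x by rewrite mulr_gt0 // exprn_gt0.
  rewrite powRM ?invr_ge0 ?(ltW p0) ?(ltW v0) // mulrC; congr (_ * _).
  by rewrite -powR_inv1 ?(ltW v0) // -powRrM mulN1r opprK.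
rewrite ge0_integralZl //; last 3 first.
- apply: measurable_funTS; apply/measurable_EFinP.
  exact: (measurableT_comp (measurable_powR (- a))).
- by move=> x _; rewrite lee_fin powR_ge0.
- by rewrite lee_fin powR_ge0.
apply: (le_trans (lee_wpmul2l _ H)); first by rewrite lee_fin powR_ge0.
rewrite -EFinM lee_fin mulrA -powRD_gt0 // addrC subrK powRr1; last exact: ltW.
by rewrite le_eqVlt; apply/orP; left; apply/eqP; rewrite /v /a; field; apply/andP; split; lra.
Qed.

(** The ball is split at radius r th. By Bernoulli the outer shell has volume at most v d (1 - th)
    <= e/2, and on the inner ball the integrand is at most th^n, which tends to 0. *)
Lemma integral_inside_ball y r (e : R) : (0 < d)%N -> 0 < r -> 0 < e ->
  exists N, forall n, (N <= n)%N ->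
  (\int[lebesgue_rV d]_(x in eball y r) ((enorm (x - y) / r) ^+ n)%:E <= e%:E)%E.
Proof.
move=> d0 r0 e0.
have w0 := @unit_ball_volume_gt0 R d.
pose v := @unit_ball_volume R d * r ^+ d; have v0 : 0 < v by rewrite mulr_gt0 // exprn_gt0.
have dR : 0 < d%:R :> R by rewrite ltr0n.
pose z := Num.min (2^-1) (e / 2 / (v * d%:R)).
have z0 : 0 < z by rewrite lt_min invr_gt0 ltr0n /= !divr_gt0 // mulr_gt0.
have z1 : z <= 2^-1 by rewrite ge_min lexx.
have z2 : z <= e / 2 / (v * d%:R) by rewrite ge_min lexx orbT.
pose th := 1 - z; have th0 : 0 < th by rewrite /th; lra.
have th1 : th < 1 by rewrite /th; lra.
have thd : v * (1 - th ^+ d) <= e / 2.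
  have := ler_expr_tangent d.-1 (ltW th0) (@ler01 R).
  rewrite prednK // !expr1n mulr1 => h.
  have h1 : 1 - th ^+ d <= d%:R * z by rewrite /th in h *; lra.
  apply: le_trans (ler_wpM2l (ltW v0) h1) _.
  by rewrite mulrA mulrC -ler_pdivlMr // mulr_gt0.
have e2 : 0 < e / 2 / v by rewrite !divr_gt0.
have /cvgrPdist_le/(_ _ e2) : (th ^+ n @[n --> \oo]) --> (0 : R).
  by apply: cvg_expr; rewrite gtr0_norm.
move=> [N _ HN]; exists N => n Nn.
have thn : th ^+ n <= e / 2 / v.
  by have := HN n Nn; rewrite sub0r normrN ger0_norm // exprn_ge0 // ltW.
pose A := [set x : 'rV[R]_d | enorm (x - y) < r * th].
have rth : 0 < r * th by rewrite mulr_gt0.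
have AE : A = eball y (r * th) by [].
have mA : measurable A by rewrite AE; exact: measurable_eball.
have mB := measurable_eball y r.
have AB : A `<=` eball y r.
  by move=> x; rewrite /A /eball /=; move/lt_trans; apply; rewrite gtr_pMr.
have mD : measurable (eball y r `\` A) by exact: measurableD.
have rho_le x : eball y r x -> enorm (x - y) / r <= 1.
  by rewrite /eball /= => h; rewrite ler_pdivrMr // mul1r ltW.
have rho0 x : 0 <= enorm (x - y) / r by rewrite divr_ge0 ?enorm_ge0 // ltW.
apply: (@le_trans _ _ (\int[lebesgue_rV d]_(x in eball y r)
    ((th ^+ n)%:E + (\1_(eball y r `\` A) x)%:E))%E).
  apply: ge0_le_integral => //.
  - by move=> x _; rewrite lee_fin exprn_ge0.
  - apply: measurable_funTS; apply/measurable_EFinP; apply: measurable_funX.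
    exact: measurable_rho.
  - apply: measurable_funTS; under eq_fun do rewrite -EFinD; apply/measurable_EFinP.
    by apply: measurable_funD => //; exact: measurable_indic.
  move=> x Bx; rewrite -EFinD lee_fin indicE.
  have [xA|xA] := ltP (enorm (x - y)) (r * th).
    have h : enorm (x - y) / r <= th by rewrite ler_pdivrMr // mulrC ltW.
    apply: (@le_trans _ _ (th ^+ n)); last by rewrite lerDl.
    by rewrite lerXn2r ?nnegrE // ltW.
  have -> : x \in eball y r `\` A.
    by rewrite inE; split => //; rewrite /A /= ltNge xA.
  apply: (@le_trans _ _ 1); first by rewrite exprn_ile1 // rho_le.
  by rewrite /= lerDr exprn_ge0 // ltW.
rewrite ge0_integralD //; last 2 first.
- by move=> x _; rewrite lee_fin exprn_ge0 // ltW.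
- by apply: measurable_funTS; apply/measurable_EFinP; exact: measurable_indic.
rewrite integral_cst // integral_indic // setIidl; last by move=> x [].
rewrite measureD //; last exact: lebesgue_eball_lty.
rewrite (setIidr AB) AE /= (lebesgue_eball y rth) (lebesgue_eball y r0).
rewrite -EFinB -EFinM -EFinD lee_fin -/v.
have -> : @unit_ball_volume R d * (r * th) ^+ d = v * th ^+ d.
  by rewrite exprMn mulrA.
have : th ^+ n * v <= e / 2 by rewrite -ler_pdivlMr.
by move: thd; rewrite mulrBr mulr1; lra.
Qed.

(** Applied to A = 2^(d-2), it makes the normalizing factor 2^(2b) of the test function tend to
    1. *)
Lemma powR_inv_le (A h : R) : 0 < A -> 0 < h ->
  exists N, forall k, (N <= k)%N -> A `^ (k.+1%:R^-1) <= 1 + h.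
Proof.
move=> A0 h0; exists (Num.truncn (A / h)) => k Nk.
have k0 : 0 < k.+1%:R :> R by [].
have Ak : A <= (1 + h) ^+ k.+1.
  have h1 : 0 <= 1 + h by lra.
  have := ler_expr_tangent k h1 (@ler01 R).
  rewrite !expr1n mulr1 addrAC subrr add0r; apply: le_trans.
  have : A / h < k.+1%:R.
    by apply: lt_le_trans (truncnS_gt _) _; rewrite ler_nat.
  by rewrite ltr_pdivrMr //; lra.
have -> : 1 + h = ((1 + h) ^+ k.+1) `^ k.+1%:R^-1.
  by rewrite -powR_mulrn -?powRrM ?mulfV ?powRr1 ?gt_eqF //; lra.
by apply: ge0_ler_powR; rewrite ?nnegrE ?invr_ge0 ?exprn_ge0 // ?(ltW A0) //; lra.
Qed.

Lemma dirichlet_ball_test_function y r k : (3 <= d)%N -> 0 < r ->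
  (dirichlet (ball_test_function y r k) <=
   ((2 `^ (d%:R - 2)) `^ (k.+1%:R^-1) * ((d%:R - 2) ^+ 2 / r ^+ 2))%:E *
   (\int[lebesgue_rV d]_(x in eball y r) ((enorm (x - y) / r) ^+ (4 * k + 2))%:E +
    (@unit_ball_volume R d * r ^+ d * d%:R / (d%:R - 2))%:E))%E.
Proof.
move=> d3 r0; have dR : 3 <= d%:R :> R by rewrite ler_nat.
set c := (2 `^ _) `^ _ * _.
have cE : c = 2 `^ (2 * ((d%:R - 2) / (2 * k.+1%:R))) * (d%:R - 2) ^+ 2 / r ^+ 2.
  rewrite /c -powRrM -mulrA; congr (_ `^ _ * _).
  by have : k.+1%:R != 0 :> R; [rewrite pnatr_eq0|move: k.+1%:R => K K0; field].
have c0 : 0 <= c by rewrite /c mulr_ge0 ?powR_ge0 // divr_ge0 ?sqr_ge0.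
have sm : smooth (ball_test_function y r k) by exact: smooth_ball_test_function.
have cp i : continuous (partial_derivative i (ball_test_function y r k)).
  by have [] := sm [:: i].
pose F x := (\sum_i partial_derivative i (ball_test_function y r k) x ^+ 2)%:E.
have mF : measurable_fun setT F.
  apply/measurable_EFinP; apply: continuous_measurable_fun_rV.
  apply: continuous_bigsum => i x.
  apply: (@continuous_comp _ _ _ (partial_derivative i (ball_test_function y r k)) (fun t => t ^+ 2)).
    exact: cp.
  exact: exprn_continuous.
have F0 x : (0 <= F x)%E by rewrite lee_fin sumr_ge0 // => i _; exact: sqr_ge0.
rewrite /dirichlet -/F.
have -> : [set: 'rV[R]_d] = eball y r `|` [set x | r <= enorm (x - y)].
  by apply/seteqP; split => // x _; rewrite /eball /=; case: ltP; [left|right].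
have mB := measurable_eball y r; have mC := measurable_outside y r.
rewrite ge0_integral_setU //; last 3 first.
- exact: measurable_funTS.
- by move=> x _; exact: F0.
- by apply/disj_setPS => x []; rewrite /eball /= ltNge => /negP.
rewrite ge0_muleDr; last 2 first.
- by apply: integral_ge0 => x _; rewrite lee_fin exprn_ge0 // divr_ge0 ?enorm_ge0 // ltW.
- rewrite lee_fin divr_ge0 ?mulr_ge0 ?exprn_ge0 ?(ltW r0) ?(ltW (unit_ball_volume_gt0)) //; lra.
apply: leeD.
  rewrite -ge0_integralZl //; last 2 first.
  - apply: measurable_funTS; apply/measurable_EFinP; apply: measurable_funX.
    exact: measurable_rho.
  - by move=> x _; rewrite lee_fin exprn_ge0 // divr_ge0 ?enorm_ge0 // ltW.
  apply: ge0_le_integral => //.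
  - by move=> x _; exact: F0.
  - exact: measurable_funTS.
  - apply: measurable_funTS; under eq_fun do rewrite -EFinM; apply/measurable_EFinP.
    by apply: measurable_funM => //; apply: measurable_funX; exact: measurable_rho.
  move=> x _; rewrite -EFinM lee_fin cE.
  exact: ball_test_function_gradient_in.
apply: le_trans (lee_wpmul2l _ (integral_outside_ball y d3 r0)) => //.
rewrite -ge0_integralZl //; last 2 first.
- apply: measurable_funTS; apply/measurable_EFinP.
  apply: (measurableT_comp (measurable_powR _)); exact: measurable_rho.
- by move=> x _; rewrite lee_fin powR_ge0.
apply: ge0_le_integral => //.
- by move=> x _; exact: F0.
- exact: measurable_funTS.
- apply: measurable_funTS; under eq_fun do rewrite -EFinM; apply/measurable_EFinP.
  apply: measurable_funM => //.
  apply: (measurableT_comp (measurable_powR _)); exact: measurable_rho.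
move=> x /= rx; rewrite -EFinM lee_fin cE.
by apply: ball_test_function_gradient_out => //; rewrite ler_pdivlMr // mul1r.
Qed.

Lemma compact_cap_ball_le y r : (3 <= d)%N -> 0 < r ->
  (compact_cap (ecball y r) <=
   (d%:R * (d%:R - 2) * @unit_ball_volume R d * r ^+ d / r ^+ 2)%:E)%E.
Proof.
move=> d3 r0; have dR : 3 <= d%:R :> R by rewrite ler_nat.
have w0 := @unit_ball_volume_gt0 R d.
pose A := @unit_ball_volume R d * r ^+ d * d%:R / (d%:R - 2).
pose c0 := (d%:R - 2) ^+ 2 / r ^+ 2.
have A0 : 0 < A by rewrite divr_gt0 ?mulr_gt0 ?exprn_gt0 //; lra.
have c00 : 0 < c0 by rewrite divr_gt0 ?exprn_gt0 //; lra.
have -> : d%:R * (d%:R - 2) * @unit_ball_volume R d * r ^+ d / r ^+ 2 = c0 * A.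
  by rewrite /c0 /A; field; apply/andP; split; [lra|rewrite gt_eqF].
apply/lee_addgt0Pr => e e0.
(* The bound becomes (1 + h) (e/4 + c0 A): the factor contributes h c0 A <= e/2, and the integral
   over the ball e/4 plus at most another e/4 since h <= 1. *)
pose h := Num.min 1 (e / 2 / (c0 * A)); pose ep := e / (4 * c0).
have h0 : 0 < h by rewrite lt_min ltr01 !divr_gt0 // mulr_gt0.
have h1 : h <= 1 by rewrite ge_min lexx.
have h3 : h <= e / 2 / (c0 * A) by rewrite ge_min lexx orbT.
have h2 : h * (c0 * A) <= e / 2 by move: h3; rewrite ler_pdivlMr // mulr_gt0.
have ep0 : 0 < ep by rewrite divr_gt0 // mulr_gt0.
have [N1 HN1] := integral_inside_ball y (leq_trans (isT : (0 < 3)%N) d3) r0 ep0.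
have [N2 HN2] := @powR_inv_le (2 `^ (d%:R - 2)) h (powR_gt0 _ (ltr0n R 2)) h0.
pose k := maxn N1 N2.
apply: (@le_trans _ _ (dirichlet (ball_test_function y r k))).
  apply: ereal_inf_lbound; exists (ball_test_function y r k) => //.
  exact: ball_test_function_admissible.
apply: (le_trans (dirichlet_ball_test_function y k d3 r0)).
have H1 := HN1 (4 * k + 2)%N.
have H2 := HN2 k (leq_maxr _ _).
set P := (2 `^ _) `^ _ in H2 *.
have P0 : 0 <= P by exact: powR_ge0.
apply: (@le_trans _ _ ((P * c0)%:E * (ep%:E + A%:E))%E).
  apply: lee_wpmul2l; first by rewrite lee_fin mulr_ge0 // ltW.
  apply: leeD => //; apply: H1.
  by apply: (leq_trans (leq_maxl N1 N2)); rewrite -/k; lia.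
rewrite -EFinD -EFinM -EFinD lee_fin.
have ec : c0 * ep = e / 4 by rewrite /ep; field; rewrite gt_eqF.
have H3 : P * (c0 * ep + c0 * A) <= (1 + h) * (c0 * ep + c0 * A).
  by rewrite ler_wpM2r // addr_ge0 // mulr_ge0 // ltW.
have H4 : h * (c0 * ep) <= c0 * ep by rewrite ler_piMl // mulr_ge0 // ltW.
rewrite ec in H3 H4.
have -> : P * c0 * (ep + A) = P * (e / 4 + c0 * A) by rewrite -ec; ring.
set X := c0 * A in h2 H3 *; lra.
Qed.

End capacity_of_balls.

(** * Inner regularity *)

Section inner_regularity.
Context {R : realType} {d : nat}.
Let leb := @lebesgue_rV R d.

Lemma nonincreasing_measure_small (D : nat -> set 'rV[R]_d) (e : R) :
  (forall n, measurable (D n)) -> (forall m n, (m <= n)%N -> D n `<=` D m) ->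
  (leb (D 0%N) < +oo)%E -> (leb (\bigcap_n D n) < e%:E)%E ->
  exists n, (leb (D n) <= e%:E)%E.
Proof.
move=> mD dD D0 De; apply: contrapT => /forallNP h.
have mI : measurable (\bigcap_n D n) by exact: bigcapT_measurable.
have dD' : {homo D : n m / (n <= m)%N >-> (m <= n)%O}.
  by move=> m n mn; apply/subsetPset; exact: dD.
have c := nonincreasing_cvg_mu D0 mD mI dD'.
move: De; rewrite -(cvg_lim _ c) // ltNge => /negP; apply.
apply: lime_ge; first by apply/cvg_ex; exists (leb (\bigcap_n D n)).
by apply: nearW => n /=; apply: ltW; rewrite ltNge; apply/negP; exact: h.
Qed.

(** The gap is measured inside [K] only, where the measure is finite. Asking for both a closed and
    an open approximation makes the property stable under complements. *)
Definition squeezable (K A : set 'rV[R]_d) := forall e : R, 0 < e ->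
  exists F U, [/\ closed F, open U, F `<=` A, A `<=` U &
    (leb ((U `\` F) `&` K) <= e%:E)%E].

Variable K : set 'rV[R]_d.
Hypotheses (mK : measurable K) (K_fin : (leb K < +oo)%E).

Lemma open_squeezable (U : set 'rV[R]_d) : open U -> squeezable K U.
Proof.
move=> oU e e0.
(* The points at sup-norm distance at least 1/(n+1) from the complement of [U]. *)
pose F (n : nat) := [set x : 'rV[R]_d | forall w : 'rV[R]_d,
  (forall j, `|w 0 j - x 0 j| < n.+1%:R^-1) -> U w].
have cF n : closed (F n).
  rewrite -[F n]setCK closedC.
  have -> : ~` F n = \bigcup_(w in ~` U) [set x : 'rV[R]_d | forall j, `|w 0 j - x 0 j| < n.+1%:R^-1].
    apply/seteqP; split => x /=.
      by move=> /existsNP[w /not_implyP[h nU]]; exists w.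
    by case=> w nU h /(_ w h).
  apply: bigcup_open => w _; rewrite openE => x xw; rewrite /interior.
  suff : \forall z \near (nbhs x), forall j, `|w 0 j - (z : 'rV[R]_d) 0 j| < n.+1%:R^-1 by [].
  apply: filter_forall => j.
  have cj : continuous (fun z : 'rV[R]_d => `|w 0 j - z 0 j|).
    move=> z; apply: (@continuous_comp _ _ _ (fun z : 'rV[R]_d => w 0 j - z 0 j)
      (fun t : R => `|t|)); last exact: norm_continuous.
    by apply: continuousB; [exact: cst_continuous|exact: coord_continuous].
  have := @open_comp _ _ _ [set t : R | t < n.+1%:R^-1] (fun z _ => cj z) (@open_lt R _).
  by move=> o; apply: (open_nbhs_nbhs (conj o (xw j))).
have FU n : F n `<=` U by move=> x; apply => j; rewrite subrr normr0 invr_gt0.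
have mF n : measurable (F n) by exact: closed_measurable_rV.
have mU : measurable U by exact: open_measurable_rV.
pose D n := (U `\` F n) `&` K.
have mD n : measurable (D n) by apply: measurableI => //; exact: measurableD.
have [|||n Dn] := @nonincreasing_measure_small D e mD.
- move=> m n mn x [[Ux nF] Kx]; split => //; split => // Fm; apply: nF => w wx.
  apply: Fm => j; apply: lt_le_trans (wx j) _.
  by rewrite lef_pV2 ?posrE // ler_nat.
- by apply: le_lt_trans K_fin; apply: le_measure; rewrite ?inE // => x [].
- rewrite (_ : \bigcap_n D n = set0) ?measure0 ?lte_fin //.
  apply/seteqP; split => // x Dx; have [[Ux _] _] := Dx 0%N I.
  have /nbhs_ballP[r /= r0 rU] : nbhs x U by exact: open_nbhs_nbhs.
  have [[_ nF] _] := Dx (Num.truncn r^-1) I.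
  apply: nF => w wx; apply: rU; split => // i j; rewrite ord1 /ball /= distrC.
  apply: lt_trans (wx j) _; rewrite invf_plt ?posrE //.
  exact: truncnS_gt.
by exists (F n), U; split.
Qed.

Lemma squeezableC (A : set 'rV[R]_d) : squeezable K A -> squeezable K (~` A).
Proof.
move=> sA e e0; have [F [U [cF oU FA AU h]]] := sA e e0.
exists (~` U), (~` F); split.
- by rewrite closedC.
- by rewrite openC.
- exact: subsetC.
- exact: subsetC.
by move: h; rewrite !setDE setCK [~` F `&` U]setIC.
Qed.

Lemma squeezable_bigcup (A : nat -> set 'rV[R]_d) :
  (forall n, squeezable K (A n)) -> squeezable K (\bigcup_n A n).
Proof.
move=> sA e e0.
have e2 : 0 < e / 2 by rewrite divr_gt0.
have en n : 0 < e / 2 / (2 ^ n.+1)%:R by rewrite divr_gt0 // ltr0n expn_gt0.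
pose P n (p : set 'rV[R]_d * set 'rV[R]_d) := [/\ closed p.1, open p.2,
   p.1 `<=` A n, A n `<=` p.2 &
   (leb ((p.2 `\` p.1) `&` K) <= (e / 2 / (2 ^ n.+1)%:R)%:E)%E].
have H n : {p | P n p}.
  by apply: cid; have [F [U h]] := sA n _ (en n); exists (F, U).
pose F n := (sval (H n)).1; pose U n := (sval (H n)).2.
have HP n : P n (F n, U n) by rewrite /F /U; case: (H n) => -[].
have cF n : closed (F n) by have [] := HP n.
have oU n : open (U n) by have [] := HP n.
have FA n : F n `<=` A n by have [] := HP n.
have AU n : A n `<=` U n by have [] := HP n.
have mF n : measurable (F n) by exact: closed_measurable_rV.
have mU n : measurable (U n) by exact: open_measurable_rV.
pose G := \bigcup_n U n.
have oG : open G by exact: bigcup_open.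
have mG : measurable G by exact: open_measurable_rV.
(* Only finite unions of the closed sets are closed. The remainders [D n] decrease to a set of
   measure at most e/2, so some [D n] has measure at most e. *)
pose C n := \big[setU/set0]_(i < n) F i.
have cC n : closed (C n) by exact: closed_bigsetU.
have mC n : measurable (C n) by exact: closed_measurable_rV.
have CE n : C n = \bigcup_(i < n) F i by rewrite bigcup_mkord.
pose D n := (G `\` C n) `&` K.
have mD n : measurable (D n) by apply: measurableI => //; exact: measurableD.
have [|||n Dn] := @nonincreasing_measure_small D e mD.
- move=> m n mn x [[Gx nC] Kx]; split => //; split => //; rewrite CE => -[i im Fi].
  by apply: nC; rewrite CE; exists i => //=; exact: leq_trans mn.
- by apply: le_lt_trans K_fin; apply: le_measure; rewrite ?inE // => x [].
- apply: (@le_lt_trans _ _ (e / 2)%:E); last by rewrite lte_fin; lra.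
  pose S n := (U n `\` F n) `&` K.
  have mS n : measurable (S n) by apply: measurableI => //; exact: measurableD.
  apply: (@le_trans _ _ (\sum_(0 <= n <oo) leb (S n))%E).
    apply: measure_sigma_subadditive => //; first exact: bigcapT_measurable.
    move=> x Dx; have [[[n _ Un] _] Kx] := Dx 0%N I.
    exists n => //; split => //; split => // Fn.
    by have [[_ nC] _] := Dx n.+1 I; apply: nC; rewrite CE; exists n => /=.
  apply: le_trans (@epsilon_trick0 R (e / 2) xpredT (ltW e2)).
  by apply: lee_nneseries => // n _; have [] := HP n.
exists (C n), G; split => //.
- by rewrite CE => x [i _ /FA]; exists i.
- by move=> x [i _ /AU]; exists i.
Qed.

Lemma measurable_squeezable (A : set 'rV[R]_d) : measurable A -> squeezable K A.
Proof.
apply: smallest_sub; last by move=> U; exact: open_squeezable.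
split.
- by apply: open_squeezable; exact: open0.
- by move=> B sB; rewrite setTD; exact: squeezableC.
- exact: squeezable_bigcup.
Qed.

End inner_regularity.

Lemma compact_inner_regular {R : realType} {d : nat} (K A : set 'rV[R]_d) (e : R) :
  compact K -> (lebesgue_rV d K < +oo)%E -> measurable A -> A `<=` K -> 0 < e ->
  exists E, [/\ compact E, E `<=` A & (lebesgue_rV d (A `\` E) <= e%:E)%E].
Proof.
move=> cK Kfin mA AK e0.
have clK : closed K by apply: compact_closed => //; exact: norm_hausdorff.
have mK : measurable K by exact: closed_measurable_rV.
have [F [U [cF oU FA AU h]]] := measurable_squeezable mK Kfin mA e0.
exists F; split => //.
  exact: (subclosed_compact cF cK (subset_trans FA AK)).
apply: le_trans h; apply: le_measure; rewrite ?inE.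
- by apply: measurableD => //; exact: closed_measurable_rV.
- apply: measurableI => //; apply: measurableD.
    exact: open_measurable_rV.
  exact: closed_measurable_rV.
by move=> x [Ax nF]; split; [split => //; exact: AU|exact: AK].
Qed.
(** * Densities f' o s *)

Section rearrangement_bounds.
Context {R : realType} {dd : measure_display} {T : measurableType dd}.
Variable m : {sigma_finite_measure set T -> \bar R}.
Variables (A : set T) (s : T -> R) (al : R).
Hypotheses (mA : measurable A) (ms : measurable_fun setT s).
Hypotheses (al0 : 0 < al) (al1 : al < 1) (s0 : forall x, A x -> 0 <= s x).
Let leb : {measure set (measurableTypeR R) -> \bar R} := @lebesgue_measure R.
Let b := al^-1.

Let b1 : 1 < b.
Proof. by rewrite /b invf_gt1. Qed.

Let mh : measurable_fun setT (fun x => s x `^ (- al)).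
Proof. exact: (measurableT_comp (measurable_powR (- al))). Qed.

Let mlevel t : measurable (A `&` [set x | t <= s x `^ (- al)]).
Proof. by apply: measurableI => //; exact: measurable_ler_set. Qed.

Let msublevel t : measurable (A `&` [set x | s x <= t]).
Proof. by apply: measurableI => //; exact: measurable_ler_set. Qed.

Let total (a : R) : 0 < a ->
  (\int[leb]_(t in `[0%R, +oo[) (if t < a `^ (- al) then a else t `^ (- b))%:E =
   (a `^ (1 - al) / (1 - al))%:E)%E.
Proof.
move=> a0; have h1 := al0; have h2 := al1; have h3 := b1.
rewrite integral_cst_powRN ?(ltW a0) ?powR_gt0 //; congr EFin.
rewrite -powRrM.
have -> : - al * (1 - b) = 1 - al by rewrite /b; field; lra.
have -> : a * a `^ (- al) = a `^ (1 - al).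
  by rewrite powRD_gt0 // powRr1 // ltW.
have : b * al = 1 by rewrite /b mulVf //; lra.
have -> : b = al^-1 by [].
by move=> _; field; lra.
Qed.

(** For t > 0 the inequality s^(-al) >= t forces s <= t^(-b), so this level set has mass at most
    min(a, t^(-b)), whose integral over t is [total]. *)
Lemma integral_powRN_sublevel_le (a : R) : 0 < a -> a <= 1 -> (m A <= a%:E)%E ->
  (forall v, 0 <= v <= 1 -> (m (A `&` [set x | s x <= v]%R) <= v%:E)%E) ->
  (\int[m]_(x in A) (s x `^ (- al))%:E <= (a `^ (1 - al) / (1 - al))%:E)%E.
Proof.
move=> a0 a1 mAa msv; have h1 := al0; have h3 := b1.
rewrite layer_cake_ge //; last by move=> x; exact: powR_ge0.
rewrite -total //; apply: ge0_le_integral => //.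
- apply: measurable_funTS.
  pose Q : set (T * measurableTypeR R) := [set p | A p.1 /\ p.2 <= s p.1 `^ (- al)].
  have mQ : measurable Q.
    rewrite (_ : Q = (fst @^-1` A) `&` [set p | p.2 <= s p.1 `^ (- al)]) //.
    apply: measurableI.
      by rewrite -[X in measurable X]setTI; exact: measurable_fst.
    apply: (@measurable_ler_set _ _ _ (fun p : T * measurableTypeR R => p.2)
      (fun p => s p.1 `^ (- al))); first exact: measurable_snd.
    exact: (measurableT_comp mh).
  have := @measurable_fun_ysection _ _ _ _ R m _ mQ.
  congr measurable_fun; apply/funext => t; congr (m _).
  by apply/seteqP; split => x; rewrite /ysection /= inE.
- apply/measurable_EFinP; apply: measurable_funTS.
  apply: (@measurable_fun_ifT _ _ _ _ (cst a) (fun x => x `^ (- b))) => //.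
  exact: measurable_fun_ltr.
move=> t; rewrite /= in_itv /= andbT => t0.
case: ltP => [_|ht].
  by apply: le_trans mAa; apply: le_measure; rewrite ?inE // => x [].
have tp : 0 < t by apply: lt_le_trans ht; rewrite powR_gt0.
have tb : t `^ (- b) <= a.
  apply: le_trans (powRN_le _ _ ht) _; [lra|by rewrite powR_gt0|].
  by rewrite -powRrM mulrNN /b mulfV ?powRr1 ?(ltW a0) //; lra.
apply: le_trans (msv (t `^ (- b)) _); last by rewrite powR_ge0 (le_trans tb).
apply: le_measure; rewrite ?inE // => x [Ax /= tx]; split => //=.
(* [powR] is 0 at base 0 for a nonzero exponent, so a zero of [s] lies in no level set with t >
   0. *)
have sp : 0 < s x.
  rewrite lt0r s0 // andbT; apply/eqP => sx0; move: tx.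
  by rewrite sx0 powR0 ?oppr_eq0 ?gt_eqF // leNgt tp.
have := powRN_le (ltW (lt_trans ltr01 h3)) tp tx.
by rewrite -powRrM mulrNN /b mulfV ?powRr1 ?(ltW sp) //; lra.
Qed.

(** When the distribution of [s] is exactly uniform, the level sets of s^(-al) have mass min(1,
    t^(-b)) and nothing is lost. *)
Lemma integral_powRN_sublevel_eq : m A = 1%E -> (forall x, A x -> s x <= 1) ->
  (forall v, 0 <= v <= 1 -> m (A `&` [set x | s x <= v]) = v%:E) ->
  (\int[m]_(x in A) (s x `^ (- al))%:E = (1 - al)^-1%:E)%E.
Proof.
move=> mA1 s1 msv; have h1 := al0; have h3 := b1.
have := total ltr01; rewrite !powR1 mul1r => <-.
rewrite layer_cake_ge //; last by move=> x; exact: powR_ge0.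
have m0 : m (A `&` [set x | s x <= 0]) = 0%E by apply: msv; rewrite lexx ler01.
apply: eq_integral => t; rewrite inE /= in_itv /= andbT => t0.
apply/eqP; rewrite eq_le; apply/andP; split.
  case: ltP => [_|ht].
    by rewrite -mA1; apply: le_measure; rewrite ?inE // => x [].
  have tp : 0 < t by exact: lt_le_trans ht.
  have tb : t `^ (- b) <= 1.
    by apply: le_trans (powRN_le _ ltr01 ht) _; [exact: ltW (lt_trans ltr01 h3)|rewrite powR1].
  rewrite -msv; last by rewrite powR_ge0.
  apply: le_measure; rewrite ?inE // => x [Ax /= tx]; split => //=.
  have sp : 0 < s x.
    rewrite lt0r s0 // andbT; apply/eqP => sx0; move: tx.
    by rewrite sx0 powR0 ?oppr_eq0 ?gt_eqF // leNgt tp.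
  have := powRN_le (ltW (lt_trans ltr01 h3)) tp tx.
  by rewrite -powRrM mulrNN /b mulfV ?gt_eqF // powRr1 ?(ltW sp).
(* The zeros of [s] satisfy s <= v but miss the level set; they are added back at no cost since they
   form a null set. *)
have key v : measurable (A `&` [set x | s x <= v]) ->
    (forall x, A x -> 0 < s x -> s x <= v -> t <= s x `^ (- al)) ->
    (m (A `&` [set x | (s x <= v)%R]) <= m (A `&` [set x | (t <= s x `^ (- al))%R]))%E.
  move=> mv hv; rewrite -[leRHS]adde0 -m0.
  apply: (@le_trans _ _ (m ((A `&` [set x | t <= s x `^ (- al)]) `|` (A `&` [set x | s x <= 0])))).
    apply: le_measure; rewrite ?inE //; first exact: measurableU.
    move=> x [Ax /= sv]; have [sp|sn] := ltP 0 (s x); last by right.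
    by left; split => //=; exact: hv.
  exact: measureU2.
case: ltP => [t1|ht].
  have -> : 1%:E = m (A `&` [set x | s x <= 1]) by rewrite msv // ler01 lexx.
  apply: key => // x Ax sp sx1; apply: le_trans (ltW t1) _.
  have := powRN_le (ltW h1) sp sx1; by rewrite powR1.
have tp : 0 < t by exact: lt_le_trans ht.
rewrite -msv; last first.
  rewrite powR_ge0 /=.
  by apply: le_trans (powRN_le _ ltr01 ht) _; [exact: ltW (lt_trans ltr01 h3)|rewrite powR1].
apply: key => // x Ax sp sx; have := powRN_le (ltW h1) sp sx.
by rewrite -powRrM mulrNN /b mulVf ?gt_eqF // powRr1 ?(ltW tp).
Qed.

End rearrangement_bounds.

Section density_bounds.
Context {R : realType} {dd : measure_display} {T : measurableType dd}.
Variables (m : {measure set T -> \bar R}) (K : set T) (q : R).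
Hypothesis mK : measurable K.

(** What has to be known about a density. The lower bound gives equivalence with Lebesgue measure,
    the upper bound both inner regularity and domination by the capacity, the last clause the total
    mass. Each clause is convex and closed in L1. *)
Definition density_bounds (h : T -> R) : Prop :=
  [/\ m.-integrable K (EFin \o h),
    forall A, measurable A -> A `<=` K ->
      (q%:E * m A <= \int[m]_(x in A) (h x)%:E <= (fine (m A) `^ q)%:E)%E &
    (\int[m]_(x in K) (h x)%:E = 1)%E].

Lemma density_bounds_convex n (c : 'I_n -> R) (h : 'I_n -> T -> R) :
  (m K < +oo)%E -> (forall i, 0 <= c i) -> \sum_i c i = 1 ->
  (forall i, density_bounds (h i)) ->
  density_bounds (fun x => \sum_i c i * h i x).
Proof.
move=> Kfin c0 c1 hB.
have ih i : m.-integrable K (fun x => ((c i)%:E * (h i x)%:E)%E).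
  by apply: integrableZl => //; have [] := hB i.
have E : (EFin \o (fun x => \sum_i c i * h i x)) =
    (fun x => (\sum_i (c i)%:E * (h i x)%:E)%E).
  apply/funext => x /=; rewrite -sumEFin.
  by apply: eq_bigr => i _; rewrite EFinM.
have intE A : measurable A -> A `<=` K ->
    (\int[m]_(x in A) (\sum_i c i * h i x)%:E =
     \sum_i (c i)%:E * \int[m]_(x in A) (h i x)%:E)%E.
  move=> mA AK; rewrite -[X in integral _ _ X]/(EFin \o (fun x => \sum_i c i * h i x)) E.
  have ihA i : m.-integrable A (fun x => ((c i)%:E * (h i x)%:E)%E).
    exact: integrableS (ih i).
  rewrite (integral_sum mA ihA); apply: eq_bigr => i _.
  by rewrite integralZl //; have [hi _ _] := hB i; exact: integrableS hi.
split.
- by rewrite E; apply: integrable_sum.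
- move=> A mA AK; rewrite intE //; apply/andP; split.
    rewrite -[leLHS]mul1e -c1 -sumEFin ge0_sume_distrl; last by move=> i _; rewrite lee_fin.
    apply: lee_sum => i _; apply: lee_wpmul2l; first by rewrite lee_fin.
    by have [_ /(_ A mA AK) /andP[]] := hB i.
  rewrite -[leRHS]mul1e -c1 -sumEFin ge0_sume_distrl; last by move=> i _; rewrite lee_fin.
  apply: lee_sum => i _; apply: lee_wpmul2l; first by rewrite lee_fin.
  by have [_ /(_ A mA AK) /andP[]] := hB i.
rewrite intE // -[RHS]/(1%:E) -c1 -sumEFin; apply: eq_bigr => i _.
by have [_ _ ->] := hB i; rewrite mule1.
Qed.

(** For each [A] the integral over [A] moves by at most the L1 distance on [K]. *)
Lemma density_bounds_L1 (g : T -> R) : (m K < +oo)%E ->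
  m.-integrable K (EFin \o g) ->
  (forall e : R, 0 < e -> exists2 h, density_bounds h &
     (\int[m]_(x in K) `|g x - h x|%:E < e%:E)%E) ->
  density_bounds g.
Proof.
move=> Kfin ig gh.
have igA A : measurable A -> A `<=` K -> m.-integrable A (EFin \o g).
  by move=> mA AK; exact: integrableS ig.
have approx A e : measurable A -> A `<=` K -> 0 < e -> exists2 h, density_bounds h &
    [/\ (\int[m]_(x in A) (g x)%:E <= \int[m]_(x in A) (h x)%:E + e%:E)%E &
    (\int[m]_(x in A) (h x)%:E <= \int[m]_(x in A) (g x)%:E + e%:E)%E].
  move=> mA AK e0; have [h hB he] := gh e e0; exists h => //.
  have [ih _ _] := hB.
  have ihA : m.-integrable A (EFin \o h) by exact: integrableS ih.
  have fg := integrable_fin_num mA (igA A mA AK).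
  have fh := integrable_fin_num mA ihA.
  have igh : m.-integrable K (EFin \o (fun x => g x - h x)).
    rewrite (_ : EFin \o _ = (EFin \o g) \- (EFin \o h))%E //.
    exact: integrableB.
  have D : (`|\int[m]_(x in A) (g x)%:E - \int[m]_(x in A) (h x)%:E| <= e%:E)%E.
    rewrite -(integralB_EFin mA (igA A mA AK) ihA); apply: ltW.
    apply: le_lt_trans he.
    apply: (@le_trans _ _ (\int[m]_(x in A) `|g x - h x|%:E)%E).
      apply: (le_abse_integral m mA (f := EFin \o (fun x => g x - h x))).
      by apply: measurable_funS mK AK _; have /integrableP[] := igh.
    apply: ge0_subset_integral => //.
    have /integrableP[mgh _] := igh.
    exact: (measurableT_comp (f := @abse R) _ mgh).
  move: D fg fh; case: integral => // a; case: integral => // b' D _ _.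
  move: D; rewrite -EFinB /= lee_fin ler_norml => /andP[h1 h2].
  by rewrite -!EFinD !lee_fin; split; lra.
split => //.
  move=> A mA AK; apply/andP; split; apply/lee_addgt0Pr => e e0;
    have [h [_ /(_ A mA AK)/andP[l u] _] [h1 h2]] := approx A e mA AK e0.
    exact: le_trans l h2.
  by apply: le_trans h1 _; exact: leeD2r.
apply/eqP; rewrite eq_le; apply/andP; split; apply/lee_addgt0Pr => e e0;
  have [h [_ _ E] [h1 h2]] := approx K e mK (@subset_refl _ K) e0; rewrite E in h1 h2.
  exact: h1.
exact: h2.
Qed.

End density_bounds.

Lemma normalized_lebesgue_sigma_finite {R : realType} {d : nat} (y : 'rV[R]_d) (r : R) :
  sigma_finite setT (normalized_lebesgue y r).
Proof.
have [F FT Fn] := @lebesgue_rV_sigma_finite R d; exists F => // n.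
have [mF Foo] := Fn n; split => //.
by rewrite /normalized_lebesgue /mscale /= lte_mul_pinfty // lee_fin.
Qed.

HB.instance Definition _ (R : realType) (d : nat) (y : 'rV[R]_d) (r : R) :=
  @Measure_isSigmaFinite.Build _ _ _ (normalized_lebesgue y r)
    (@normalized_lebesgue_sigma_finite R d y r).

(** * Set functions dominated by the capacity *)

Section ball_measures.
Context {R : realType} {d : nat}.
Variables (y : 'rV[R]_d) (r : R).
Hypotheses (d3 : (3 <= d)%N) (r0 : 0 < r).

Let K := ecball y r.
Let m := normalized_lebesgue y r.
Let q : R := (d%:R - 2) / d%:R.
Let v : R := @unit_ball_volume R d * r ^+ d.

Lemma ball_volume_gt0 : 0 < v.
Proof. by rewrite mulr_gt0 ?unit_ball_volume_gt0 // exprn_gt0. Qed.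

Lemma exponent_gt0 : 0 < q.
Proof.
have dR : 3 <= d%:R :> R by rewrite ler_nat.
by rewrite /q divr_gt0; lra.
Qed.

Lemma normalized_lebesgueE (A : set 'rV[R]_d) : m A = (v^-1%:E * lebesgue_rV d A)%E.
Proof.
rewrite /m /normalized_lebesgue /mscale /=; congr (_%:E * _)%E.
by rewrite lebesgue_eball.
Qed.

Lemma closed_ecball : closed K.
Proof. exact: closed_closure. Qed.

Lemma measurable_ecball : measurable K.
Proof. by apply: closed_measurable_rV; exact: closed_ecball. Qed.

Lemma compact_ecball : compact K.
Proof.
have [k [_ kE]] := @enorm_ball_bounded R d y r.
apply: (subclosed_compact closed_ecball (@compact_norm_le R d k)).
by move=> x /ecball_sub /kE h i; have := h i; rewrite !mxE -ltr_norml => /ltW.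
Qed.

Lemma lebesgue_ecball_lty : (lebesgue_rV d K < +oo)%E.
Proof.
apply: le_lt_trans (lebesgue_enorm_ball_lty y r).
apply: le_measure; rewrite ?inE; [exact: measurable_ecball|exact: measurable_enorm_ball|].
exact: ecball_sub.
Qed.

Lemma normalized_ecball_lty : (m K < +oo)%E.
Proof.
rewrite normalized_lebesgueE lte_mul_pinfty ?lebesgue_ecball_lty //.
by rewrite lee_fin invr_ge0 ltW // ball_volume_gt0.
Qed.

Lemma density_bounds_measure_preserving (s : 'rV[R]_d -> R) :
  measure_preserving y r s ->
  density_bounds m K q (derive1 (fun t : R => t `^ q) \o s).
Proof.
move=> [msK s01 spres].
have dR : 3 <= d%:R :> R by rewrite ler_nat.
have q0 := exponent_gt0.
pose al : R := 1 - q.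
have al0 : 0 < al.
  by rewrite /al /q subr_gt0 ltr_pdivrMr; lra.
have al1 : al < 1 by rewrite /al; lra.
have mK := measurable_ecball.
(* [s] is controlled on [K] only; its extension by 0 is measurable and nonnegative everywhere. *)
pose s' := s \_ K.
have ms' : measurable_fun setT s' by exact/(measurable_restrictT _ _).1.
have s'E x : K x -> s' x = s x by move=> Kx; rewrite /s' patchE mem_set.
have s'0 x : 0 <= s' x.
  rewrite /s' patchE; case: ifPn => //; rewrite inE => Kx.
  by have /andP[] := s01 x Kx.
have s'1 x : K x -> s' x <= 1.
  by move=> Kx; rewrite s'E //; have /andP[] := s01 x Kx.
have dist t : 0 <= t <= 1 -> m (K `&` [set x | s' x <= t]) = t%:E.
  move=> /andP[t0 t1].
  have sub : (`[0, t]%classic : set R) `<=` `[0, 1]%classic.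
    by apply: subset_itvl; rewrite bnd_simp.
  have := spres _ (measurable_itv _) sub.
  rewrite lebesgue_measure_itv /= lte_fin oppr0 adde0.
  have -> : ecball y r `&` s @^-1` `[0, t] = K `&` [set x | s' x <= t].
    apply/seteqP; split => x [Kx] /=; rewrite s'E // in_itv /=.
      by case/andP.
    by move=> h; split => //; rewrite h andbT; have /andP[] := s01 x Kx.
  rewrite /m => ->; case: ltP => // h; have -> : t = 0 by apply/eqP; rewrite eq_le h t0.
  by [].
have mK1 : m K = 1%E.
  rewrite -(dist 1) ?ler01 ?lexx //; congr (m _); apply/seteqP; split => x; last by case.
  by move=> Kx; split => //=; exact: s'1.
pose N0 := K `&` [set x | s' x <= 0].
have mN0 : measurable N0 by apply: measurableI => //; exact: measurable_ler_set.
have N00 : m N0 = 0%E by apply: dist; rewrite lexx ler01.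
pose H x := derive1 (fun t : R => t `^ q) (s x).
pose G x := q * s' x `^ (- al).
have HG x : K x -> 0 < s' x -> H x = G x.
  move=> Kx sp; rewrite /H /G -s'E // powR_derive1 ?in_itv /= ?andbT //.
  by rewrite /al opprB.
have mG : measurable_fun setT G.
  by apply: measurable_funM => //; exact: (measurableT_comp (measurable_powR (- al))).
(* The value at the null set of zeros of [s] is free. The actual value of [derive1] at 0 yields
   measurability, c = 0 agrees with [G] by the convention for powers of 0, and c = q gives the
   pointwise lower bound. *)
pose ifpos (c : R) x := if 0 < s' x then G x else c.
have mif c : measurable_fun setT (ifpos c).
  apply: measurable_fun_ifT => //; exact: measurable_fun_ltr.
have mH : measurable_fun K H.
  apply: (@eq_measurable_fun _ _ _ _ _ (ifpos (derive1 (fun t : R => t `^ q) 0))).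
    move=> x; rewrite inE => Kx; rewrite /ifpos; case: ltP => [sp|sn].
      by rewrite HG.
    by rewrite /H -s'E // (_ : s' x = 0) //; apply/eqP; rewrite eq_le sn s'0.
  exact: measurable_funTS.
have ae (c : R) A : A `<=` K -> ae_eq m A (EFin \o H) (EFin \o ifpos c).
  move=> AK; exists N0; split => // x /= /not_implyP[Ax NE]; split; first exact: AK.
  rewrite /= leNgt; apply/negP => sp; apply: NE.
  by rewrite /ifpos sp HG //; exact: AK.
have intH (c : R) A : measurable A -> A `<=` K ->
    (\int[m]_(x in A) (H x)%:E = \int[m]_(x in A) (ifpos c x)%:E)%E.
  move=> mA AK; apply: ae_eq_integral => //.
  - by apply/measurable_EFinP; exact: measurable_funS mK AK mH.
  - by apply/measurable_EFinP; exact: measurable_funTS.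
  exact: ae.
have if0G x : ifpos 0 x = G x.
  rewrite /ifpos; case: ltP => // sn.
  have sx0 : s' x = 0 by apply/eqP; rewrite eq_le sn s'0.
  by rewrite /G sx0 powR0 ?mulr0 // oppr_eq0 gt_eqF.
have intG A : measurable A -> A `<=` K ->
    (\int[m]_(x in A) (H x)%:E = q%:E * \int[m]_(x in A) (s' x `^ (- al))%:E)%E.
  move=> mA AK; rewrite (intH 0) // -ge0_integralZl //.
  - by apply: eq_integral => x _; rewrite if0G EFinM.
  - apply: measurable_funTS; apply/measurable_EFinP.
    exact: (measurableT_comp (measurable_powR (- al))).
  - by move=> x _; rewrite lee_fin powR_ge0.
  - by rewrite lee_fin ltW.
have qal : 1 - al = q by rewrite /al; ring.
have qq (x : R) : q * (x / q) = x by rewrite mulrC divfK // gt_eqF.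
have total : (\int[m]_(x in K) (H x)%:E = 1)%E.
  rewrite intG // (@integral_powRN_sublevel_eq _ _ _ m K s' al mK ms' al0 al1 (fun x _ => s'0 x) mK1 s'1 dist).
  by rewrite qal -EFinM mulfV // gt_eqF.
have mle A : measurable A -> A `<=` K -> (m A <= 1)%E.
  by move=> mA AK; rewrite -mK1; apply: le_measure; rewrite ?inE.
split => //.
- apply/integrableP; split; first exact/measurable_EFinP.
  have -> : (\int[m]_(x in K) `|(EFin \o H) x| = \int[m]_(x in K) (ifpos 0 x)%:E)%E.
    apply: ae_eq_integral => //.
    + by apply: measurableT_comp => //; exact/measurable_EFinP.
    + by apply/measurable_EFinP; exact: measurable_funTS.
    exists N0; split => // x /= /not_implyP[Kx NE]; split => //.
    rewrite /= leNgt; apply/negP => sp; apply: NE.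
    rewrite /ifpos sp HG // ger0_norm // mulr_ge0 ?powR_ge0 // ltW //.
  by rewrite -intH // total ltry.
move=> A mA AK; apply/andP; split.
  rewrite (intH q) // -integral_cst //; apply: ge0_le_integral => //.
  - by move=> x _; rewrite lee_fin ltW.
  - by apply: measurable_funTS; exact/measurable_EFinP.
  move=> x Ax; rewrite lee_fin /ifpos; case: ltP => // sp.
  rewrite /G ler_peMr ?(ltW q0) //.
  have := powRN_le (ltW al0) sp (s'1 x (AK x Ax)).
  by rewrite powR1.
have mAfin : m A \is a fin_num.
  by rewrite ge0_fin_numE // (le_lt_trans (mle A mA AK)) // ltry.
have [A0|A0] := eqVneq (m A) 0%E.
  rewrite -[X in (_ <= X)%E]/((fine (m A) `^ q)%:E) A0 /= powR0 ?gt_eqF // null_set_integral //.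
  by apply/measurable_EFinP; exact: measurable_funS mK AK mH.
have a0 : 0 < fine (m A) by rewrite fine_gt0 // lt0e A0 measure_ge0 /= -ge0_fin_numE.
have a1 : fine (m A) <= 1 by rewrite -lee_fin fineK // mle.
rewrite intG //.
have := @integral_powRN_sublevel_le _ _ _ m A s' al mA ms' al0 al1 (fun x _ => s'0 x) (fine (m A)) a0 a1.
rewrite fineK // => /(_ (lexx _)) h.
apply: (le_trans (lee_wpmul2l _ (h _))); first by rewrite lee_fin ltW.
  move=> t t01; rewrite -dist //; apply: le_measure; rewrite ?inE.
  - by apply: measurableI => //; exact: measurable_ler_set.
  - by apply: measurableI => //; exact: measurable_ler_set.
  by move=> x [/AK Kx ?].
by rewrite -EFinM lee_fin qal qq.
Qed.

Let C : R := d%:R * (d%:R - 2) * @unit_ball_volume R d * r ^+ d / r ^+ 2.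

Lemma ball_capacity_gt0 : 0 < C.
Proof.
have dR : 3 <= d%:R :> R by rewrite ler_nat.
have w0 := @unit_ball_volume_gt0 R d.
rewrite divr_gt0 ?exprn_gt0 // mulr_gt0 ?exprn_gt0 // !mulr_gt0 //; lra.
Qed.

(** The bound on the Dirichlet integral, normalized by the ball: kap^2 = w^(2/d) = v^(1-q) / r^2
    turns d (d - 2) kap^2 a^q into C (a / v)^q. For a = v it meets the upper bound of the test
    functions. *)
Lemma compact_cap_ge (E : set 'rV[R]_d) (a : R) : measurable E -> 0 < a ->
  (a%:E <= lebesgue_rV d E)%E -> ((C * (a / v) `^ q)%:E <= compact_cap E)%E.
Proof.
move=> mE a0 aE; have dR : 3 <= d%:R :> R by rewrite ler_nat.
have w0 := @unit_ball_volume_gt0 R d; have v0 := ball_volume_gt0.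
apply: le_ereal_inf_tmp => _ [u uE <-].
apply: le_trans (dirichlet_ge d3 uE mE a0 aE); rewrite -/q.
set kap := unit_ball_volume `^ _.
have k2 : kap ^+ 2 = v / r ^+ 2 / v `^ q.
  have -> : v / r ^+ 2 / v `^ q = v `^ (1 - q) / r ^+ 2.
    rewrite powRD_gt0 // powRr1 ?(ltW v0) // powRN; field.
    by rewrite !gt_eqF // powR_gt0.
  have -> : 1 - q = 2 / d%:R by rewrite /q; field; lra.
  rewrite /v powRM ?(ltW w0) ?exprn_ge0 ?(ltW r0) //.
  have -> : (r ^+ d) `^ (2 / d%:R) = r ^+ 2.
    rewrite -powR_mulrn ?(ltW r0) // -powRrM (_ : d%:R * (2 / d%:R) = 2%:R).
      by rewrite powR_mulrn // ltW.
    by field; lra.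
  rewrite mulfK ?gt_eqF ?exprn_gt0 //.
  rewrite /kap -powR_mulrn ?powR_ge0 // -powRrM; congr (_ `^ _).
  by rewrite mulrC.
rewrite lee_fin k2 powRM ?invr_ge0 ?(ltW a0) ?(ltW v0) //.
rewrite -[v^-1]powR_inv1 ?(ltW v0) // -powRrM mulN1r powRN /C -/v.
rewrite le_eqVlt; apply/orP; left; apply/eqP; rewrite /v.
by field; rewrite !gt_eqF // powR_gt0.
Qed.

Lemma cap_ecball : cap K = C%:E.
Proof.
rewrite cap_compact; last exact: compact_ecball.
apply/eqP; rewrite eq_le; apply/andP; split; first exact: compact_cap_ball_le.
have := @compact_cap_ge K v measurable_ecball ball_volume_gt0.
rewrite divff ?gt_eqF ?ball_volume_gt0 // powR1 mulr1; apply.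
rewrite -(lebesgue_eball y r0); apply: le_measure; rewrite ?inE.
- exact: measurable_eball.
- exact: measurable_ecball.
- exact: subset_closure.
Qed.

End ball_measures.

Section representation.
Context {R : realType} {d : nat}.
Variables (y : 'rV[R]_d) (r : R).
Hypotheses (d3 : (3 <= d)%N) (r0 : 0 < r).

Let K := ecball y r.
Let m := normalized_lebesgue y r.
Let q : R := (d%:R - 2) / d%:R.
Let v : R := @unit_ball_volume R d * r ^+ d.
Let C : R := d%:R * (d%:R - 2) * @unit_ball_volume R d * r ^+ d / r ^+ 2.

(** Inner regularity comes first: since cap(A) is a supremum over compact subsets of [A], once mu(A)
    is one too, the domination by the capacity need only be checked on compact sets. *)
Lemma BP_eq_of_density (g : 'rV[R]_d -> R) (mu : set 'rV[R]_d -> \bar R) :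
  density_bounds m K q g ->
  (forall A, borel_in K A -> mu A = (C%:E * \int[m]_(x in A) (g x)%:E)%E) ->
  BP_eq y r mu.
Proof.
move=> [ig bg tg] muE.
have mK : measurable K by exact: measurable_ecball.
have q0 : 0 < q by exact: exponent_gt0.
have v0 : 0 < v by exact: ball_volume_gt0.
have C0 : 0 < C by exact: ball_capacity_gt0.
pose I A := (\int[m]_(x in A) (g x)%:E)%E.
have mEl A : m A = (v^-1%:E * lebesgue_rV d A)%E by exact: normalized_lebesgueE.
have I0 A : borel_in K A -> (0 <= I A)%E.
  move=> [mA AK]; have /andP[h _] := bg A mA AK; apply: le_trans h.
  by rewrite mule_ge0 // lee_fin ltW.
have igA A : borel_in K A -> m.-integrable A (EFin \o g).
  by move=> [mA AK]; exact: integrableS ig.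
have Ifin A : borel_in K A -> I A \is a fin_num.
  by move=> bA; apply: integrable_fin_num (igA A bA); case: bA.
have ID A B : borel_in K A -> borel_in K B -> A `&` B = set0 ->
    I (A `|` B) = (I A + I B)%E.
  move=> bA bB AB; have [mA AK] := bA; have [mB BK] := bB.
  apply: integral_setU => //; last by apply/disj_setPS; rewrite AB.
  have /integrableP[h _] := ig; apply: measurable_funS mK _ h.
  by move=> x [/AK|/BK].
have bK : borel_in K K by split.
have bD A E : borel_in K A -> borel_in K E -> borel_in K (A `\` E).
  by move=> [mA AK] [mE EK]; split; [exact: measurableD|move=> x [/AK]].
have Isplit A E : borel_in K A -> borel_in K E -> E `<=` A -> I A = (I E + I (A `\` E))%E.
  move=> bA bE EA; rewrite -ID ?setDUK //; first exact: bD.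
  by rewrite setDE setICA setICr setI0.
have bcompact E : compact E -> E `<=` K -> borel_in K E.
  move=> cE EK; split => //; apply: closed_measurable_rV.
  by apply: compact_closed => //; exact: norm_hausdorff.
have reg A : borel_in K A ->
    mu A = ereal_sup [set mu E | E in [set E | compact E /\ E `<=` A]].
  move=> bA; have [mA AK] := bA; apply/eqP; rewrite eq_le; apply/andP; split; last first.
    apply: ge_ereal_sup => _ [E [cE EA] <-].
    have bE := bcompact E cE (subset_trans EA AK).
    rewrite !muE //; apply: lee_wpmul2l; first by rewrite lee_fin ltW.
    by rewrite -/(I E) -/(I A) (Isplit A E) // leeDl // I0 //; exact: bD.
  apply/lee_addgt0Pr => e e0.
  (* Solves C de^q = e, so a remainder of normalized volume at most [de] has mu-mass at most [e]. *)
  pose de := (e / C) `^ q^-1.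
  have de0 : 0 < de by rewrite powR_gt0 // divr_gt0.
  have vde : 0 < v * de by rewrite mulr_gt0.
  have [E [cE EA hE]] := compact_inner_regular (compact_ecball (y := y) (r := r))
    (lebesgue_ecball_lty y r) mA AK vde.
  have bE := bcompact E cE (subset_trans EA AK).
  apply: (@le_trans _ _ (mu E + e%:E)%E); last first.
    by apply: leeD2r; apply: ereal_sup_ubound; exists E.
  rewrite !muE // -/(I E) -/(I A) (Isplit A E) // muleDr //; last first.
    by rewrite fin_num_adde_defr // Ifin.
  apply: leeD2l; have bAE := bD A E bA bE; have [mAE AEK] := bAE.
  have /andP[_ h] := bg (A `\` E) mAE AEK.
  apply: (le_trans (lee_wpmul2l _ h)); first by rewrite lee_fin ltW.
  rewrite -EFinM lee_fin mulrC -ler_pdivlMr //.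
  have -> : e / C = de `^ q.
    by rewrite /de -powRrM mulVf ?powRr1 ?gt_eqF // ltW // divr_gt0.
  have mAEde : (m (A `\` E) <= de%:E)%E.
    by rewrite mEl lee_pdivrMl // -EFinM.
  apply: ge0_ler_powR; rewrite ?nnegrE ?fine_ge0 ?(ltW q0) ?(ltW de0) //.
  rewrite -lee_fin fineK // ge0_fin_numE //.
  by apply: le_lt_trans mAEde _; rewrite ltry.
have mule0P A : borel_in K A -> (mu A = 0%E <-> lebesgue_rV d A = 0%E).
  move=> bA; have [mA AK] := bA; rewrite muE //; have /andP[l u] := bg A mA AK; split.
    move=> /eqP; rewrite mule_eq0 eqe gt_eqF //= => /eqP IA0.
    have l' : (q%:E * (v^-1%:E * lebesgue_rV d A) <= I A)%E by rewrite -mEl.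
    apply/eqP; rewrite eq_le measure_ge0 andbT.
    have qv0 : 0 < q * v^-1 by rewrite mulr_gt0 ?invr_gt0.
    by move: l'; rewrite [I A]IA0 muleA -EFinM pmule_rle0.
  move=> A0; have u' : (I A <= (fine (v^-1%:E * lebesgue_rV d A) `^ q)%:E)%E.
    by rewrite -mEl.
  move: u'; rewrite A0 mule0 /= powR0 ?gt_eqF // => u'.
  have IA0 : I A = 0%E by apply/eqP; rewrite eq_le u' I0.
  by rewrite [X in (_ * X)%E]IA0 mule0.
split => //.
  split.
  - by move=> A bA; rewrite muE // mule_ge0 ?lee_fin ?(ltW C0) // I0.
  - move=> A B bA bB AB; have [mA AK] := bA; have [mB BK] := bB.
    rewrite !muE //; last by split; [exact: measurableU|move=> x [/AK|/BK]].
    by rewrite -/(I _) ID // muleDr // fin_num_adde_defr // Ifin.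
  - move=> A bA; have [mA AK] := bA; rewrite reg //.
    apply: ge_ereal_sup => _ [E [cE EA] <-].
    have bE := bcompact E cE (subset_trans EA AK); have [mE EK] := bE.
    apply: (@le_trans _ _ (compact_cap E)); last by apply: ereal_sup_ubound; exists E.
    have /andP[_ h] := bg E mE EK.
    have h' : (I E <= (fine (v^-1%:E * lebesgue_rV d E) `^ q)%:E)%E by rewrite -mEl.
    rewrite muE //; apply: (le_trans (lee_wpmul2l _ h')); first by rewrite lee_fin ltW.
    have Efin : lebesgue_rV d E \is a fin_num.
      rewrite ge0_fin_numE // (le_lt_trans _ (lebesgue_ecball_lty y r)) //.
      by apply: le_measure; rewrite ?inE.
    rewrite fineM // /= -EFinM.
    (* The capacity-volume inequality asks for positive volume; for a null set the left side
       vanishes and the Dirichlet integrals are nonnegative. *)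
    have [E0|E0] := eqVneq (lebesgue_rV d E) 0%E.
      rewrite E0 /= mulr0 powR0 ?gt_eqF // mulr0; apply: le_ereal_inf_tmp => _ [u _ <-].
      by apply: integral_ge0 => x _; rewrite lee_fin sumr_ge0 // => i _; exact: sqr_ge0.
    rewrite [v^-1 * _]mulrC; apply: compact_cap_ge => //; last by rewrite fineK.
    by rewrite fine_gt0 // lt0e E0 measure_ge0 /= -ge0_fin_numE.
  - by rewrite muE // -/m tg mule1 cap_ecball.
split => //.
- move=> F bF tF.
  have bU : borel_in K (\bigcup_n F n).
    split; first by apply: bigcupT_measurable => n; have [] := bF n.
    by move=> x [n _]; have [_] := bF n; apply.
  rewrite muE // integral_bigcup //; last 2 first.
  - by move=> n; have [] := bF n.
  - exact: igA.
  rewrite -nneseriesZl; last by move=> n _; exact: I0.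
  by apply: eq_eseriesr => n _; rewrite muE.
- move=> E cE EK; have bE := bcompact E cE EK.
  by rewrite muE // -/(I E) -(fineK (Ifin E bE)) -EFinM ltry.
Qed.

End representation.

Theorem propositionA2 (R : realType) (d : nat) (hd : (3 <= d)%N)
    (y : 'rV[R]_d) (r : R) (hr : 0 < r) :
  M_f (fun t : R => t `^ ((d%:R - 2) / d%:R)) y r `<=` BP_eq y r.
Proof.
move=> mu [g [ig gh] muE].
have mK : measurable (ecball y r) by exact: measurable_ecball.
have Kfin : (normalized_lebesgue y r (ecball y r) < +oo)%E.
  exact: normalized_ecball_lty.
have gB : density_bounds (normalized_lebesgue y r) (ecball y r) ((d%:R - 2) / d%:R) g.
  apply: (density_bounds_L1 mK Kfin ig) => e e0.
  have [h [n [c [hs [c0 c1 hsS ->]]]] he] := gh e e0.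
  exists (fun x => \sum_i c i * hs i x) => //.
  apply: (density_bounds_convex mK Kfin c0 c1) => i.
  by have [s sP <-] := hsS i; exact: density_bounds_measure_preserving.
apply: (BP_eq_of_density hd hr gB) => A [mA AK].
rewrite muE //.
(* The densities are scaled by the capacity of the ball about 0, whose value does not depend on the
   centre. *)
rewrite (cap_ecball 0 hd hr) integralZl //.
exact: integrableS ig.
Qed.
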